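(* Let $\Omega\subset\mathbb{R}^3$ be a bounded convex domain and let $\varepsilon\in L^\infty(\Omega)^{3\times3}$ be self-adjoint with constants $\underline{\varepsilon},\overline{\varepsilon}>0$ such that $\underline{\varepsilon}\|\phi\|^2_{L^2(\Omega)}\le(\varepsilon\phi,\phi)_{L^2(\Omega)}\le\overline{\varepsilon}\|\phi\|^2_{L^2(\Omega)}$ for all $\phi\in L^2(\Omega)^3$. Then $c_{\mathrm m,\varepsilon}\le\max\{c_{\mathrm f,\varepsilon},\sqrt{\overline{\varepsilon}}\,c_{\mathrm p}\}$.
   Context: $\|\phi\|_\varepsilon^2=(\varepsilon\phi,\phi)_{L^2(\Omega)}$. $D(\Omega)=\{\phi\in L^2(\Omega)^3:\operatorname{div}\phi\in L^2\}$, $R(\Omega)=\{\phi\in L^2(\Omega)^3:\operatorname{rot}\phi\in L^2\}$ (weak operators), $\mathring{R}(\Omega)$ the closure of $C_c^\infty(\Omega)^3$ in the graph norm of $R(\Omega)$, $\varepsilon^{-1}D(\Omega)=\{\phi:\varepsilon\phi\in D(\Omega)\}$. The tangential Maxwell constant $c_{\mathrm m,\varepsilon}$ is the smallest constant with $\|\phi\|_\varepsilon\le c_{\mathrm m,\varepsilon}\sqrt{\|\operatorname{div}\varepsilon\phi\|^2_{L^2}+\|\operatorname{rot}\phi\|^2_{L^2}}$ for all $\phi\in\mathring{R}(\Omega)\cap\varepsilon^{-1}D(\Omega)$. $c_{\mathrm f,\varepsilon}$ is the smallest constant with $\|\varphi\|_{L^2}\le c_{\mathrm f,\varepsilon}\|\nabla\varphi\|_\varepsilon$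 for all $\varphi\in\mathring{H}^1(\Omega)$ (closure of $C_c^\infty(\Omega)$ in $H^1(\Omega)$). $c_{\mathrm p}$ is the smallest constant with $\|\varphi\|_{L^2}\le c_{\mathrm p}\|\nabla\varphi\|_{L^2}$ for all $\varphi\in H^1(\Omega)$ with zero mean. *)

(* Defs.v *)
From HB Require Import structures.
From mathcomp Require Import all_boot all_order all_algebra.
From mathcomp Require Import all_classical all_reals all_analysis.
Set Implicit Arguments. Unset Strict Implicit. Unset Printing Implicit Defensive.
Import Order.TTheory GRing.Theory Num.Theory numFieldNormedType.Exports.
Local Open Scope classical_set_scope.
Local Open Scope ring_scope.

Section Maxwell.
Variable R : realType.

Definition pt := ((R * R) * R)%type.

Definition leb3 := ((@lebesgue_measure R \x @lebesgue_measure R) \x @lebesgue_measure R)%E.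

Definition sfield := pt -> R.
Definition vfield := 'I_3 -> pt -> R.

Definition ev (i : 'I_3) : pt :=
  (((nat_of_ord i == 0%N)%:R, (nat_of_ord i == 1%N)%:R), (nat_of_ord i == 2%N)%:R).

Definition partial (i : 'I_3) (f : sfield) : sfield := fun x => 'D_(ev i) f x.

Definition i0 : 'I_3 := @Ordinal 3 0 isT.
Definition i1 : 'I_3 := @Ordinal 3 1 isT.
Definition i2 : 'I_3 := @Ordinal 3 2 isT.

Definition grad (f : sfield) : vfield := fun i => partial i f.
Definition div (u : vfield) : sfield := fun x => \sum_(i < 3) partial i (u i) x.
Definition rot (u : vfield) : vfield := fun i =>
  if nat_of_ord i == 0%N then partial i1 (u i2) \- partial i2 (u i1)
  else if nat_of_ord i == 1%N then partial i2 (u i0) \- partial i0 (u i2)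
  else partial i0 (u i1) \- partial i1 (u i0).

Definition dot (u v : vfield) : sfield := fun x => \sum_(i < 3) u i x * v i x.

Definition mmul (eps : pt -> 'M[R]_3) (u : vfield) : vfield :=
  fun i x => \sum_(j < 3) eps x i j * u j x.

(* C^infinity: all iterated partial derivatives exist everywhere and are continuous. *)
Definition smooth (f : sfield) : Prop :=
  exists S : set sfield, S f /\
    forall g, S g -> continuous g /\
      forall i, (forall x, derivable g x (ev i)) /\ S (partial i g).

Definition support (f : sfield) : set pt := [set x | f x != 0].

Definition test_fun (Omega : set pt) (f : sfield) : Prop :=
  smooth f /\ compact (closure (support f)) /\ closure (support f) `<=` Omega.

Definition test_vfield (Omega : set pt) (u : vfield) : Prop :=
  forall i, test_fun Omega (u i).

Definition L2 (Omega : set pt) (f : sfield) : Prop :=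
  measurable_fun Omega f /\ (\int[leb3]_(x in Omega) ((f x) ^+ 2)%:E < +oo)%E.
Definition vL2 (Omega : set pt) (u : vfield) : Prop := forall i, L2 Omega (u i).

Definition integ (Omega : set pt) (f : sfield) : R := Rintegral leb3 Omega f.
Definition nrm2 (Omega : set pt) (f : sfield) : R := integ Omega (fun x => f x ^+ 2).
Definition vnrm2 (Omega : set pt) (u : vfield) : R := integ Omega (dot u u).
Definition enrm2 (Omega : set pt) (eps : pt -> 'M[R]_3) (u : vfield) : R :=
  integ Omega (dot (mmul eps u) u).

Definition weak_grad (Omega : set pt) (f : sfield) (G : vfield) : Prop :=
  forall psi, test_vfield Omega psi ->
    integ Omega (fun x => f x * div psi x) = - integ Omega (dot G psi).
Definition weak_div (Omega : set pt) (u : vfield) (g : sfield) : Prop :=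
  forall psi, test_fun Omega psi ->
    integ Omega (dot u (grad psi)) = - integ Omega (fun x => g x * psi x).
Definition weak_rot (Omega : set pt) (u : vfield) (h : vfield) : Prop :=
  forall psi, test_vfield Omega psi ->
    integ Omega (dot u (rot psi)) = integ Omega (dot h psi).

Definition H1 (Omega : set pt) (f : sfield) (G : vfield) : Prop :=
  L2 Omega f /\ vL2 Omega G /\ weak_grad Omega f G.

Definition H10 (Omega : set pt) (f : sfield) (G : vfield) : Prop :=
  H1 Omega f G /\
  exists fn : nat -> sfield, (forall n, test_fun Omega (fn n)) /\
    (fun n => nrm2 Omega (fn n \- f)) @ \oo --> 0 /\
    (fun n => vnrm2 Omega (fun i => grad (fn n) i \- G i)) @ \oo --> 0.

Definition Rsp (Omega : set pt) (u h : vfield) : Prop :=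
  vL2 Omega u /\ vL2 Omega h /\ weak_rot Omega u h.

Definition Rcirc (Omega : set pt) (u : vfield) : Prop :=
  exists h, Rsp Omega u h /\
  exists un : nat -> vfield, (forall n, test_vfield Omega (un n)) /\
    (fun n => vnrm2 Omega (fun i => un n i \- u i)) @ \oo --> 0 /\
    (fun n => vnrm2 Omega (fun i => rot (un n) i \- h i)) @ \oo --> 0.

Definition c_m (Omega : set pt) (eps : pt -> 'M[R]_3) : \bar R :=
  ereal_inf [set c%:E | c in [set c : R | 0 <= c /\
    forall (u : vfield) (g : sfield) (h : vfield),
      Rcirc Omega u -> vL2 Omega (mmul eps u) ->
      L2 Omega g -> weak_div Omega (mmul eps u) g ->
      vL2 Omega h -> weak_rot Omega u h ->
      Num.sqrt (enrm2 Omega eps u) <= c * Num.sqrt (nrm2 Omega g + vnrm2 Omega h)]].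

Definition c_f (Omega : set pt) (eps : pt -> 'M[R]_3) : \bar R :=
  ereal_inf [set c%:E | c in [set c : R | 0 <= c /\
    forall (f : sfield) (G : vfield), H10 Omega f G ->
      Num.sqrt (nrm2 Omega f) <= c * Num.sqrt (enrm2 Omega eps G)]].

Definition c_p (Omega : set pt) : \bar R :=
  ereal_inf [set c%:E | c in [set c : R | 0 <= c /\
    forall (f : sfield) (G : vfield), H1 Omega f G -> integ Omega f = 0 ->
      Num.sqrt (nrm2 Omega f) <= c * Num.sqrt (vnrm2 Omega G)]].

Definition convex_set3 (Omega : set pt) : Prop :=
  forall x y, Omega x -> Omega y -> forall t : R, 0 <= t <= 1 ->
    Omega (t *: x + (1 - t) *: y).

End Maxwell.

(* Main.v *)
(** Let [c] be a Poincare constant of the convex domain [D]. The point is that every test field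
    [u] of [D] satisfies [inf_p ||u - grad p|| <= c ||rot u||], over test functions [p]. For [u] in
    the tangential space this gives the theorem, because
    [||u||_eps^2 = ||u - grad p||_eps^2 + 2 (eps u, grad p) - ||grad p||_eps^2], where the first
    term is at most [eps_hi ||u - grad p||^2], and where [2 a b - b^2 <= a^2] bounds the rest by
    [c_f^2 ||div eps u||^2].

    The approximation by gradients uses no regularity theory on [D]. Enclose [D] in a box and take
    a convex penalty [V >= 0] that vanishes on a slightly shrunk copy [W] of [D] containing the
    support of [u] and is large outside a compact polytope contained in [D]. On the box, for fields
    [Phi] with vanishing normal component and functions [q] with zero trace, the Bochner inequality
    [int e^-V |grad Phi|^2 <= int e^-V (|rot Phi|^2 + |div_V Phi|^2)] makes the system
    [e^-V rot Phi + grad q = u], [div_V Phi = 0] coercive. Starting from explicit trigonometric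
    sums for [V = 0], a continuity method along [t V] shows that the range of this system is dense.
    Then [int e^V |u - grad q|^2] is close to [int e^-V |rot Phi|^2], hence to
    [int_W Phi . rot u <= c ||rot u|| ||grad Phi||_W], by the Poincare inequality on [W].
    A Hardy inequality in terms of the penalty shows that [q] is small near the boundary of the
    polytope, so that it can be cut off there. *)
Require Import Defs.
From HB Require Import structures.
From mathcomp Require Import all_boot all_order all_algebra.
From mathcomp Require Import all_classical all_reals all_analysis.
From mathcomp Require Import measurable_realfun.
From mathcomp Require Import ring lra.
Set Implicit Arguments. Unset Strict Implicit. Unset Printing Implicit Defensive.
Import Order.TTheory GRing.Theory Num.Theory numFieldNormedType.Exports.
Local Open Scope classical_set_scope.
Local Open Scope ring_scope.

(** The inequality between [grad Phi], [rot Phi] and the divergence has in general a boundary term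
    given by the second fundamental form, hence the usual need for a smooth boundary. The faces of a
    box are flat and contribute nothing; the Hessian of the convex penalty plays the part of the
    nonnegative curvature. Its constant is exactly 1, and so [c] comes out unchanged: testing the
    system with [rot Phi] gives, up to small errors, [int e^-V |rot Phi|^2 <= c ||rot u|| (int e^-V
    |grad Phi|^2)^(1/2)], where the last factor is at most the square root of the left side. The
    weights are dual to each other: [e^-V] on [Phi] becomes [e^V] on [u - grad q], which is what
    makes [grad q] small where the penalty is large. Only finite trigonometric sums are ever put
    into the system, so solvability is replaced by density of the range, and the coercivity constant
    has to be uniform along [t V]. The shrunk copy [W] is a dilation of [D] by a factor at most 1:
    this does not increase the Poincare constant, and it leaves room between [W] and the complement
    of [D] for the penalty to grow. *)

Local Notation rot := Defs.rot.
Local Notation div := Defs.div.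

(** * Integration on three-dimensional space *)

Section Measure3.
Variable R : realType.
Local Notation mR := (measurableTypeR R).
Local Notation mpt := ((mR * mR) * mR)%type.
Local Notation mu := (@lebesgue_measure R).
Local Notation pt := (pt R).

Definition mu1 : {sigma_finite_measure set mR -> \bar R} := mu.
(** The inner product is named so that it can carry its own sigma-finite structure, which Fubini's
    theorem asks for when [mu3] is integrated slice by slice. *)
Definition mu2 : set (mR * mR)%type -> \bar R := (mu1 \x mu1)%E.
HB.instance Definition _ := Measure.on mu2.

Lemma mu2_sigma_finite : sigma_finite setT mu2.
Proof.
have /sigma_finiteP[F [TF ndF Foo]] := sigma_finiteT mu1.
exists (fun n => F n `*` F n).
  rewrite -setXTT TF predeqE => -[x y]; split.
    move=> [/= [n _ Fnx] [k _ Gky]]; exists (maxn n k) => //; split.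
    - by move: x Fnx; exact/subsetPset/ndF/leq_maxl.
    - by move: y Gky; exact/subsetPset/ndF/leq_maxr.
  by move=> [n _ []/= ? ?]; split; exists n.
move=> k; have [? ?] := Foo k.
split; first exact: measurableX.
by rewrite /mu2 product_measure1E// lte_mul_pinfty// ge0_fin_numE.
Qed.
HB.instance Definition _ := Measure_isSigmaFinite.Build _ _ _ mu2 mu2_sigma_finite.

Definition mu3 : set mpt -> \bar R := (mu2 \x mu1)%E.
HB.instance Definition _ := Measure.on mu3.

Lemma integE (D : set pt) (f : pt -> R) : integ D f = Rintegral mu3 D f.
Proof. by []. Qed.

Definition crd (i : 'I_3) (x : pt) : R :=
  if nat_of_ord i == 0%N then x.1.1 else if nat_of_ord i == 1%N then x.1.2 else x.2.

Definition mk3 (f : 'I_3 -> R) : pt := ((f (i0), f (i1)), f (i2)).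

Lemma crd_mk3 f i : crd i (mk3 f) = f i.
Proof.
case: i => -[|[|[|//]]] h; rewrite /crd /=; congr f; exact: val_inj.
Qed.

Lemma ord3P (P : 'I_3 -> Prop) : P i0 -> P i1 -> P i2 -> forall i, P i.
Proof.
move=> h0 h1 h2 [[|[|[|//]]] h].
- by rewrite (_ : Ordinal h = i0)//; exact: val_inj.
- by rewrite (_ : Ordinal h = i1)//; exact: val_inj.
- by rewrite (_ : Ordinal h = i2)//; exact: val_inj.
Qed.

Lemma sum3 (V : nmodType) (F : 'I_3 -> V) : \sum_(i < 3) F i = F i0 + F i1 + F i2.
Proof.
rewrite !big_ord_recl big_ord0 addr0 addrA.
by congr (F _ + F _ + F _); exact: val_inj.
Qed.

Lemma crd_continuous i : continuous (crd i).
Proof.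
elim/ord3P: i => x; rewrite /crd /=.
- by apply: (@continuous_comp _ _ _ fst fst); exact: cvg_fst.
- by apply: (@continuous_comp _ _ _ fst snd); [exact: cvg_fst|exact: cvg_snd].
- exact: cvg_snd.
Qed.

Lemma norm_ptE (x : pt) : `|x| = Num.max (Num.max `|crd i0 x| `|crd i1 x|) `|crd i2 x|.
Proof. by []. Qed.

Lemma crd_le_norm (x : pt) i : `|crd i x| <= `|x|.
Proof. by elim/ord3P: i; rewrite norm_ptE !le_max lexx ?orbT. Qed.

Lemma crdD i x y : crd i (x + y) = crd i x + crd i y.
Proof. by elim/ord3P: i. Qed.
Lemma crdN i x : crd i (- x) = - crd i x.
Proof. by elim/ord3P: i. Qed.
Lemma crdB i x y : crd i (x - y) = crd i x - crd i y.
Proof. by rewrite crdD crdN. Qed.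
Lemma crdZ i (t : R) x : crd i (t *: x) = t * crd i x.
Proof. by elim/ord3P: i. Qed.

Definition box (L : R) : set pt := [set x | forall i, - L < crd i x < L].
Definition cbox (L : R) : set pt := [set x | forall i, - L <= crd i x <= L].

Lemma box_cbox L : box L `<=` cbox L.
Proof. by move=> x h i; have /andP[/ltW -> /ltW ->] := h i. Qed.

Lemma boxE L : box L = (`]- L, L[ `*` `]- L, L[) `*` `]- L, L[.
Proof.
apply/seteqP; split=> x.
  by move=> h; split; [split|]; rewrite /= in_itv /=; [exact: (h i0)|exact: (h i1)|exact: (h i2)].
by move=> [[/=]]; rewrite !in_itv /= => h0 h1 h2; elim/ord3P.
Qed.

Lemma box_measurable L : measurable (box L : set mpt).
Proof. by rewrite boxE; apply: measurableX => //; apply: measurableX. Qed.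

Lemma box_finite L : (mu3 (box L) < +oo)%E.
Proof.
have fi : (mu1 [set` `]- L, L[%R] < +oo)%E.
  by rewrite /mu1 /= lebesgue_measure_itv; case: ifP => //=; rewrite -EFinB ltry.
have f2 : (mu2 ([set` `]- L, L[%R] `*` [set` `]- L, L[%R]) < +oo)%E.
  by rewrite /mu2 product_measure1E// lte_mul_pinfty// ge0_fin_numE.
have -> : mu3 (box L) = (mu2 ([set` `]- L, L[%R] `*` [set` `]- L, L[%R]) * mu1 [set` `]- L, L[%R])%E.
  by rewrite boxE; apply: product_measure1E => //; exact: measurableX.
by rewrite lte_mul_pinfty// ge0_fin_numE.
Qed.

Lemma cbox_compact L : compact (cbox L).
Proof.
rewrite (_ : cbox L = (`[- L, L] `*` `[- L, L]) `*` `[- L, L]).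
  apply: compact_setX; last exact: segment_compact.
  by apply: compact_setX; exact: segment_compact.
apply/seteqP; split=> x.
  by move=> h; split; [split|]; rewrite /= in_itv /=; [exact: (h i0)|exact: (h i1)|exact: (h i2)].
by move=> [[/=]]; rewrite !in_itv /= => h0 h1 h2; elim/ord3P.
Qed.

(** Measurability refers to the product sigma-algebra, so an open set is written as the countable
    union of the rational cubes that it contains. *)
Lemma open_measurable3 (A : set pt) : open A -> measurable (A : set mpt).
Proof.
move=> oA.
pose B (k : (rat * rat * rat * rat)%type) : set pt :=
  [set x | [/\ `|x.1.1 - ratr k.1.1.1| < ratr k.2, `|x.1.2 - ratr k.1.1.2| < ratr k.2 &
   `|x.2 - ratr k.1.2| < ratr k.2]].
have BE k : B k = ((ball (ratr k.1.1.1 : R) (ratr k.2)) `*` (ball (ratr k.1.1.2 : R) (ratr k.2)))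
     `*` (ball (ratr k.1.2 : R) (ratr k.2)).
  apply/seteqP; split=> x; rewrite /ball /=.
    by move=> [h0 h1 h2]; rewrite distrC h0 distrC h1 distrC h2.
  by move=> [[h0 h1] h2]; split; rewrite distrC.
have mB k : measurable (B k : set mpt).
  by rewrite BE; apply: measurableX; [apply: measurableX|]; apply: open_measurable; exact: (@ball_open R R^o).
rewrite (_ : A = \bigcup_(k in [set k | B k `<=` A]) B k).
  rewrite bigcup_mkcond; apply: countable_bigcupT_measurable; first exact: countableP.
  by move=> k; case: ifP => _ //.
apply/seteqP; split=> x; last by case=> k /= kA /kA.
move=> Ax; have /nbhs_ballP[e /= e0 eA] := open_nbhs_nbhs (conj oA Ax).
have e20 : 0 < e / 2 by rewrite divr_gt0.
(* A rational radius strictly between 0 and [e / 2]: a cube of this radius that contains [x] has all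
   its points within [e] of [x]. *)
have [r [r0 [q _ qr]]] : exists r, ((ball (e / 4 : R^o) (e / 4)) `&` range ratr) r.
  apply: dense_rat; last exact: ball_open.
  by exists (e / 4); apply: ballxx; rewrite divr_gt0.
have rpos : 0 < ratr q :> R by move: r0; rewrite -qr /ball /= ltr_norml; lra.
have rlt : ratr q < e / 2 :> R by move: r0; rewrite -qr /ball /= ltr_norml; lra.
have ap (t : R) : exists p : rat, `|t - ratr p| < ratr q.
  have [s [s0 [p _ ps]]] : exists s, ((ball (t : R^o) (ratr q)) `&` range ratr) s.
    apply: dense_rat; last exact: ball_open.
    by exists t; apply: ballxx.
  by exists p; rewrite ps.
have [p0 h0] := ap x.1.1; have [p1 h1] := ap x.1.2; have [p2 h2] := ap x.2.
exists (p0, p1, p2, q); last by [].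
move=> y [/= g0 g1 g2]; apply: eA.
have tri (a b c : R) : `|a - c| < ratr q -> `|b - c| < ratr q -> `|a - b| < e.
  by move=> h g; rewrite (_ : a - b = (a - c) - (b - c)); [rewrite (le_lt_trans (ler_normB _ _))//; lra|ring].
by split; [split|]; rewrite /ball /=; [exact: tri h0 g0|exact: tri h1 g1|exact: tri h2 g2].
Qed.

Lemma continuous_measurable3 (D : set pt) (f : pt -> R) : measurable (D : set mpt) ->
  continuous f -> measurable_fun (D : set mpt) (f : mpt -> mR).
Proof.
move=> mD /continuousP cf; apply: (measurability _ (RGenOpens.measurableE R)).
move=> _ [_ [a [b ->] <-]]; apply: measurableI => //.
by apply: open_measurable3; apply: cf; apply: interval_open.
Qed.

Lemma continuous_bounded_cbox (f : pt -> R) L : continuous f ->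
  exists2 M, 0 <= M & forall x, cbox L x -> `|f x| <= M.
Proof.
move=> cf.
have : compact (f @` cbox L).
  by apply: continuous_compact; [apply: continuous_subspaceT|exact: cbox_compact].
move=> /compact_bounded[M [Mr hM]]; exists (Num.max 0 (M + 1)); first by rewrite le_max lexx.
move=> x bx; have /(hM _) : M < Num.max 0 (M + 1) by rewrite lt_max ltrDl ltr01 orbT.
by apply; exists x.
Qed.

Lemma continuous_integrable3 (D : set pt) (f : pt -> R) L : measurable (D : set mpt) ->
  D `<=` cbox L -> continuous f -> mu3.-integrable D (EFin \o f).
Proof.
move=> mD DL cf.
have [M M0 hM] := continuous_bounded_cbox L cf.
apply: measurable_bounded_integrable => //.
- apply: (@le_lt_trans _ _ (mu3 (box (L + 1)))); last exact: box_finite.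
  apply: le_measure; rewrite ?inE //; first exact: box_measurable.
  by move=> x /DL h i; move: (h i); lra.
- exact: continuous_measurable3.
- exists M; split; first exact: num_real.
  by move=> y My x Dx /=; rewrite (le_trans (hM _ (DL _ Dx)))// ltW.
Qed.
End Measure3.

(** * Square-integrable functions and fields *)

Section L2theory.
Variable R : realType.
Local Notation mR := (measurableTypeR R).
Local Notation mpt := ((mR * mR) * mR)%type.
Local Notation pt := (pt R).
Implicit Types (D : set pt) (f g : pt -> R) (u v w : vfield R).

Definition mbl3 D := measurable (D : set mpt).
Definition itg D f := (@mu3 R).-integrable (D : set mpt) (EFin \o f).
(** The sets on which continuity alone gives integrability and membership in [L2]. *)
Definition bdm D := mbl3 D /\ exists L, D `<=` cbox L.

Lemma box_bdm L : bdm (box L).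
Proof. by split; [exact: box_measurable|exists L; exact: box_cbox]. Qed.

Lemma bdm_itg D f : bdm D -> continuous f -> itg D f.
Proof. by move=> [mD [L DL]] cf; exact: continuous_integrable3 DL cf. Qed.

Lemma eq_integ D f g : (forall x, D x -> f x = g x) -> integ D f = integ D g.
Proof. by move=> h; apply: eq_Rintegral => x /set_mem; exact: h. Qed.

Lemma eq_itg D f g : mbl3 D -> (forall x, D x -> f x = g x) -> itg D f -> itg D g.
Proof. by move=> mD h; apply: eq_integrable => // x /set_mem /h /= ->. Qed.

Lemma itgD D f g : mbl3 D -> itg D f -> itg D g -> itg D (fun x => f x + g x).
Proof. by move=> mD hf hg; exact: (integrableD mD hf hg). Qed.
Lemma itgZ D (a : R) f : mbl3 D -> itg D f -> itg D (fun x => a * f x).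
Proof. by move=> mD hf; exact: (integrableZl mD a hf). Qed.

Lemma integD D f g : mbl3 D -> itg D f -> itg D g ->
  integ D (fun x => f x + g x) = integ D f + integ D g.
Proof. by move=> mD hf hg; exact: RintegralD. Qed.
Lemma integZ D (a : R) f : mbl3 D -> itg D f -> integ D (fun x => a * f x) = a * integ D f.
Proof. by move=> mD hf; exact: RintegralZl. Qed.
Lemma integB D f g : mbl3 D -> itg D f -> itg D g ->
  integ D (fun x => f x - g x) = integ D f - integ D g.
Proof. by move=> mD hf hg; exact: RintegralB. Qed.
Lemma le_integ D f g : mbl3 D -> itg D f -> itg D g ->
  (forall x, D x -> f x <= g x) -> integ D f <= integ D g.
Proof. by move=> mD hf hg h; exact: le_Rintegral. Qed.
Lemma integ_ge0 D f : (forall x, D x -> 0 <= f x) -> 0 <= integ D f.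
Proof. by move=> h; exact: Rintegral_ge0. Qed.
Lemma integ0 D : integ D (fun=> 0) = 0.
Proof. by rewrite integE /Rintegral integral0. Qed.

Lemma L2_itg2 D f : mbl3 D -> L2 D f -> itg D (fun x => f x ^+ 2).
Proof.
move=> mD [mf hf]; apply/integrableP; split.
  by apply/measurable_EFinP; apply: measurable_funX.
under eq_integral do rewrite /= ger0_norm ?sqr_ge0//.
exact: hf.
Qed.

Lemma L2_itgM D f g : mbl3 D -> L2 D f -> L2 D g -> itg D (fun x => f x * g x).
Proof.
move=> mD hf hg.
have h : itg D (fun x => f x ^+ 2 + g x ^+ 2) by apply: itgD => //; exact: L2_itg2.
apply: (le_integrable mD _ _ h).
  by apply/measurable_EFinP; apply: measurable_funM; [case: hf|case: hg].
move=> x _ /=; rewrite lee_fin [leRHS]ger0_norm ?addr_ge0 ?sqr_ge0//.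
by rewrite normrM; have := sqr_ge0 (`|f x| - `|g x|); rewrite sqrrB !real_normK ?num_real//; nra.
Qed.

Lemma L2P D f : mbl3 D -> measurable_fun (D : set mpt) (f : mpt -> mR) ->
  itg D (fun x => f x ^+ 2) -> L2 D f.
Proof.
move=> mD mf /integrableP[_ h]; split=> //; move: h.
by under eq_integral do rewrite /= ger0_norm ?sqr_ge0//.
Qed.

Lemma L2D D f g : mbl3 D -> L2 D f -> L2 D g -> L2 D (fun x => f x + g x).
Proof.
move=> mD hf hg; apply: L2P => //.
  by apply: measurable_funD; [case: hf|case: hg].
apply: (@eq_itg _ (fun x => f x ^+ 2 + (2 * (f x * g x)) + g x ^+ 2)) => //.
  by move=> x _; ring.
by apply: itgD => //; [apply: itgD => //; [exact: L2_itg2|apply: itgZ => //; exact: L2_itgM]|exact: L2_itg2].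
Qed.

(** The bound is only almost everywhere because the factors in view are the entries of [eps]. *)
Lemma L2M D f g (M : R) : mbl3 D -> measurable_fun (D : set mpt) (g : mpt -> mR) ->
  {ae @mu3 R, forall x, D x -> `|g x| <= M} -> L2 D f -> L2 D (fun x => g x * f x).
Proof.
move=> mD mg hg hf; have mf := hf.1; apply: L2P => //; first exact: measurable_funM.
have h := itgZ (M ^+ 2) mD (L2_itg2 mD hf).
apply/integrableP; split.
  by apply/measurable_EFinP; apply: measurable_funX; apply: measurable_funM.
case/integrableP : h => mh; apply: le_lt_trans.
apply: ae_ge0_le_integral => //.
- by do 2 apply: measurableT_comp => //; apply: measurable_funX; apply: measurable_funM.
- by do 2 apply: measurableT_comp => //; apply: measurable_funM => //; exact: measurable_funX.
apply: (@filterS _ _ (ae_filter_ringOfSetsType (@mu3 R : {measure set mpt -> \bar R}))) hg => x /= hx Dx; rewrite lee_fin -exprMn !(ger0_norm (sqr_ge0 _)).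
rewrite !exprMn ler_wpM2r ?sqr_ge0// -real_normK ?num_real//.
by have := hx Dx; have := normr_ge0 (g x); nra.
Qed.

Lemma L2Z D (a : R) f : mbl3 D -> L2 D f -> L2 D (fun x => a * f x).
Proof.
by move=> mD hf; apply: (L2M (M := `|a|)) => //; apply: aeW => x _.
Qed.

Lemma L2N D f : mbl3 D -> L2 D f -> L2 D (fun x => - f x).
Proof.
move=> mD /(L2Z (-1) mD); congr L2; by apply/funext => x; rewrite mulN1r.
Qed.

Lemma L2B D f g : mbl3 D -> L2 D f -> L2 D g -> L2 D (fun x => f x - g x).
Proof. by move=> mD hf hg; apply: L2D => //; exact: L2N. Qed.

Lemma continuous_L2 D f : bdm D -> continuous f -> L2 D f.
Proof.
move=> bD cf; have mD := bD.1; apply: L2P => //; first exact: continuous_measurable3.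
by apply: bdm_itg => // x; apply: cvgM; exact: cf.
Qed.

Lemma itg_sum3 D (F : 'I_3 -> pt -> R) : mbl3 D -> (forall i, itg D (F i)) ->
  itg D (fun x => \sum_(i < 3) F i x).
Proof.
move=> mD h; apply: (@eq_itg _ (fun x => F i0 x + F i1 x + F i2 x)) => //.
  by move=> x _; rewrite sum3.
by apply: itgD => //; apply: itgD.
Qed.

Lemma integ_sum3 D (F : 'I_3 -> pt -> R) : mbl3 D -> (forall i, itg D (F i)) ->
  integ D (fun x => \sum_(i < 3) F i x) = \sum_(i < 3) integ D (F i).
Proof.
move=> mD h; have i01 : itg D (fun x => F i0 x + F i1 x) by apply: itgD.
rewrite sum3 -(integD mD (h i0) (h i1)) -(integD mD i01 (h i2)).
by apply: eq_integ => x _; rewrite sum3.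
Qed.

Lemma vL2_itg D u v : mbl3 D -> vL2 D u -> vL2 D v -> itg D (dot u v).
Proof. by move=> mD hu hv; apply: itg_sum3 => // i; exact: L2_itgM. Qed.

Lemma dot_ge0 u x : 0 <= dot u u x.
Proof. by apply: sumr_ge0 => i _; rewrite -expr2 sqr_ge0. Qed.

Lemma vnrm2_ge0 D u : 0 <= vnrm2 D u.
Proof. by apply: integ_ge0 => x _; exact: dot_ge0. Qed.

Lemma vnrm2_comb D u v (t : R) : mbl3 D -> vL2 D u -> vL2 D v ->
  vnrm2 D (fun i x => u i x + t * v i x) =
  vnrm2 D u + t * 2 * integ D (dot u v) + t ^+ 2 * vnrm2 D v.
Proof.
move=> mD hu hv; have i1 := vL2_itg mD hu hv.
have i2 := vL2_itg mD hu hu; have i3 := vL2_itg mD hv hv.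
have j1 := itgZ (t * 2) mD i1; have j3 := itgZ (t ^+ 2) mD i3.
rewrite /vnrm2 -(integZ _ mD i1) -(integZ _ mD i3) -(integD mD i2 j1) -(integD mD (itgD mD i2 j1) j3).
by apply: eq_integ => x _; rewrite /dot !sum3; ring.
Qed.

(** Both Cauchy-Schwarz inequalities reduce to this: a quadratic polynomial without negative values
    has no positive discriminant. *)
Lemma discr_le (a b c : R) : 0 <= a -> 0 <= c -> (forall t, 0 <= a + t * 2 * b + t ^+ 2 * c) ->
  `|b| <= Num.sqrt a * Num.sqrt c.
Proof.
move=> a0 c0 h; rewrite -sqrtrM// -sqrtr_sqr ler_wsqrtr//.
have [c00|cn0] := eqVneq c 0.
  rewrite c00 mulr0; have [->|bn0] := eqVneq b 0; first by rewrite expr0n.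
  (* With [c = 0] the polynomial is affine, and at this point it takes the value -1. *)
  have := h (- (a + 1) / (2 * b)); rewrite c00 mulr0 addr0.
  by rewrite (_ : - (a + 1) / (2 * b) * 2 * b = - (a + 1)); [lra|field].
have cp : 0 < c by rewrite lt_neqAle eq_sym cn0.
have := h (- b / c); rewrite (_ : _ + _ = (a * c - b ^+ 2) / c); last by field.
by rewrite pmulr_lge0 ?invr_gt0// subr_ge0.
Qed.

Lemma vCauchySchwarz D u v : mbl3 D -> vL2 D u -> vL2 D v ->
  `|integ D (dot u v)| <= Num.sqrt (vnrm2 D u) * Num.sqrt (vnrm2 D v).
Proof.
move=> mD hu hv; apply: discr_le; rewrite ?vnrm2_ge0// => t.
by rewrite -vnrm2_comb// vnrm2_ge0.
Qed.

Lemma vnormD D u v : mbl3 D -> vL2 D u -> vL2 D v ->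
  Num.sqrt (vnrm2 D (fun i x => u i x + v i x)) <=
  Num.sqrt (vnrm2 D u) + Num.sqrt (vnrm2 D v).
Proof.
move=> mD hu hv.
have -> : vnrm2 D (fun i x => u i x + v i x) = vnrm2 D (fun i x => u i x + 1 * v i x).
  by congr vnrm2; apply/funext => i; apply/funext => x; rewrite mul1r.
rewrite vnrm2_comb// mul1r expr1n mul1r.
have cs := le_trans (ler_norm _) (vCauchySchwarz mD hu hv).
have su := sqr_sqrtr (vnrm2_ge0 D u); have sv := sqr_sqrtr (vnrm2_ge0 D v).
rewrite -[leRHS]ger0_norm ?addr_ge0 ?sqrtr_ge0// -sqrtr_sqr ler_wsqrtr//.
by rewrite sqrrD su sv; lra.
Qed.

Lemma nrm2_ge0 D f : 0 <= nrm2 D f.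
Proof. by apply: integ_ge0 => x _; rewrite sqr_ge0. Qed.

Lemma L2_CauchySchwarz D f g : mbl3 D -> L2 D f -> L2 D g ->
  `|integ D (fun x => f x * g x)| <= Num.sqrt (nrm2 D f) * Num.sqrt (nrm2 D g).
Proof.
move=> mD hf hg; apply: discr_le; rewrite ?nrm2_ge0// => t.
have h1 := L2_itg2 mD hf; have h2 := L2_itg2 mD hg; have h3 := L2_itgM mD hf hg.
have j3 := itgZ (t * 2) mD h3; have j2 := itgZ (t ^+ 2) mD h2.
rewrite /nrm2 -(integZ _ mD h3) -(integZ _ mD h2) -(integD mD h1 j3) -(integD mD (itgD mD h1 j3) j2).
apply: integ_ge0 => x _.
by rewrite (_ : _ + _ = (f x + t * g x) ^+ 2) ?sqr_ge0//; ring.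
Qed.

End L2theory.

(** * Calculus on a box *)

Section PartialDerivatives.
Variable R : realType.
Local Notation mR := (measurableTypeR R).
Local Notation mpt := ((mR * mR) * mR)%type.
Local Notation pt := (pt R).
Implicit Types (f g : pt -> R) (i : 'I_3).

(** As a relation, existence and value of the derivative travel together, so that the rules of
    calculus compose without side conditions. *)
Definition pd i f g := forall x : pt, is_derive x (@ev R i) f (g x).

Lemma pd_partial i f g : pd i f g -> partial i f = g.
Proof. by move=> h; apply/funext => x; exact: (@derive_val _ _ _ _ _ _ _ (h x)). Qed.

Lemma pd_derivable i f g x : pd i f g -> derivable f x (ev R i).
Proof. by move=> h; exact: (@ex_derive _ _ _ _ _ _ _ (h x)). Qed.

Lemma derivable_pd i f : (forall x, derivable f x (ev R i)) -> pd i f (partial i f).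
Proof. by move=> h x; exact: DeriveDef. Qed.

Lemma pd_ext i f g f' g' : f =1 f' -> g =1 g' -> pd i f g -> pd i f' g'.
Proof. by move=> /funext <- /funext <-. Qed.

Lemma pd_eq i f g g' : pd i f g -> g =1 g' -> pd i f g'.
Proof. by move=> h /funext <-. Qed.

Lemma pd_cst i (a : R) : pd i (fun=> a) (fun=> 0).
Proof. by move=> x; exact: is_derive_cst. Qed.

Lemma pdD i f g f' g' : pd i f f' -> pd i g g' -> pd i (fun x => f x + g x) (fun x => f' x + g' x).
Proof. by move=> hf hg x; exact: is_deriveD. Qed.

Lemma pdN i f f' : pd i f f' -> pd i (fun x => - f x) (fun x => - f' x).
Proof. by move=> hf x; exact: is_deriveN. Qed.

Lemma pdB i f g f' g' : pd i f f' -> pd i g g' -> pd i (fun x => f x - g x) (fun x => f' x - g' x).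
Proof. by move=> hf hg; apply: pdD => //; exact: pdN. Qed.

Lemma pdM i f g f' g' : pd i f f' -> pd i g g' ->
  pd i (fun x => f x * g x) (fun x => f' x * g x + f x * g' x).
Proof.
move=> hf hg x; apply: is_derive_eq; first exact: (@is_deriveM _ _ f g x (ev R i) (f' x) (g' x)).
by rewrite /GRing.scale /= addrC [g x * _]mulrC.
Qed.

Lemma pdZ i (a : R) f f' : pd i f f' -> pd i (fun x => a * f x) (fun x => a * f' x).
Proof.
by move=> h; apply: pd_eq (pdM (pd_cst i a) h) _ => x; rewrite mul0r add0r.
Qed.

Lemma pd_sum3 i (F G : 'I_3 -> pt -> R) : (forall j, pd i (F j) (G j)) ->
  pd i (fun x => \sum_(j < 3) F j x) (fun x => \sum_(j < 3) G j x).
Proof.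
move=> h; apply: (pd_ext _ _ (pdD (pdD (h i0) (h i1)) (h i2))) => x; by rewrite sum3.
Qed.

(** A directional derivative sees only one line. This brings in the one-variable chain rule, where a
    chain rule on [pt] would ask for total differentiability. *)
Lemma is_derive_line (x v : pt) f (d : R) :
  is_derive x v f d <-> is_derive (0 : R) 1 (fun h : R => f (h *: v + x)) d.
Proof.
have E : (fun h : R => h^-1 *: (f (h *: v + x) - f x)) =
   (fun h : R => h^-1 *: ((fun h => f (h *: v + x)) (h *: (1 : R) + 0) - (fun h => f (h *: v + x)) 0)).
  by apply/funext => h /=; rewrite scale0r add0r addr0 /GRing.scale /= mulr1.
by split=> -[h1 h2]; split; move: h1 h2; rewrite /derivable /derive /= E.
Qed.

Lemma pd_comp i (p p' : R -> R) f f' : (forall t : R, is_derive t 1 p (p' t)) ->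
  pd i f f' -> pd i (fun x => p (f x)) (fun x => p' (f x) * f' x).
Proof.
move=> hp hf x; apply/is_derive_line.
pose F := (fun h : R => f (h *: ev R i + x)).
have h : is_derive (0 : R) 1 F (f' x) by exact/is_derive_line.
have h' : is_derive (F 0) 1 p (p' (F 0)) := hp _.
have := is_derive1_comp h' h.
by rewrite {1}(_ : F 0 = f x)// /F scale0r add0r.
Qed.

Lemma pd_coord i j : pd i (crd j) (fun=> (i == j)%:R).
Proof.
move=> x; apply/is_derive_line.
have -> : (fun h : R => crd j (h *: ev R i + x)) = (fun h : R => h * (i == j)%:R + crd j x).
  apply/funext => h; rewrite crdD crdZ; congr (h * _ + _).
  by elim/ord3P: j; elim/ord3P: i.
have -> : (fun h : R => h * (i == j)%:R + crd j x) = (( *%R^~ (i == j)%:R) \+ cst (crd j x)) by [].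
apply: is_derive_eq.
by rewrite scaler0 add0r addr0 /GRing.scale /= mulr1.
Qed.

Lemma pt_ext (x y : pt) : (forall i, crd i x = crd i y) -> x = y.
Proof.
move: x y => [[a b] c] [[a' b'] c'] h.
by have := h i0; have := h i1; have := h i2; rewrite /crd /= => -> -> ->.
Qed.

Lemma pd_slice (i : 'I_3) (s : R -> pt) f g (t : R) :
  (forall h, h *: ev R i + s t = s (h *: (1 : R) + t)) -> pd i f g ->
  is_derive t 1 (fun r => f (s r)) (g (s t)).
Proof.
move=> E /(_ (s t)) [h1 h2]; split; move: h1 h2; rewrite /derivable /derive /=.
all: by under [X in X @ _]eq_fun do rewrite E.
Qed.

Lemma pd_slice0 f g (y z t : R) : pd i0 f g ->
  is_derive t 1 (fun s : R => f ((s, y), z)) (g ((t, y), z)).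
Proof.
apply: (@pd_slice i0 (fun s => ((s, y), z))) => h.
by apply: pt_ext; elim/ord3P; rewrite crdD crdZ /crd /= /GRing.scale /= ?mulr0 ?add0r.
Qed.

Lemma pd_slice1 f g (y z t : R) : pd i1 f g ->
  is_derive t 1 (fun s : R => f ((y, s), z)) (g ((y, t), z)).
Proof.
apply: (@pd_slice i1 (fun s => ((y, s), z))) => h.
by apply: pt_ext; elim/ord3P; rewrite crdD crdZ /crd /= /GRing.scale /= ?mulr0 ?add0r.
Qed.

Lemma pd_slice2 f g (y : R * R) (t : R) : pd i2 f g ->
  is_derive t 1 (fun s : R => f (y, s)) (g (y, t)).
Proof.
apply: (@pd_slice i2 (fun s => (y, s))) => h.
by apply: pt_ext; elim/ord3P; rewrite crdD crdZ /crd /= /GRing.scale /= ?mulr0 ?add0r.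
Qed.

Lemma continuous_slice0 (y z : R) : continuous (fun s : R => ((s, y), z)).
Proof.
move=> t; apply: (@cvg_pair _ _ _ _ (nbhs (t, y)) (nbhs z)); last exact: cvg_cst.
by apply: (@cvg_pair _ _ _ _ (nbhs t) (nbhs y)); [exact: cvg_id|exact: cvg_cst].
Qed.

Lemma continuous_slice1 (y z : R) : continuous (fun s : R => ((y, s), z)).
Proof.
move=> t; apply: (@cvg_pair _ _ _ _ (nbhs (y, t)) (nbhs z)); last exact: cvg_cst.
by apply: (@cvg_pair _ _ _ _ (nbhs y) (nbhs t)); [exact: cvg_cst|exact: cvg_id].
Qed.

Lemma continuous_slice2 (y : R * R) : continuous (fun s : R => (y, s)).
Proof.
by move=> t; apply: (@cvg_pair _ _ _ _ (nbhs y) (nbhs t)); [exact: cvg_cst|exact: cvg_id].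
Qed.

Lemma FTC_zero (F G : R -> R) (L : R) : 0 < L -> (forall t : R, is_derive t 1 F (G t)) ->
  continuous G -> F (- L) = 0 -> F L = 0 ->
  (\int[@mu1 R]_(x in [set` `]- L, L[%R]) (G x)%:E = 0)%E.
Proof.
move=> L0 dF cG F1 F2.
have LL : - L < L by rewrite (lt_trans _ L0)// oppr_lt0.
have cF : continuous F.
  by move=> t; apply: differentiable_continuous; apply/derivable1_diffP; case: (dF t).
have mG : measurable_fun [set: mR] (G : mR -> mR) by exact: continuous_measurable_fun.
rewrite /mu1 /= integral_itv_obnd_cbnd; last first.
  by apply: measurableT_comp => //; exact: measurable_funTS.
rewrite integral_itv_bndo_bndc; last first.
  by apply: measurableT_comp => //; exact: measurable_funTS.
rewrite (continuous_FTC2 LL (F := F)).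
- by rewrite F1 F2 subee.
- exact: continuous_subspaceT.
- split.
  + by move=> t _; case: (dF t).
  + exact: cvg_at_right_filter (cF _).
  + exact: cvg_at_left_filter (cF _).
- by move=> t _; rewrite derive1E; case: (dF t).
Qed.

Lemma integral_prod0r d1 d2 (T1 : measurableType d1) (T2 : measurableType d2)
  (m1 : {sigma_finite_measure set T1 -> \bar R}) (m2 : {sigma_finite_measure set T2 -> \bar R})
  (f : T1 * T2 -> \bar R) :
  (m1 \x m2)%E.-integrable setT f -> (forall x, \int[m2]_y f (x, y) = 0)%E ->
  (\int[(m1 \x m2)%E]_z f z = 0)%E.
Proof.
move=> itf h; rewrite -integral12_prod_meas1//.
by apply: integral0_eq => x _; exact: h.
Qed.

(** The slice hypothesis may assume integrability, since almost all slices are integrable. This is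
    what allows Fubini's theorem to be applied once more to a slice. *)
Lemma integral_prod0l d1 d2 (T1 : measurableType d1) (T2 : measurableType d2)
  (m1 : {sigma_finite_measure set T1 -> \bar R}) (m2 : {sigma_finite_measure set T2 -> \bar R})
  (f : T1 * T2 -> \bar R) :
  (m1 \x m2)%E.-integrable setT f ->
  (forall y, m1.-integrable setT (fun x => f (x, y)) -> \int[m1]_x f (x, y) = 0)%E ->
  (\int[(m1 \x m2)%E]_z f z = 0)%E.
Proof.
move=> itf h; rewrite -integral21_prod_meas1//.
rewrite (ae_eq_integral (cst 0%E)) ?integral0//.
- exact: (measurable_fubini_G itf).
- have := ae_integrable2 itf.
  by apply: (@filterS _ _ (ae_filter_ringOfSetsType m2)) => y hy _; exact: h.
Qed.

(** The [i]-th variable is integrated first, where the fundamental theorem of calculus applies.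
    Every integration by parts below rests on this. *)
Lemma integ_pd0 i f g (L : R) : 0 < L -> pd i f g -> continuous g ->
  (forall x, `|crd i x| = L -> f x = 0) -> integ (box L) g = 0.
Proof.
move=> L0 fg cg f0.
have itf : (@mu3 R).-integrable setT ((EFin \o g) \_ (box L : set mpt)).
  apply: (proj1 (integrable_mkcond (EFin \o g : mpt -> \bar R) (box_measurable L))).
  exact: (bdm_itg (box_bdm L) cg).
rewrite integE /Rintegral integral_mkcond.
have nL : `|L| = L by rewrite gtr0_norm.
have nnL : `|- L| = L by rewrite normrN.
pose I := [set` `]- L, L[%R] : set R.
have bE x y z : (((x, y), z) \in (box L : set mpt)) = [&& x \in I, y \in I & z \in I].
  apply/idP/idP; rewrite !inE.
    by move=> h; apply/and3P; split; rewrite inE /I /= in_itv /=; [exact: (h i0)|exact: (h i1)|exact: (h i2)].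
  by move=> /and3P[]; rewrite !inE /I /= !in_itv /= => h0 h1 h2; elim/ord3P.
have slice (P : bool) (G : R -> R) : (P -> (\int[@mu1 R]_(x in I) (G x)%:E = 0)%E) ->
    (\int[@mu1 R]_x (if P && (x \in I) then (G x)%:E else 0) = 0)%E.
  case: P => [|_] /=; last by rewrite integral0.
  move=> h; rewrite -[RHS]h// [RHS]integral_mkcond.
  by apply: eq_integral => x _; rewrite patchE.
suff -> : (\int[@mu3 R]_x ((EFin \o g) \_ (box L : set mpt)) x = 0)%E by [].
move: i fg f0; elim/ord3P => fg f0; rewrite /mu3.
- apply: integral_prod0l => // z itz; rewrite /mu2.
  apply: integral_prod0l => // y _.
  rewrite -[RHS](slice ((y \in I) && (z \in I)) (fun x => g ((x, y), z))).
    by apply: eq_integral => x _; rewrite patchE bE andbC andbA.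
  move=> _; apply: (@FTC_zero (fun x => f ((x, y), z))) => //.
  + by move=> t; exact: (pd_slice0 y z t fg).
  + move=> t; apply: (@continuous_comp _ _ _ (fun s : R => ((s, y), z)) g); last exact: cg.
    exact: continuous_slice0.
  + by apply: f0.
  + by apply: f0.
- apply: integral_prod0l => // z itz; rewrite /mu2.
  apply: integral_prod0r => // y.
  rewrite -[RHS](slice ((y \in I) && (z \in I)) (fun x => g ((y, x), z))).
    by apply: eq_integral => x _; rewrite patchE bE -andbA [(z \in I) && _]andbC.
  move=> _; apply: (@FTC_zero (fun x => f ((y, x), z))) => //.
  + by move=> t; exact: (pd_slice1 y z t fg).
  + move=> t; apply: (@continuous_comp _ _ _ (fun s : R => ((y, s), z)) g); last exact: cg.
    exact: continuous_slice1.
  + by apply: f0.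
  + by apply: f0.
- apply: integral_prod0r => // -[x y].
  rewrite -[RHS](slice ((x \in I) && (y \in I)) (fun z => g ((x, y), z))).
    by apply: eq_integral => z _; rewrite patchE bE -andbA.
  move=> _; apply: (@FTC_zero (fun z => f ((x, y), z))) => //.
  + by move=> t; exact: (pd_slice2 (x, y) t fg).
  + move=> t; apply: (@continuous_comp _ _ _ (fun s : R => ((x, y), s)) g); last exact: cg.
    exact: continuous_slice2.
  + by apply: f0.
  + by apply: f0.
Qed.
End PartialDerivatives.

Section Continuity.
Variable R : realType.
Local Notation pt := (pt R).
Implicit Types f g : pt -> R.

Lemma cont_cst (a : R) : continuous (fun _ : pt => a). Proof. by move=> x; exact: cvg_cst. Qed.
Lemma cont_add f g : continuous f -> continuous g -> continuous (fun x => f x + g x).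
Proof. by move=> cf cg x; apply: cvgD; [exact: cf|exact: cg]. Qed.
Lemma cont_mul f g : continuous f -> continuous g -> continuous (fun x => f x * g x).
Proof. by move=> cf cg x; apply: cvgM; [exact: cf|exact: cg]. Qed.
Lemma cont_opp f : continuous f -> continuous (fun x => - f x).
Proof. by move=> cf x; apply: cvgN; exact: cf. Qed.
Lemma cont_sum3 (F : 'I_3 -> pt -> R) : (forall i, continuous (F i)) ->
  continuous (fun x => \sum_(i < 3) F i x).
Proof.
move=> cF; have -> : (fun x => \sum_(i < 3) F i x) = fun x => F i0 x + F i1 x + F i2 x.
  by apply/funext => x; rewrite sum3.
by apply: cont_add => //; exact: cont_add.
Qed.
Lemma cont_sqr f : continuous f -> continuous (fun x => f x ^+ 2).
Proof. by move=> cf; exact: cont_mul. Qed.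
Lemma cont_comp (p : R -> R) f : continuous p -> continuous f -> continuous (fun x => p (f x)).
Proof. by move=> cp cf x; apply: continuous_comp; [exact: cf|exact: cp]. Qed.
Lemma cont_expR f : continuous f -> continuous (fun x => expR (f x)).
Proof. by move=> cf; apply: (cont_comp (p := @expR R)) => //; exact: continuous_expR. Qed.
Lemma cont_dot (u v : vfield R) : (forall i, continuous (u i)) -> (forall i, continuous (v i)) ->
  continuous (dot u v).
Proof. by move=> cu cv; apply: cont_sum3 => i; exact: cont_mul. Qed.

Lemma is_derive_continuous (p : R -> R) (t d : R) : is_derive t 1 p d -> {for t, continuous p}.
Proof. by move=> [h _]; apply: differentiable_continuous; exact/derivable1_diffP. Qed.
End Continuity.

Ltac cont := lazymatch goal with
  | |- forall x, continuous_at x (fun _ => ?a) => exact: cont_cst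
  | |- forall x, continuous_at x (fun y => (@?f y + @?g y)%R) => apply: (@cont_add _ f g); cont
  | |- forall x, continuous_at x (fun y => (@?f y * @?g y)%R) => apply: (@cont_mul _ f g); cont
  | |- forall x, continuous_at x (fun y => (- @?f y)%R) => apply: (@cont_opp _ f); cont
  | |- forall x, continuous_at x (fun y => (@?f y ^+ 2)%R) => apply: (@cont_sqr _ f); cont
  | |- forall x, continuous_at x (fun y => expR (@?f y)) => apply: (@cont_expR _ f); cont
  | |- forall x, continuous_at x (dot _ _) => apply: cont_dot => ?; cont
  | |- _ => first [assumption | match goal with H : forall _, _ |- _ => solve [apply: H] end | idtac]
  end.

(** * A class of smooth functions stable under differentiation *)

Section SmoothClass.
Variable R : realType.
Local Notation pt := (pt R).
Implicit Types f g : pt -> R.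

(** The derivatives of [exp(-1/t)], extended by 0, all have this form. With [s = 1/t] the derivative
    in [t] is [- s^2] times that in [s], hence the polynomial ['X^2 * (P - P')] of [flat']. *)
Definition flat (P : {poly R}) (t : R) : R := if 0 < t then P.[t^-1] * expR (- t^-1) else 0.

Definition flat' (P : {poly R}) : {poly R} := 'X^2 * (P - P^`()).

Lemma poly_le_expR (P : {poly R}) : exists2 C, 0 <= C & forall s : R, 0 <= s -> `|P.[s]| <= C * expR s.
Proof.
elim/poly_ind: P => [|p c [C C0 hC]].
  by exists 0 => // s s0; rewrite horner0 normr0 mul0r.
have mono n : exists2 C, 0 <= C & forall s : R, 0 <= s -> s ^+ n * 1 <= C * expR s.
  case: n => [|n]; first by exists 1 => // s s0; rewrite expr0 mulr1 mul1r; have := expR_ge1Dx s; lra.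
  exists (n.+1)`!%:R => // s s0; have := expR_ge1Dxn n s0; rewrite mulr1 => h.
  have f0 : 0 < (n.+1)`!%:R :> R by rewrite ltr0n fact_gt0.
  by rewrite mulrC -ler_pdivrMr//; lra.
(* The extra power [m] absorbs the factor ['X] that the induction on polynomials produces. *)
have H m : forall q : {poly R}, exists2 C, 0 <= C & forall s : R, 0 <= s -> s ^+ m * `|q.[s]| <= C * expR s.
  move=> q; elim/poly_ind: q m => [|q d IH] m.
    by exists 0 => // s s0; rewrite horner0 normr0 mul0r mulr0.
  have [C1 C10 h1] := IH m.+1; have [C2 C20 h2] := mono m.
  exists (C1 + `|d| * C2); first by rewrite addr_ge0// mulr_ge0.
  move=> s s0; rewrite hornerMXaddC; have := h1 s s0; have := h2 s s0; rewrite mulr1 => g2 g1.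
  apply: (@le_trans _ _ (s ^+ m * (`|q.[s]| * s + `|d|))).
    by rewrite ler_wpM2l ?exprn_ge0// (le_trans (ler_normD _ _))// normrM (ger0_norm s0).
  rewrite mulrDr mulrDl lerD//.
    by move: g1; rewrite exprSr -mulrA [s * `|_|]mulrC.
  by rewrite mulrC -mulrA ler_wpM2l.
have [C' C'0 hC'] := H 0%N (p * 'X + c%:P).
by exists C' => // s s0; have := hC' s s0; rewrite expr0 mul1r.
Qed.

(** This is [poly_le_expR] for [P * 'X^2] at [1/t]. A quadratic bound at the origin gives the
    derivative 0 there. *)
Lemma flat_quadratic P : exists2 C, 0 <= C & forall t : R, `|flat P t| <= C * t ^+ 2.
Proof.
have [C C0 hC] := poly_le_expR (P * 'X^2).
exists C => // t; rewrite /flat; case: ifP => [t0|_]; last by rewrite normr0 mulr_ge0// sqr_ge0.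
have s0 : 0 <= t^-1 by rewrite invr_ge0 ltW.
have := hC _ s0; rewrite hornerM hornerXn normrM (ger0_norm (sqr_ge0 _)) => h.
rewrite normrM (gtr0_norm (expR_gt0 _)) expRN ler_pdivrMr ?expR_gt0//.
have t2 : 0 < t ^+ 2 by rewrite exprn_gt0.
by rewrite mulrAC -ler_pdivrMr// -exprVn.
Qed.

Lemma is_derive_flat P (t : R) : is_derive t 1 (flat P) (flat (flat' P) t).
Proof.
have [t0|t0|t0] := ltgtP 0 t.
- have hP : is_derive t^-1 1 (horner P) (P^`()).[t^-1] := is_derive_poly _ _.
  have hV : is_derive t 1 (fun y : R => y^-1) (- t ^- 2 *: 1).
    by apply: (@is_deriveV _ (fun y => y)); rewrite gt_eqF.
  have h1 : is_derive t 1 (fun y : R => P.[y^-1]) ((P^`()).[t^-1] * (- t ^- 2 *: 1)).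
    exact: (@is_derive1_comp _ (horner P) (fun y => y^-1)).
  have h2 : is_derive t 1 (fun y : R => expR (- y^-1)) (expR (- t^-1) * (- (- t ^- 2 *: 1))).
    by apply: (@is_derive1_comp _ expR (fun y => - y^-1)); exact: is_deriveN.
  apply: (@near_eq_is_derive _ _ _ (fun y : R => P.[y^-1] * expR (- y^-1))).
    near=> y; rewrite /flat ifT// -oppr_lt0; near: y; apply: Nlt_nbhsl; rewrite oppr_lt0//.
  have h3 := is_deriveM h1 h2.
  have -> : flat (flat' P) t = P.[t^-1] *: (expR (- t^-1) * - (- t ^- 2 *: 1)) + expR (- t^-1) *: (P^`().[t^-1] * (- t ^- 2 *: 1)).
    rewrite /flat t0 /flat' hornerM hornerXn hornerD hornerN /GRing.scale /= exprVn. ring.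
  exact: h3.
- apply: (@near_eq_is_derive _ _ _ (fun=> 0)).
    near=> y; rewrite /flat ifF//; apply/negbTE; rewrite -leNgt ltW//; near: y; exact: lt_nbhsl.
  have -> : flat (flat' P) t = 0 by rewrite /flat ltNge (ltW t0).
  exact: is_derive_cst.
- rewrite -t0; have f0 Q : flat Q 0 = 0 by rewrite /flat ltxx.
  have [C C0 hC] := flat_quadratic P.
  have lim : (fun h : R => h^-1 *: (flat P (h *: 1 + 0) - flat P 0)) @ (0 : R)^' --> (0 : R).
    apply/cvgrPdist_lt => e e0; near=> h; rewrite f0 addr0 subr0 sub0r normrN /GRing.scale /= mulr1.
    have hn : h != 0 by near: h; exact: nbhs_dnbhs_neq.
    rewrite normrM normfV mulrC ltr_pdivrMr ?normr_gt0//.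
    apply: le_lt_trans (hC h) _; rewrite -real_normK ?num_real// expr2 mulrA ltr_pM2r ?normr_gt0//.
    apply: (@le_lt_trans _ _ ((C + 1) * `|h|)); first by rewrite ler_wpM2r// lerDl.
    rewrite mulrC -ltr_pdivlMr; last by rewrite ltr_wpDl.
    near: h; apply: dnbhs0_lt; rewrite divr_gt0//; by rewrite ltr_wpDl.
  rewrite f0; split; first by apply/cvg_ex; exists 0.
  exact/cvg_lim.
Unshelve. all: by end_near.
Qed.

(** One set that witnesses [smooth] for every function constructed below: partial derivatives are
    computed by induction on the expression and stay in the class. [Sm_flat] is there for the
    cutoffs. *)
Inductive Sm : (pt -> R) -> Prop :=
| Sm_cst a : Sm (fun=> a)
| Sm_crd i : Sm (crd i)
| Sm_add f g : Sm f -> Sm g -> Sm (fun x => f x + g x)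
| Sm_mul f g : Sm f -> Sm g -> Sm (fun x => f x * g x)
| Sm_sin f : Sm f -> Sm (fun x => sin (f x))
| Sm_cos f : Sm f -> Sm (fun x => cos (f x))
| Sm_flat P f : Sm f -> Sm (fun x => flat P (f x)).

Lemma Sm_pd f : Sm f -> continuous f /\ forall i, exists2 g, Sm g & pd i f g.
Proof.
elim=> {f}.
- move=> a; split; first exact: cont_cst.
  by move=> i; exists (fun=> 0); [exact: Sm_cst|exact: pd_cst].
- move=> j; split; first exact: crd_continuous.
  by move=> i; exists (fun=> (i == j)%:R); [exact: Sm_cst|exact: pd_coord].
- move=> f g sf [cf pf] sg [cg pg]; split; first exact: cont_add.
  move=> i; have [f' sf' pf'] := pf i; have [g' sg' pg'] := pg i.
  by exists (fun x => f' x + g' x); [exact: Sm_add|exact: pdD].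
- move=> f g sf [cf pf] sg [cg pg]; split; first exact: cont_mul.
  move=> i; have [f' sf' pf'] := pf i; have [g' sg' pg'] := pg i.
  exists (fun x => f' x * g x + f x * g' x); last exact: pdM.
  by apply: Sm_add; exact: Sm_mul.
- move=> f sf [cf pf]; split.
    by apply: (cont_comp (p := @sin R)) => //; exact: continuous_sin.
  move=> i; have [f' sf' pf'] := pf i.
  exists (fun x => cos (f x) * f' x); first by apply: Sm_mul => //; exact: Sm_cos.
  by apply: (pd_comp (p := @sin R)) pf' => t; exact: is_derive_sin.
- move=> f sf [cf pf]; split.
    by apply: (cont_comp (p := @cos R)) => //; exact: continuous_cos.
  move=> i; have [f' sf' pf'] := pf i.
  exists (fun x => - sin (f x) * f' x).
    apply: Sm_mul => //; rewrite (_ : (fun x => - sin (f x)) = fun x => -1 * sin (f x)).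
      by apply: Sm_mul; [exact: Sm_cst|exact: Sm_sin].
    by apply/funext => x; rewrite mulN1r.
  by apply: (pd_comp (p := @cos R) (p' := fun t => - sin t)) pf' => t; exact: is_derive_cos.
- move=> P f sf [cf pf]; split.
    apply: (cont_comp (p := flat P)) => // t; exact: is_derive_continuous (is_derive_flat P t).
  move=> i; have [f' sf' pf'] := pf i.
  exists (fun x => flat (flat' P) (f x) * f' x); first by apply: Sm_mul => //; exact: Sm_flat.
  by apply: (pd_comp (p := flat P)) pf' => t; exact: is_derive_flat.
Qed.

Lemma Sm_continuous f : Sm f -> continuous f. Proof. by case/Sm_pd. Qed.

Lemma Sm_partial f i : Sm f -> Sm (partial i f).
Proof. by case/Sm_pd => _ /(_ i)[g sg /pd_partial ->]. Qed.

Lemma Sm_pdp f i : Sm f -> pd i f (partial i f).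
Proof. by case/Sm_pd => _ /(_ i)[g sg h]; rewrite (pd_partial h). Qed.

Lemma Sm_smooth f : Sm f -> smooth f.
Proof.
move=> sf; exists Sm; split=> // g sg; split; first exact: Sm_continuous.
move=> i; split; last exact: Sm_partial.
by move=> x; exact: pd_derivable (Sm_pdp i sg).
Qed.

Lemma Sm_opp f : Sm f -> Sm (fun x => - f x).
Proof.
move=> sf; rewrite (_ : (fun x => _) = fun x => -1 * f x); last by apply/funext => x; rewrite mulN1r.
by apply: Sm_mul => //; exact: Sm_cst.
Qed.
End SmoothClass.

(** * Trigonometric sums on a box *)

Section TrigSums.
Variable R : realType.
Local Notation pt := (pt R).
Variable L : R.
Hypothesis L0 : 0 < L.
Implicit Types (f g : pt -> R) (b : 'I_3 -> bool) (k : 'I_3 -> nat).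

Definition freq (n : nat) : R := n%:R * (pi / (2 * L)).

(** The eigenfunctions of the interval from [- L] to [L] with [n] half-waves: Dirichlet conditions
    for [s = true], Neumann conditions for [s = false]. Differentiation exchanges the two. *)
Definition wave (s : bool) (n : nat) (t : R) : R :=
  if s then sin (freq n * (t + L)) else cos (freq n * (t + L)).

Definition sgnb (s : bool) : R := if s then 1 else -1.

Lemma is_derive_wave s n (t : R) : is_derive t 1 (wave s n) (sgnb s * freq n * wave (~~ s) n t).
Proof.
have h : is_derive t 1 (fun t : R => freq n * (t + L)) (freq n).
  apply: is_derive_eq; rewrite /GRing.scale /=; ring.
rewrite /wave /sgnb; case: s.
  rewrite mul1r [_ * cos _]mulrC.
  by apply: (@is_derive1_comp _ sin (fun t : R => freq n * (t + L))).
rewrite (_ : -1 * freq n * _ = - sin (freq n * (t + L)) * freq n); last by rewrite /=; ring.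
by apply: (@is_derive1_comp _ cos (fun t : R => freq n * (t + L))).
Qed.

Lemma wave_face n (t : R) : `|t| = L -> wave true n t = 0.
Proof.
have L2 : 2 * L != 0 by rewrite mulf_neq0// gt_eqF.
have s0 m : sin (m%:R * pi) = 0 :> R.
  elim: m => [|m IH]; first by rewrite mul0r sin0.
  by rewrite -natr1 mulrDl mul1r sinDpi IH oppr0.
rewrite /wave /freq => tL.
have [->|->] : t = L \/ t = - L.
  by have [t0|t0] := leP 0 t; move: tL; [rewrite ger0_norm// => ->; left|rewrite ltr0_norm// => <-; right; rewrite opprK].
  rewrite (_ : _ * _ = n%:R * pi)//; field; exact: lt0r_neq0.
by rewrite addNr mulr0 sin0.
Qed.

Definition mode b k (x : pt) : R :=
  wave (b i0) (k i0) (crd i0 x) * wave (b i1) (k i1) (crd i1 x) * wave (b i2) (k i2) (crd i2 x).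

Definition flipb i b : 'I_3 -> bool := fun j => if j == i then ~~ b j else b j.

Lemma flipbC i j b : flipb i (flipb j b) = flipb j (flipb i b).
Proof. by apply/funext => m; rewrite /flipb; do 2 case: eqP. Qed.

Lemma flipbK i b : flipb i (flipb i b) = b.
Proof. by apply/funext => m; rewrite /flipb; case: eqP => // ->; rewrite negbK. Qed.

Lemma pd_wave i j s n : pd i (fun x : pt => wave s n (crd j x))
  (fun x => sgnb s * freq n * wave (~~ s) n (crd j x) * (i == j)%:R).
Proof.
apply: (pd_comp (p := wave s n) (p' := fun t => sgnb s * freq n * wave (~~ s) n t)).
  by move=> t; exact: is_derive_wave.
exact: pd_coord.
Qed.

Lemma pd_mode i b k : pd i (mode b k) (fun x => sgnb (b i) * freq (k i) * mode (flipb i b) k x).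
Proof.
have h := pdM (pdM (pd_wave i i0 (b i0) (k i0)) (pd_wave i i1 (b i1) (k i1)))
   (pd_wave i i2 (b i2) (k i2)).
apply: (pd_eq h) => x; rewrite /mode /flipb.
by elim/ord3P: i {h} => /=; ring.
Qed.

Lemma mode_face i b k (x : pt) : b i -> `|crd i x| = L -> mode b k x = 0.
Proof.
rewrite /mode => bi /wave_face h; move: bi h.
elim/ord3P: i => -> ->; by rewrite ?(mulr0,mul0r).
Qed.

Lemma Sm_wave s n j : Sm (fun x : pt => wave s n (crd j x)).
Proof.
have h : Sm (fun x : pt => freq n * (crd j x + L)).
  by apply: Sm_mul; [exact: Sm_cst|apply: Sm_add; [exact: Sm_crd|exact: Sm_cst]].
by rewrite /wave; case: s; [exact: Sm_sin|exact: Sm_cos].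
Qed.

Lemma Sm_mode b k : Sm (mode b k).
Proof. by apply: Sm_mul; [apply: Sm_mul|]; exact: Sm_wave. Qed.

(** All modes of a sum share the parity [b], so that boundary conditions are encoded in [b]: the sum
    vanishes on the faces of each coordinate [i] with [b i], and [partial i] changes only the [i]-th
    condition. *)
Inductive TS b : (pt -> R) -> Prop :=
| TS0 : TS b (fun=> 0)
| TSc a k f : TS b f -> TS b (fun x => a * mode b k x + f x).

Lemma TS_mode b k a : TS b (fun x => a * mode b k x).
Proof.
have := TSc a k (TS0 b); congr TS; by apply/funext => x; rewrite addr0.
Qed.

Lemma TS_add b f g : TS b f -> TS b g -> TS b (fun x => f x + g x).
Proof.
move=> hf hg; elim: hf => [|a k {}f _ IH].
  by move: hg; congr TS; apply/funext => x; rewrite add0r.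
by have := TSc a k IH; congr TS; apply/funext => x; rewrite addrA.
Qed.

Lemma TS_scale b a f : TS b f -> TS b (fun x => a * f x).
Proof.
elim=> [|c k {}f _ IH]; first by have := TS0 b; congr TS; apply/funext => x; rewrite mulr0.
by have := TSc (a * c) k IH; congr TS; apply/funext => x; rewrite mulrDr mulrA.
Qed.

Lemma TS_Sm b f : TS b f -> Sm f.
Proof.
elim=> [|a k {}f _ IH]; first exact: Sm_cst.
by apply: Sm_add => //; apply: Sm_mul; [exact: Sm_cst|exact: Sm_mode].
Qed.

Lemma TS_face i b f (x : pt) : TS b f -> b i -> `|crd i x| = L -> f x = 0.
Proof.
move=> tf bi xL; elim: tf => // a k {}f _ ->.
by rewrite (mode_face _ bi xL) mulr0 addr0.
Qed.

Lemma partial_comb i a b k f : Sm f -> partial i (fun x => a * mode b k x + f x) =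
  fun x => a * (sgnb (b i) * freq (k i)) * mode (flipb i b) k x + partial i f x.
Proof.
move=> sf; have := pdD (pdZ a (pd_mode i b k)) (Sm_pdp i sf) => /pd_partial ->.
by apply/funext => x; rewrite !mulrA.
Qed.

Lemma partial_cst0 i : partial i (fun _ : pt => 0 : R) = fun=> 0.
Proof. exact: pd_partial (pd_cst i 0). Qed.

Lemma TS_partial i b f : TS b f -> TS (flipb i b) (partial i f).
Proof.
elim=> [|a k {}f tf IH]; first by rewrite partial_cst0; exact: TS0.
by rewrite (partial_comb _ _ _ _ (TS_Sm tf)); exact: TSc.
Qed.

(** Read off mode by mode: each derivative multiplies a mode by a number and flips one parity. *)
Lemma TS_partialC i j b f : TS b f -> partial i (partial j f) = partial j (partial i f).
Proof.
elim=> [|a k {}f tf IH]; first by rewrite !partial_cst0.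
have sf := TS_Sm tf.
rewrite !(partial_comb _ _ _ _ sf) !(partial_comb _ _ _ _ (Sm_partial _ sf)) IH flipbC.
apply/funext => x; congr (_ + _).
have [->//|ij] := eqVneq i j.
by rewrite /flipb (negbTE ij) eq_sym (negbTE ij); ring.
Qed.

End TrigSums.

(* Unification must not unfold directional derivatives into limits. *)
#[local] Opaque Defs.partial.

(* [ring] compares its atoms up to conversion, which is hopeless for derivatives. *)
Ltac pring := repeat (match goal with |- context [Defs.partial ?i ?f ?x] =>
  generalize (Defs.partial i f x); intro end); ring.

Section VectorCalculus.
Variable R : realType.
Local Notation pt := (pt R).
Implicit Types (f g : pt -> R) (u v : vfield R).

Lemma partialD i f g : Sm f -> Sm g ->
  partial i (fun x => f x + g x) = fun x => partial i f x + partial i g x.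
Proof. by move=> sf sg; apply/pd_partial/pdD; exact: Sm_pdp. Qed.

Lemma partialZ i (a : R) f : Sm f -> partial i (fun x => a * f x) = fun x => a * partial i f x.
Proof. by move=> sf; apply/pd_partial/pdZ; exact: Sm_pdp. Qed.

Lemma rotE0 u x : rot u i0 x = partial i1 (u i2) x - partial i2 (u i1) x. Proof. by []. Qed.
Lemma rotE1 u x : rot u i1 x = partial i2 (u i0) x - partial i0 (u i2) x. Proof. by []. Qed.
Lemma rotE2 u x : rot u i2 x = partial i0 (u i1) x - partial i1 (u i0) x. Proof. by []. Qed.

Lemma eqI3 : ((i0 == i1) = false) * ((i0 == i2) = false) * ((i1 == i0) = false) *
  ((i1 == i2) = false) * ((i2 == i0) = false) * ((i2 == i1) = false).
Proof. by []. Qed.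

Definition vec3 (a b c : pt -> R) : vfield R := fun j => if j == i0 then a else if j == i1 then b else c.

Lemma rot_vec3 a b c x : (rot (vec3 a b c) i0 x = partial i1 c x - partial i2 b x) *
  (rot (vec3 a b c) i1 x = partial i2 a x - partial i0 c x) *
  (rot (vec3 a b c) i2 x = partial i0 b x - partial i1 a x).
Proof. by []. Qed.

Lemma div_vec3 a b c x : div (vec3 a b c) x = partial i0 a x + partial i1 b x + partial i2 c x.
Proof. by rewrite /Defs.div sum3. Qed.

Definition rotE := (rotE0, rotE1, rotE2).

Lemma rot_comb u v (a : R) j x : (forall i, Sm (u i)) -> (forall i, Sm (v i)) ->
  rot (fun i x => u i x + a * v i x) j x = rot u j x + a * rot v j x.
Proof.
move=> su sv.
have h i : Sm (fun x => a * v i x) by apply: Sm_mul; [exact: Sm_cst|].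
by elim/ord3P: j; rewrite !rotE !partialD// !partialZ//; pring.
Qed.

Lemma div_comb u v (a : R) x : (forall i, Sm (u i)) -> (forall i, Sm (v i)) ->
  div (fun i x => u i x + a * v i x) x = div u x + a * div v x.
Proof.
move=> su sv; have h i : Sm (fun x => a * v i x) by apply: Sm_mul; [exact: Sm_cst|].
by rewrite /Defs.div !sum3 !partialD// !partialZ//; pring.
Qed.

Lemma grad_comb f g (a : R) j x : Sm f -> Sm g ->
  grad (fun x => f x + a * g x) j x = grad f j x + a * grad g j x.
Proof.
move=> sf sg; have h : Sm (fun x => a * g x) by apply: Sm_mul; [exact: Sm_cst|].
by rewrite /grad partialD// partialZ.
Qed.
Lemma rot_Sm u i : (forall j, Sm (u j)) -> Sm (rot u i).
Proof.
move=> su; elim/ord3P: i.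
all: by apply: Sm_add; [exact: Sm_partial|apply: Sm_opp; exact: Sm_partial].
Qed.

Lemma div_Sm u : (forall j, Sm (u j)) -> Sm (div u).
Proof.
move=> su; rewrite /Defs.div (_ : (fun x => _) = fun x => partial i0 (u i0) x + partial i1 (u i1) x + partial i2 (u i2) x).
  by apply: Sm_add; [apply: Sm_add|]; exact: Sm_partial.
by apply/funext => x; rewrite sum3.
Qed.
End VectorCalculus.

(** * Exact solution of the unweighted system by modes *)

Section FlatSolution.
Variable R : realType.
Local Notation pt := (pt R).
Variable L : R.
Hypothesis L0 : 0 < L.
Implicit Types (f g q m : pt -> R) (Phi M : vfield R).

(* Parities: [bvec i] is that of the [i]-th component of a field with vanishing
   normal component on the faces of the box, [bcov i] that of the [i]-th component
   of a field with vanishing tangential components. *)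
Definition bvec (i : 'I_3) : 'I_3 -> bool := fun j => j == i.
Definition bcov (i : 'I_3) : 'I_3 -> bool := fun j => j != i.
Definition bfull : 'I_3 -> bool := fun=> true.
Definition bnone : 'I_3 -> bool := fun=> false.

Definition adm Phi q := (forall i, TS L (bvec i) (Phi i)) /\ TS L bfull q.

Lemma adm_Sm Phi q : adm Phi q -> (forall i, Sm (Phi i)) /\ Sm q.
Proof. by move=> [h1 h2]; split=> [i|]; [exact: TS_Sm (h1 i)|exact: TS_Sm h2]. Qed.

Lemma adm_comb Phi q Psi r (a : R) : adm Phi q -> adm Psi r ->
  adm (fun i x => Phi i x + a * Psi i x) (fun x => q x + a * r x).
Proof.
by move=> [h1 h2] [g1 g2]; split=> [i|]; apply: TS_add => //; exact: TS_scale.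
Qed.

Lemma adm0 : adm (fun _ _ => 0) (fun=> 0).
Proof. by split=> [i|]; exact: TS0. Qed.

(** The constant [c] carries the mean of [g]: the divergence of a field with vanishing normal
    component has mean zero. *)
Definition flat_solvable M g := exists Phi q (c : R), [/\ adm Phi q,
  forall j x, rot Phi j x + grad q j x = M j x & forall x, div Phi x + c = g x].

Lemma flat_solvable_comb M g M' g' (a : R) : flat_solvable M g -> flat_solvable M' g' ->
  flat_solvable (fun i x => M i x + a * M' i x) (fun x => g x + a * g' x).
Proof.
move=> [P [q [c [h1 h2 h3]]]] [P' [q' [c' [k1 k2 k3]]]].
have [s1 s2] := adm_Sm h1; have [s1' s2'] := adm_Sm k1.
exists (fun i x => P i x + a * P' i x), (fun x => q x + a * q' x), (c + a * c'); split.
- exact: adm_comb.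
- by move=> j x; rewrite rot_comb// grad_comb// -h2 -k2; pring.
- by move=> x; rewrite div_comb// -h3 -k3; pring.
Qed.

Lemma flat_solvable0 : flat_solvable (fun _ _ => 0) (fun=> 0).
Proof.
exists (fun _ _ => 0), (fun=> 0), 0; split; first exact: adm0.
- by move=> j x; rewrite /grad partial_cst0; elim/ord3P: j; rewrite rotE !partial_cst0; pring.
- by move=> x; rewrite /Defs.div sum3 !partial_cst0; pring.
Qed.

Lemma flat_solvable_ext M g M' g' : (forall j x, M j x = M' j x) -> g =1 g' ->
  flat_solvable M g -> flat_solvable M' g'.
Proof.
move=> hM hg [P [q [c [h1 h2 h3]]]]; exists P, q, c; split=> // [j x|x].
  by rewrite h2.
by rewrite h3.
Qed.

Definition sqfreq (k : 'I_3 -> nat) : R := \sum_(i < 3) freq L (k i) ^+ 2.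

Lemma mode_laplacian b k x : \sum_(i < 3) partial i (partial i (mode L b k)) x = - sqfreq k * mode L b k x.
Proof.
have h i y : partial i (partial i (mode L b k)) y = - freq L (k i) ^+ 2 * mode L b k y.
  have sM := Sm_mode L (flipb i b) k.
  rewrite (pd_partial (pd_mode L i b k)) partialZ// (pd_partial (pd_mode L i _ k)) flipbK /flipb eqxx.
  by case: (b i) => /=; rewrite /sgnb /=; pring.
by rewrite !sum3 !h /sqfreq sum3; pring.
Qed.

Lemma sqfreq_eq0 k : sqfreq k = 0 -> forall i, k i = 0%N.
Proof.
move=> /eqP; rewrite /sqfreq psumr_eq0; last by move=> i _; exact: sqr_ge0.
move=> /allP h i; have := h i; rewrite mem_index_enum => /(_ isT); rewrite sqrf_eq0 /freq.
rewrite mulf_eq0 pnatr_eq0 => /orP[/eqP //|].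
by rewrite gt_eqF// divr_gt0 ?pi_gt0// mulr_gt0.
Qed.

Lemma wave_true0 (t : R) : wave L true 0 t = 0.
Proof. by rewrite /wave /freq !mul0r sin0. Qed.

Lemma wave_false0 (t : R) : wave L false 0 t = 1.
Proof. by rewrite /wave /freq !mul0r cos0. Qed.

Definition unitf (i : 'I_3) m : vfield R := fun j => if j == i then m else fun=> 0.

Lemma unitfE m x : (unitf i0 m i0 x = m x) * (unitf i0 m i1 x = 0) * (unitf i0 m i2 x = 0) *
  (unitf i1 m i0 x = 0) * (unitf i1 m i1 x = m x) * (unitf i1 m i2 x = 0) *
  (unitf i2 m i0 x = 0) * (unitf i2 m i1 x = 0) * (unitf i2 m i2 x = m x).
Proof. by []. Qed.

(* As [rot rot = grad div - Delta] and [Delta M = - sqfreq k * M] for the mode [M], one can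
   take [Phi = rot (M e_i) / sqfreq k] and [q = - partial i M / sqfreq k]. *)
Lemma flat_solvable_unit_mode i k : flat_solvable (unitf i (mode L (bcov i) k)) (fun=> 0).
Proof.
set M := mode L (bcov i) k; have sM : Sm M := Sm_mode L _ k.
have tM : TS L (bcov i) M by have := TS_mode L (bcov i) k 1; congr TS; apply/funext => x; rewrite mul1r.
have [s0|s0] := eqVneq (sqfreq k) 0.
  (* At frequency zero the sine factors prescribed by [bcov i] make the mode vanish. *)
  have M0 x : M x = 0.
    rewrite /M /mode !(sqfreq_eq0 s0) /bcov.
    by elim/ord3P: i {M sM tM}; rewrite !eqxx ?eqI3 /= /freq !mul0r sin0 ?(mulr0, mul0r).
  by apply: flat_solvable_ext flat_solvable0 => // j x; rewrite /unitf; case: eqP.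
have lap x : M x = - (sqfreq k)^-1 * (partial i0 (partial i0 M) x + partial i1 (partial i1 M) x + partial i2 (partial i2 M) x).
  by have := mode_laplacian (bcov i) k x; rewrite sum3 => ->; rewrite mulrA mulrNN mulVf// mul1r.
have sP a : Sm (partial a M) := Sm_partial a sM.
have sZ a (c : R) : Sm (fun x => c * partial a M x) by apply: Sm_mul; [exact: Sm_cst|].
set c := (sqfreq k)^-1 in lap.
have cases3 : flat_solvable (unitf i M) (fun=> 0); last exact: cases3.
have fl a d : flipb a (bcov i) = d -> forall c, TS L d (fun x => c * partial a M x).
  by move=> <- c'; apply: TS_scale; exact: TS_partial.
have tq : TS L bfull (fun x => - c * partial i M x).
  apply: fl; apply/funext => j; rewrite /flipb /bcov /bfull; by case: eqP.
have bE (a b : 'I_3 -> bool) : a i0 = b i0 -> a i1 = b i1 -> a i2 = b i2 -> a = b.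
  by move=> *; apply/funext; elim/ord3P.
have pc a b := TS_partialC a b tM.
clearbody M c; move: i M sM tM lap sP sZ fl tq pc; elim/ord3P => M sM tM lap sP sZ fl tq pc.
- exists (vec3 (fun=> 0) (fun x => c * partial i2 M x) (fun x => - c * partial i1 M x)), (fun x => - c * partial i0 M x), 0; split.
  + split=> //; elim/ord3P; rewrite /vec3 /=; [exact: TS0|apply: fl; exact: bE|apply: fl; exact: bE].
  + move=> j x; rewrite /grad (partialZ _ _ (sP _)); elim/ord3P: j; rewrite rot_vec3 unitfE.
    * by rewrite (partialZ _ _ (sP i2)) (partialZ _ _ (sP i1)) lap; pring.
    * by rewrite (partialZ _ _ (sP i1)) partial_cst0 (pc i1 i0); pring.
    * by rewrite partial_cst0 (partialZ _ _ (sP i2)) (pc i2 i0); pring.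
  + by move=> x; rewrite div_vec3 partial_cst0 (partialZ _ _ (sP i2)) (partialZ _ _ (sP i1)) (pc i2 i1); pring.
- exists (vec3 (fun x => - c * partial i2 M x) (fun=> 0) (fun x => c * partial i0 M x)), (fun x => - c * partial i1 M x), 0; split.
  + split=> //; elim/ord3P; rewrite /vec3 /=; [apply: fl; exact: bE|exact: TS0|apply: fl; exact: bE].
  + move=> j x; rewrite /grad (partialZ _ _ (sP _)); elim/ord3P: j; rewrite rot_vec3 unitfE.
    * by rewrite partial_cst0 (partialZ _ _ (sP i0)) (pc i1 i0); pring.
    * by rewrite (partialZ _ _ (sP i2)) (partialZ _ _ (sP i0)) lap; pring.
    * by rewrite (partialZ _ _ (sP i2)) partial_cst0 (pc i2 i1); pring.
  + by move=> x; rewrite div_vec3 (partialZ _ _ (sP i2)) partial_cst0 (partialZ _ _ (sP i0)) (pc i2 i0); pring.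
- exists (vec3 (fun x => c * partial i1 M x) (fun x => - c * partial i0 M x) (fun=> 0)), (fun x => - c * partial i2 M x), 0; split.
  + split=> //; elim/ord3P; rewrite /vec3 /=; [apply: fl; exact: bE|apply: fl; exact: bE|exact: TS0].
  + move=> j x; rewrite /grad (partialZ _ _ (sP _)); elim/ord3P: j; rewrite rot_vec3 unitfE.
    * by rewrite (partialZ _ _ (sP i0)) partial_cst0 (pc i2 i0); pring.
    * by rewrite partial_cst0 (partialZ _ _ (sP i1)) (pc i2 i1); pring.
    * by rewrite (partialZ _ _ (sP i0)) (partialZ _ _ (sP i1)) lap; pring.
  + by move=> x; rewrite div_vec3 (partialZ _ _ (sP i1)) (partialZ _ _ (sP i0)) partial_cst0 (pc i1 i0); pring.
Qed.

(** For a nonzero frequency take [Phi = - grad M / sqfreq k], whose rotation is zero; the constant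
    mode goes into the constant of [flat_solvable]. *)
Lemma flat_solvable_div_mode k : flat_solvable (fun _ _ => 0) (mode L bnone k).
Proof.
set M := mode L bnone k; have sM : Sm M := Sm_mode L _ k.
have tM : TS L bnone M by have := TS_mode L bnone k 1; congr TS; apply/funext => x; rewrite mul1r.
have [s0|s0] := eqVneq (sqfreq k) 0.
  have M1 x : M x = 1 by rewrite /M /mode !(sqfreq_eq0 s0) /bnone !wave_false0 !mulr1.
  have [P [q [c [h1 h2 h3]]]] := flat_solvable0.
  by exists P, q, (c + 1); split=> // x; rewrite M1 addrA h3 add0r.
have lap x : M x = - (sqfreq k)^-1 * (partial i0 (partial i0 M) x + partial i1 (partial i1 M) x + partial i2 (partial i2 M) x).
  by have := mode_laplacian bnone k x; rewrite sum3 => ->; rewrite mulrA mulrNN mulVf// mul1r.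
have sP a : Sm (partial a M) := Sm_partial a sM.
set c := (sqfreq k)^-1 in lap.
have pc a b := TS_partialC a b tM.
exists (fun j x => - c * partial j M x), (fun=> 0), 0; split.
- split; last exact: TS0.
  clearbody M; move=> i; apply: TS_scale; have := TS_partial i tM; congr TS.
  by apply/funext => j; rewrite /flipb /bvec /bnone; case: eqP.
- clearbody M; move=> j x; rewrite /grad partial_cst0; elim/ord3P: j; rewrite rotE !partialZ//.
  + by rewrite (pc i2 i1); pring.
  + by rewrite (pc i2 i0); pring.
  + by rewrite (pc i1 i0); pring.
- by move=> x; rewrite /Defs.div sum3 !partialZ// lap; pring.
Qed.

Lemma flat_solvable_TS M g : (forall i, TS L (bcov i) (M i)) -> TS L bnone g -> flat_solvable M g.
Proof.
move=> tM tg.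
have hU i m : TS L (bcov i) m -> flat_solvable (unitf i m) (fun=> 0).
  elim=> [|a k f _ IH].
    by apply: flat_solvable_ext flat_solvable0 => // j x; rewrite /unitf; case: eqP.
  apply: flat_solvable_ext (flat_solvable_comb a IH (flat_solvable_unit_mode i k)).
    by move=> j x; rewrite /unitf; case: eqP => _; pring.
  by move=> x; rewrite mulr0 addr0.
have hg : flat_solvable (fun _ _ => 0) g.
  elim: tg => [|a k f _ IH]; first exact: flat_solvable0.
  apply: flat_solvable_ext (flat_solvable_comb a IH (flat_solvable_div_mode k)).
    by move=> j x; rewrite mulr0 addr0.
  by move=> x; rewrite addrC.
apply: flat_solvable_ext (flat_solvable_comb 1 (flat_solvable_comb 1 (flat_solvable_comb 1 hg
  (hU i0 _ (tM i0))) (hU i1 _ (tM i1))) (hU i2 _ (tM i2))).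
  by elim/ord3P => x; rewrite /unitf /=; pring.
by move=> x; pring.
Qed.

End FlatSolution.

(** * Density of trigonometric sums *)

Section BernoulliMean.
Variable R : realType.
Implicit Types (y : R) (h : nat -> R).

(* [bmean n y h] is the expectation of [h] at the number of successes in [n]
   independent trials of probability [y]; as a function of [y] it is the Bernstein
   polynomial with values [h]. *)
Fixpoint bmean n y h : R :=
  if n is m.+1 then (1 - y) * bmean m y h + y * bmean m y (fun j => h j.+1) else h 0%N.

Lemma bmeanD n y h1 h2 : bmean n y (fun j => h1 j + h2 j) = bmean n y h1 + bmean n y h2.
Proof. by elim: n h1 h2 => //= n IH h1 h2; rewrite !IH; ring. Qed.

Lemma bmeanZ n y (a : R) h : bmean n y (fun j => a * h j) = a * bmean n y h.
Proof. by elim: n h => //= n IH h; rewrite !IH; ring. Qed.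

Lemma bmean_cst n y (a : R) : bmean n y (fun=> a) = a.
Proof. by elim: n => //= n ->; ring. Qed.

Lemma le_bmean n y h1 h2 : 0 <= y <= 1 -> (forall j, h1 j <= h2 j) -> bmean n y h1 <= bmean n y h2.
Proof.
move=> /andP[y0 y1]; elim: n h1 h2 => //= n IH h1 h2 h.
by apply: lerD; apply: ler_wpM2l; rewrite ?subr_ge0//; apply: IH.
Qed.

(** Variance plus squared mean. The shift [a] is kept general because the induction step replaces
    [j] by [j + 1]. *)
Lemma bmean_sqr n y (a : R) :
  bmean n y (fun j => (j%:R + a) ^+ 2) = n%:R * y * (1 - y) + (n%:R * y + a) ^+ 2.
Proof.
elim: n a => [|n IH] a /=; first by rewrite !mul0r !add0r.
under [X in y * bmean n y X]eq_fun do rewrite -natr1 -addrA.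
by rewrite !IH -natr1; ring.
Qed.

Lemma bmean_var n y : (0 < n)%N -> 0 <= y <= 1 ->
  bmean n y (fun j => (j%:R / n%:R - y) ^+ 2) <= n%:R^-1.
Proof.
move=> n0 /andP[y0 y1]; have nn : n%:R != 0 :> R by rewrite pnatr_eq0 -lt0n.
rewrite (_ : (fun j => _) = fun j => n%:R ^- 2 * (j%:R + - (n%:R * y)) ^+ 2); last first.
  by apply/funext => j; field.
rewrite bmeanZ bmean_sqr subrr expr0n /= addr0.
rewrite (_ : _ * _ = n%:R^-1 * (y * (1 - y))); last by field.
by rewrite ler_piMr ?invr_ge0//; nra.
Qed.

Lemma bmean_dist n y h (a : R) : `|bmean n y h - a| = `|bmean n y (fun j => h j - a)|.
Proof. by rewrite bmeanD bmean_cst. Qed.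

Lemma norm_bmean n y h1 h2 : 0 <= y <= 1 -> (forall j, `|h1 j| <= h2 j) -> `|bmean n y h1| <= bmean n y h2.
Proof.
move=> y01 h; rewrite ler_norml -mulN1r -bmeanZ !le_bmean// => j; have := h j; rewrite ler_norml; lra.
Qed.
End BernoulliMean.

Section Density.
Variable R : realType.
Local Notation pt := (pt R).
Variable L : R.
Hypothesis L0 : 0 < L.
Local Notation TS := (TS L).
Local Notation wave := (wave L).
Local Notation freq := (freq L).

(** The product-to-sum formulas, with [n = 0] apart since the frequency [n - 1] occurs.
    Multiplication by a cosine thus keeps the parity [s], so polynomials in cosines act on each
    class [TS b]. *)
Lemma wave_mulcos s n : exists a a' n' n'', forall t : R,
  wave false 1 t * wave s n t = a * wave s n' t + a' * wave s n'' t.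
Proof.
case: n => [|n].
  case: s; first by exists 0, 0, 0%N, 0%N => t; rewrite wave_true0; ring.
  by exists 1, 0, 1%N, 0%N => t; rewrite wave_false0; ring.
exists (2^-1), (2^-1), n.+2, n => t.
have E : forall m, freq m * (t + L) = m%:R * (freq 1 * (t + L)) by move=> m; rewrite /freq; ring.
rewrite /wave !(E n.+2) !(E n) !(E n.+1).
set th := freq 1 * (t + L).
rewrite (_ : n.+2%:R * th = n.+1%:R * th + th); last by rewrite -natr1; ring.
rewrite (_ : n%:R * th = n.+1%:R * th - th); last by rewrite -natr1; ring.
by case: s; rewrite /th E -/th mul1r ?sinD ?cosD ?cosN ?sinN; field.
Qed.

Lemma TS_mulcos b i f : TS b f -> TS b (fun x => wave false 1 (crd i x) * f x).
Proof.
elim=> [|a k {}f _ IH]; first by have := TS0 L b; congr TS; apply/funext => x; rewrite mulr0.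
have [c [c' [n [m h]]]] := wave_mulcos (b i) (k i).
pose kk p := fun j => if j == i then p else k j.
have mE x : wave false 1 (crd i x) * mode L b k x = c * mode L b (kk n) x + c' * mode L b (kk m) x.
  have := h (crd i x); rewrite /mode /kk => {}h; clear kk; move: h; elim/ord3P: i {IH} => h; rewrite !eqxx !eqI3.
  - by rewrite !mulrA h; ring.
  - rewrite (_ : _ * (_ * _ * _) = wave (b i0) (k i0) (crd i0 x) * (wave false 1 (crd i1 x) * wave (b i1) (k i1) (crd i1 x)) * wave (b i2) (k i2) (crd i2 x)); last by ring.
    by rewrite h; ring.
  - rewrite (_ : _ * (_ * _ * _) = wave (b i0) (k i0) (crd i0 x) * wave (b i1) (k i1) (crd i1 x) * (wave false 1 (crd i2 x) * wave (b i2) (k i2) (crd i2 x))); last by ring.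
    by rewrite h; ring.
have := TS_add (TSc (a * c) (kk n) (TS_mode L b (kk m) (a * c'))) IH; congr TS.
apply/funext => x; rewrite mulrDr.
by rewrite [_ * (a * _)]mulrCA mE; ring.
Qed.

(** A decreasing bijection from the interval onto the unit interval: the variable in which Bernstein
    polynomials are taken, affine in a cosine. *)
Definition hcos (t : R) : R := (1 + wave false 1 t) / 2.

Lemma hcos01 (t : R) : 0 <= hcos t <= 1.
Proof.
rewrite /hcos /wave; have := cos_le1 (freq 1 * (t + L)); have := cos_geN1 (freq 1 * (t + L)); lra.
Qed.

Lemma TS_bmean b i n (F : nat -> pt -> R) : (forall j, TS b (F j)) ->
  TS b (fun x => bmean n (hcos (crd i x)) (F^~ x)).
Proof.
elim: n F => [|n IH] F hF /=; first exact: hF.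
have h1 := IH _ hF; have h2 := IH _ (fun j => hF j.+1).
have := TS_add (TS_add (TS_scale 2^-1 h1) (TS_scale (- 2^-1) (TS_mulcos i h1)))
  (TS_add (TS_scale 2^-1 h2) (TS_scale 2^-1 (TS_mulcos i h2))).
by congr TS; apply/funext => x; rewrite /hcos; field.
Qed.

Lemma angle_range (t : R) : - L <= t <= L -> 0 <= freq 1 * (t + L) <= pi.
Proof.
move=> /andP[h1 h2]; have p0 := @pi_gt0 R; have f0 : 0 < freq 1.
  by rewrite /freq mul1r divr_gt0// mulr_gt0.
apply/andP; split; first by rewrite mulr_ge0 ?(ltW f0)//; lra.
rewrite (_ : pi = freq 1 * (2 * L)); last by rewrite /freq; field; exact: lt0r_neq0.
by rewrite ler_wpM2l ?(ltW f0)//; lra.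
Qed.

Lemma hcos_inj (t s : R) : - L <= t <= L -> - L <= s <= L -> hcos t = hcos s -> t = s.
Proof.
move=> tL sL; rewrite /hcos /wave => h.
have f0 : freq 1 != 0 by rewrite /freq mul1r mulf_neq0 ?invr_neq0 ?mulf_neq0// gt_eqF// pi_gt0.
have : freq 1 * (t + L) = freq 1 * (s + L).
  apply: cos_inj; rewrite ?in_itv /=; try exact: angle_range.
  by lra.
by move/(mulfI f0); lra.
Qed.

Definition node (s : R) : R := acos (2 * s - 1) / freq 1 - L.

Lemma nodeP (s : R) : 0 <= s <= 1 -> - L <= node s <= L /\ hcos (node s) = s.
Proof.
move=> s01; have [a0 ac] : 0 <= acos (2 * s - 1) <= pi /\ cos (acos (2 * s - 1)) = 2 * s - 1.
  by apply: acos_def; lra.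
have p0 := @pi_gt0 R; have f0 : 0 < freq 1.
  by rewrite /freq mul1r divr_gt0// mulr_gt0.
have fE : freq 1 * (2 * L) = pi by rewrite /freq; field; exact: lt0r_neq0.
split.
  rewrite /node; apply/andP; split.
    by rewrite lerBrDr addNr divr_ge0//; [lra|exact: ltW].
  rewrite lerBlDr ler_pdivrMr//; move: fE; lra.
have fa : freq 1 * (acos (2 * s - 1) / freq 1 - L + L) = acos (2 * s - 1).
  by field; exact: lt0r_neq0.
by rewrite /hcos /wave /node fa ac; field.
Qed.

Lemma continuous_hcos : continuous hcos.
Proof.
move=> t; apply: cvgM; last exact: cvg_cst.
apply: cvgD; first exact: cvg_cst.
apply: (@continuous_comp _ _ _ (fun t : R => freq 1 * (t + L)) cos); last exact: continuous_cos.
by apply: cvgM; [exact: cvg_cst|apply: cvgD; [exact: cvg_id|exact: cvg_cst]].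
Qed.

Definition hdist (x z : pt) : R := \sum_(i < 3) (hcos (crd i z) - hcos (crd i x)) ^+ 2.

(** A modulus of continuity quadratic in [hcos], so that the error of a Bernstein polynomial is
    bounded by variances alone. *)
Lemma hdist_modulus (g : pt -> R) (e : R) : continuous g -> 0 < e -> exists2 C, 0 <= C &
  forall x z, cbox L x -> cbox L z -> `|g z - g x| <= e + C * hdist x z.
Proof.
move=> cg e0; have [M M0 hM] := continuous_bounded_cbox L cg.
pose K : set (pt * pt) := (cbox L `*` cbox L) `&` [set p | e <= `|g p.2 - g p.1|].
have c1 (f : pt -> R) : continuous f -> continuous (fun p : pt * pt => f p.1).
  by move=> cf p; apply: (@continuous_comp _ _ _ fst f); [exact: cvg_fst|exact: cf].
have c2 (f : pt -> R) : continuous f -> continuous (fun p : pt * pt => f p.2).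
  by move=> cf p; apply: (@continuous_comp _ _ _ snd f); [exact: cvg_snd|exact: cf].
have cgg : continuous (fun p : pt * pt => `|g p.2 - g p.1|).
  move=> p; apply: (@continuous_comp _ _ _ (fun p : pt * pt => g p.2 - g p.1) Num.norm).
    by apply: cvgB; [exact: c2|exact: c1].
  exact: norm_continuous.
have cK : compact K.
  apply: compact_closedI; first by apply: compact_setX; exact: cbox_compact.
  apply: (@preimage_closed _ _ (fun p : pt * pt => `|g p.2 - g p.1|) [set r | e <= r]).
    by move=> p _; exact: cgg.
  exact: closed_ge.
have hc i : continuous (fun x : pt => hcos (crd i x)).
  by apply: (cont_comp (p := hcos)); [exact: continuous_hcos|exact: crd_continuous].
have cd : continuous (fun p : pt * pt => hdist p.1 p.2).
  have cs i : continuous (fun p : pt * pt => (hcos (crd i p.2) - hcos (crd i p.1)) ^+ 2).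
    have cb : continuous (fun p : pt * pt => hcos (crd i p.2) - hcos (crd i p.1)).
      by move=> p; apply: cvgB; [exact: (c2 _ (hc i))|exact: (c1 _ (hc i))].
    by move=> p; exact: (cvgM (cb p) (cb p)).
  rewrite (_ : (fun p : pt * pt => _) = fun p : pt * pt =>
   (hcos (crd i0 p.2) - hcos (crd i0 p.1)) ^+ 2 + (hcos (crd i1 p.2) - hcos (crd i1 p.1)) ^+ 2
   + (hcos (crd i2 p.2) - hcos (crd i2 p.1)) ^+ 2); last by apply/funext => q; rewrite /hdist sum3.
  by move=> p; apply: cvgD; [apply: cvgD|]; exact: cs.
have hd0 x z : 0 <= hdist x z by apply: sumr_ge0 => i _; exact: sqr_ge0.
have [Kn|/set0P Kn] := eqVneq K set0.
  exists 0 => // x z xL zL; rewrite mul0r addr0 leNgt; apply/negP => h.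
  have : K (x, z) by split => //=; exact: ltW.
  by rewrite Kn.
(* [hdist] has a positive minimum over the pairs where [g] oscillates by at least [e], since [hcos]
   is injective on the interval. For these pairs [2 * M] over this minimum serves as [C]. *)
have [p pK hp] := compact_EVT_min Kn cK (continuous_subspaceT cd).
move: pK; rewrite inE => -[[p1 p2] /= pe].
have m0 : 0 < hdist p.1 p.2.
  rewrite lt_neqAle hd0 andbT; apply/eqP => /esym/eqP; rewrite /hdist psumr_eq0; last by move=> i _; exact: sqr_ge0.
  move=> /allP h; move: pe; suff -> : p.2 = p.1 by rewrite subrr normr0 leNgt e0.
  apply: pt_ext => i; have := h i; rewrite mem_index_enum => /(_ isT); rewrite sqrf_eq0 subr_eq0 => /eqP.
  by apply: hcos_inj; [exact: p2|exact: p1].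
exists (2 * M / hdist p.1 p.2); first by rewrite divr_ge0 ?mulr_ge0// ltW.
move=> x z xL zL; have [h|h] := ltP `|g z - g x| e.
  by rewrite (le_trans (ltW h))// lerDl mulr_ge0// divr_ge0 ?mulr_ge0// ltW.
have xzK : (x, z) \in K by rewrite inE; split.
have := hp _ xzK => /= hh.
apply: (@le_trans _ _ (2 * M)).
  by rewrite (le_trans (ler_normB _ _))//; have := hM _ xL; have := hM _ zL; lra.
apply: (@le_trans _ _ (2 * M / hdist p.1 p.2 * hdist x z)); last by rewrite lerDr ltW.
by rewrite -mulrA ler_peMr ?mulr_ge0// mulrC ler_pdivlMr// mul1r.
Qed.

(** The lowest mode of parity [b] that is positive inside the box. Its product with a polynomial in
    cosines is in [TS b]. *)
Definition sgm (b : 'I_3 -> bool) : pt -> R := mode L b (fun i => if b i then 1%N else 0%N).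

Lemma sgm_TS b a : TS b (fun x => a * sgm b x).
Proof. exact: TS_mode. Qed.

Lemma sgm_le1 b x : `|sgm b x| <= 1.
Proof.
have w s n (t : R) : `|wave s n t| <= 1.
  by rewrite ler_norml /wave; case: s; rewrite ?sin_le1 ?sin_geN1 ?cos_le1 ?cos_geN1.
rewrite /sgm /mode !normrM -[leRHS]mulr1.
by apply: ler_pM; rewrite ?mulr_ge0 ?w// -[leRHS]mulr1; apply: ler_pM; rewrite ?w.
Qed.

Lemma sgm_gt0 b x : box L x -> 0 < sgm b x.
Proof.
move=> bx; have w i : 0 < wave (b i) (if b i then 1%N else 0%N) (crd i x).
  case: (b i); last by rewrite wave_false0.
  have /andP[h1 h2] := bx i; apply: sin_gt0_pi; have p0 := @pi_gt0 R.
  have f0 : 0 < freq 1 by rewrite /freq mul1r divr_gt0// mulr_gt0.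
  apply/andP; split; first by rewrite mulr_gt0//; lra.
  rewrite (_ : pi = freq 1 * (2 * L)); last by rewrite /freq; field; exact: lt0r_neq0.
  by rewrite ltr_pM2l//; lra.
by rewrite /sgm /mode !mulr_gt0.
Qed.

(** The approximant is [sgm L b] times the Bernstein polynomial of [g] in the three variables
    [hcos (crd i x)], and [hdist_modulus] bounds its error. *)
Lemma sgm_mul_approx b (g : pt -> R) (e : R) : continuous g -> 0 < e ->
  exists2 t, TS b t & forall x, cbox L x -> `|t x - sgm b x * g x| <= e.
Proof.
move=> cg e0; have e2 : 0 < e / 2 by rewrite divr_gt0.
have [C C0 hC] := hdist_modulus cg e2.
(* Each of the three coordinates contributes a variance of at most [1/n], hence the factor 3. *)
have [n n0 hn] : exists2 n, (0 < n)%N & C * (3 * n%:R^-1) <= e / 2.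
  exists (Num.bound (6 * C / e)).+1 => //.
  have h : 6 * C / e < (Num.bound (6 * C / e)).+1%:R.
    by rewrite (lt_trans (archi_boundP _)) ?ltr_nat// divr_ge0 ?mulr_ge0 ?(ltW e0).
  rewrite mulrA ler_pdivrMr ?ltr0Sn//; move: h; rewrite ltr_pdivrMr//; lra.
(* [norm_bmean] and [le_bmean] compare at every index, also above [n]; the truncation keeps all
   nodes in the interval. *)
pose nd j := node (Num.min 1 (j%:R / n%:R)).
have ndP j : - L <= nd j <= L /\ hcos (nd j) = Num.min 1 (j%:R / n%:R).
  by apply: nodeP; rewrite le_min ler01 divr_ge0//= ge_min lexx.
pose G j0 j1 j2 : R := g ((nd j0, nd j1), nd j2).
have nodes j0 j1 j2 x : cbox L x -> `|G j0 j1 j2 - g x| <= e / 2 + C * ((j0%:R / n%:R - hcos (crd i0 x)) ^+ 2 +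
   (j1%:R / n%:R - hcos (crd i1 x)) ^+ 2 + (j2%:R / n%:R - hcos (crd i2 x)) ^+ 2).
  move=> xL; apply: le_trans (hC x _ xL _) _.
    by elim/ord3P; rewrite /crd /=; apply: (ndP _).1.
  have h j i : (hcos (nd j) - hcos (crd i x)) ^+ 2 <= (j%:R / n%:R - hcos (crd i x)) ^+ 2.
    rewrite (ndP j).2; have := hcos01 (crd i x); rewrite /Num.min; case: ltP => //; nra.
  rewrite lerD2l ler_wpM2l// /hdist sum3; apply: lerD; [apply: lerD|]; exact: h.
exists (fun x => bmean n (hcos (crd i0 x)) (fun j0 => bmean n (hcos (crd i1 x)) (fun j1 =>
   bmean n (hcos (crd i2 x)) (fun j2 => G j0 j1 j2 * sgm b x)))).
  apply: (TS_bmean _ _ (F := fun j0 x => _)) => j0; apply: (TS_bmean _ _ (F := fun j1 x => _)) => j1.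
  apply: (TS_bmean _ _ (F := fun j2 x => _)) => j2; exact: sgm_TS.
move=> x xL.
have -> : bmean n (hcos (crd i0 x)) (fun j0 => bmean n (hcos (crd i1 x)) (fun j1 =>
   bmean n (hcos (crd i2 x)) (fun j2 => G j0 j1 j2 * sgm b x))) =
   sgm b x * bmean n (hcos (crd i0 x)) (fun j0 => bmean n (hcos (crd i1 x)) (fun j1 =>
   bmean n (hcos (crd i2 x)) (fun j2 => G j0 j1 j2))).
  rewrite -bmeanZ; congr bmean; apply/funext => j0; rewrite -bmeanZ; congr bmean; apply/funext => j1.
  by rewrite -bmeanZ; congr bmean; apply/funext => j2; rewrite mulrC.
rewrite -mulrBr normrM -[leRHS]mul1r; apply: ler_pM => //; first exact: sgm_le1.
have y i := hcos01 (crd i x).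
set v0 := hcos (crd i0 x); set v1 := hcos (crd i1 x); set v2 := hcos (crd i2 x).
rewrite bmean_dist.
apply: (@le_trans _ _ (bmean n v0 (fun j0 => bmean n v1 (fun j1 => bmean n v2 (fun j2 =>
   e / 2 + C * ((j0%:R / n%:R - v0) ^+ 2 + (j1%:R / n%:R - v1) ^+ 2 + (j2%:R / n%:R - v2) ^+ 2)))))).
  apply: norm_bmean => [|j0]; first exact: y.
  rewrite bmean_dist; apply: norm_bmean => [|j1]; first exact: y.
  rewrite bmean_dist; apply: norm_bmean => [|j2]; first exact: y.
  exact: nodes.
have step1 j0 j1 : bmean n v2 (fun j2 =>
   e / 2 + C * ((j0%:R / n%:R - v0) ^+ 2 + (j1%:R / n%:R - v1) ^+ 2 + (j2%:R / n%:R - v2) ^+ 2)) <=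
   e / 2 + C * ((j0%:R / n%:R - v0) ^+ 2 + (j1%:R / n%:R - v1) ^+ 2 + n%:R^-1).
  rewrite bmeanD bmean_cst bmeanZ bmeanD bmean_cst lerD2l ler_wpM2l// lerD2l.
  by apply: bmean_var => //; exact: y.
have step2 j0 : bmean n v1 (fun j1 => e / 2 + C * ((j0%:R / n%:R - v0) ^+ 2 + (j1%:R / n%:R - v1) ^+ 2 + n%:R^-1)) <=
   e / 2 + C * ((j0%:R / n%:R - v0) ^+ 2 + n%:R^-1 + n%:R^-1).
  rewrite bmeanD bmean_cst bmeanZ 2!bmeanD !bmean_cst lerD2l ler_wpM2l// lerD2r lerD2l.
  by apply: bmean_var => //; exact: y.
apply: le_trans (le_bmean _ _ _) _; first exact: y.
  move=> j0; apply: le_bmean; first exact: y.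
  by move=> j1; exact: step1.
apply: le_trans (le_bmean _ _ step2) _; first exact: y.
rewrite bmeanD bmean_cst bmeanZ 2!bmeanD !bmean_cst.
apply: (@le_trans _ _ (e / 2 + C * (n%:R^-1 + n%:R^-1 + n%:R^-1))).
  rewrite lerD2l ler_wpM2l// !lerD2r; by apply: bmean_var => //; exact: y.
by move: hn; rewrite mulrC; lra.
Qed.
End Density.

Section TrigDensity.
Variable R : realType.
Local Notation mR := (measurableTypeR R).
Local Notation mpt := ((mR * mR) * mR)%type.
Local Notation pt := (pt R).
Variable L : R.
Hypothesis L0 : 0 < L.

Lemma nrm2D_le D (f g : pt -> R) : mbl3 D -> L2 D f -> L2 D g ->
  nrm2 D (fun x => f x + g x) <= 2 * nrm2 D f + 2 * nrm2 D g.
Proof.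
move=> mD hf hg; have h1 := L2_itg2 mD hf; have h2 := L2_itg2 mD hg.
rewrite /nrm2 -(integZ _ mD h1) -(integZ _ mD h2) -(integD mD (itgZ _ mD h1) (itgZ _ mD h2)).
apply: le_integ => //; first exact: L2_itg2 (L2D mD hf hg).
  by apply: itgD => //; exact: itgZ.
by move=> x _; have := sqr_ge0 (f x - g x); nra.
Qed.

Lemma nrm2_le_sup D (f : pt -> R) (e : R) : bdm D -> continuous f -> 0 <= e ->
  (forall x, D x -> `|f x| <= e) -> nrm2 D f <= e ^+ 2 * integ D (fun=> 1).
Proof.
move=> bD cf e0 h; have mD := bD.1; have i1 : itg D (fun=> 1) by apply: bdm_itg => //; exact: cont_cst.
rewrite /nrm2 -integZ//; apply: le_integ => //.
- by apply: bdm_itg => //; exact: cont_sqr.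
- exact: itgZ.
- by move=> x Dx; rewrite mulr1 -real_normK ?num_real// !expr2; apply: ler_pM => //; exact: h.
Qed.

(** The quotient of [f] by [s = sgm L b] is singular at the boundary, so [h = f s / (s^2 + d)] is
    used. The error [f d / (s^2 + d)] is dominated by [f] and tends to 0 inside the box as [d]
    does. *)
Lemma sgm_regularized_cvg (b : 'I_3 -> bool) (f : pt -> R) (e : R) : continuous f -> 0 < e ->
  exists2 h : pt -> R, continuous h & nrm2 (box L) (fun x => f x - sgm L b x * h x) < e.
Proof.
move=> cf e0; pose d (n : nat) : R := n.+1%:R^-1.
have d0 n : 0 < d n by rewrite invr_gt0 ltr0Sn.
pose s := sgm L b; have cs : continuous s := Sm_continuous (Sm_mode L _ _).
have sd0 n x : 0 < s x ^+ 2 + d n by rewrite ltr_wpDl// sqr_ge0.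
pose r n x := d n / (s x ^+ 2 + d n).
have cr n : continuous (fun x => (s x ^+ 2 + d n)^-1).
  move=> x; apply: cvgV; first exact: lt0r_neq0.
  exact: (cont_add (cont_sqr cs) (@cont_cst _ (d n)) (x := x)).
pose F n x := (f x * r n x) ^+ 2.
have cF n : continuous (F n).
  by apply: cont_sqr; apply: cont_mul => //; apply: cont_mul => //; exact: cont_cst.
have r01 n x : 0 <= r n x <= 1.
  apply/andP; split; first by apply: divr_ge0; apply: ltW.
  by rewrite /r ler_pdivrMr// mul1r lerDr sqr_ge0.
have bQ := box_bdm L; have mQ := bQ.1.
have dlim : (\int[@mu3 R]_(x in (box L : set mpt)) (F n x)%:E)%E @[n --> \oo] --> (\int[@mu3 R]_(x in (box L : set mpt)) (0 : R)%:E)%E.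
  apply: (@dominated_cvg _ mpt R (@mu3 R) (box L) mQ (fun n x => (F n x)%:E) (fun=> 0%:E) (fun x => (f x ^+ 2)%:E)).
  - by move=> n; apply/measurable_EFinP; exact: continuous_measurable3.
  - move=> x bx; apply/cvg_EFin; first by near=> n.
    have s2 : 0 < s x ^+ 2 by rewrite exprn_gt0// sgm_gt0.
    have f1 : 0 < f x ^+ 2 + 1 by rewrite ltr_wpDl// sqr_ge0.
    apply/cvgrPdist_lt => a a0.
    have as0 : 0 < a * s x ^+ 2 by rewrite mulr_gt0.
    have q0 : 0 < a * s x ^+ 2 / (f x ^+ 2 + 1) by rewrite divr_gt0.
    near=> n; rewrite sub0r normrN (ger0_norm (sqr_ge0 _ : 0 <= F n x)) /F exprMn.
    apply: (@le_lt_trans _ _ (f x ^+ 2 * r n x)).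
      by rewrite ler_wpM2l ?sqr_ge0//; have := r01 n x; nra.
    apply: (@le_lt_trans _ _ (f x ^+ 2 * (d n / s x ^+ 2))).
      apply: ler_wpM2l; first exact: sqr_ge0.
      apply: ler_wpM2l; first exact: ltW.
      by rewrite lef_pV2 ?posrE// lerDl ltW.
    rewrite mulrA ltr_pdivrMr//; apply: (@le_lt_trans _ _ ((f x ^+ 2 + 1) * d n)).
      by apply: ler_wpM2r; [exact: ltW|rewrite lerDl].
    rewrite mulrC -ltr_pdivlMr//; near: n.
    exact: (near_infty_natSinv_lt (PosNum q0)).
  - by [].
  - by apply: bdm_itg => //; exact: cont_sqr.
  - move=> n x _ /=; rewrite lee_fin (ger0_norm (sqr_ge0 _ : 0 <= F n x)) /F exprMn ler_piMr ?sqr_ge0//.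
    by have := r01 n x; nra.
have [n hn] : exists n, nrm2 (box L) (fun x => f x * r n x) < e.
  move: dlim; rewrite integral0 => /fine_cvgP[_ /cvgrPdist_lt /(_ _ e0) [n _ /(_ n (leqnn n))]].
  rewrite /= sub0r normrN => hh; exists n; apply: le_lt_trans hh; exact: ler_norm.
exists (fun x => f x * s x * (s x ^+ 2 + d n)^-1).
  by apply: cont_mul => //; exact: cont_mul.
apply: le_lt_trans hn; rewrite le_eqVlt; apply/orP; left; apply/eqP.
by apply: eq_integ => x _; rewrite /r /s; congr (_ ^+ 2); field; exact: lt0r_neq0 (sd0 n x).
Unshelve. all: by end_near.
Qed.

Lemma TS_dense (b : 'I_3 -> bool) (f : pt -> R) (e : R) : continuous f -> 0 < e ->
  exists2 t, TS L b t & nrm2 (box L) (fun x => f x - t x) < e.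
Proof.
move=> cf e0; have e4 : 0 < e / 4 by rewrite divr_gt0.
have [h ch hh] := sgm_regularized_cvg b cf e4.
have bQ := box_bdm L; have mQ := bQ.1.
set v := integ (box L) (fun=> 1 : R); have v0 : 0 <= v by apply: integ_ge0.
(* With the factor 2 of [nrm2D_le], the two approximations cost less than [e / 2] and at most
   [e / 4]. *)
pose a := Num.sqrt (e / (8 * (v + 1))).
have v1 : 0 < 8 * (v + 1) by rewrite mulr_gt0// ltr_wpDl.
have a0 : 0 < a by rewrite sqrtr_gt0 divr_gt0.
have [t tt ht] := sgm_mul_approx L0 b ch a0.
exists t => //.
have cs : continuous (sgm L b) := Sm_continuous (Sm_mode L _ _).
have ct := Sm_continuous (TS_Sm tt).
have c1 : continuous (fun x => f x - sgm L b x * h x).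
  by apply: cont_add => //; apply: cont_opp; exact: cont_mul.
have c2 : continuous (fun x => sgm L b x * h x - t x).
  by apply: cont_add; [exact: cont_mul|exact: cont_opp].
have -> : nrm2 (box L) (fun x => f x - t x) = nrm2 (box L) (fun x => (f x - sgm L b x * h x) + (sgm L b x * h x - t x)).
  by apply: eq_integ => x _; congr (_ ^+ 2); ring.
apply: le_lt_trans (nrm2D_le mQ (continuous_L2 bQ c1) (continuous_L2 bQ c2)) _.
have : nrm2 (box L) (fun x => sgm L b x * h x - t x) <= a ^+ 2 * v.
  apply: nrm2_le_sup => //; first exact: ltW.
  by move=> x /(@box_cbox R) bx; rewrite distrC; exact: ht.
rewrite sqr_sqrtr; last by rewrite divr_ge0// ltW.
have : e / (8 * (v + 1)) * v <= e / 8.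
  rewrite mulrAC ler_pdivrMr//; nra.
lra.
Qed.
End TrigDensity.

(** * The weighted first-order system *)

Lemma Bochner_arith (R : realFieldType) (r g d v w : R) : 0 <= r * w ->
  r * g <= r * d + r * v ^+ 2 + (r * (g + w) - (r * d + r * v ^+ 2)).
Proof. lra. Qed.

Section Bochner.
Variable R : realType.
Local Notation pt := (pt R).
Variable L : R.
Hypothesis L0 : 0 < L.
Local Notation I := (integ (box L)).
Local Notation adm := (adm L).

Lemma integ_div_zero (F G : 'I_3 -> pt -> R) : (forall i, pd i (F i) (G i)) ->
  (forall i, continuous (G i)) ->
  (forall i x, `|crd i x| = L -> F i x = 0) -> I (fun x => \sum_(i < 3) G i x) = 0.
Proof.
move=> pF cG hF; have bQ := box_bdm L; rewrite integ_sum3; [|exact: bQ.1|by move=> i; exact: bdm_itg].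
by rewrite sum3 !(integ_pd0 L0 (pF _) (cG _) (hF _)) !addr0.
Qed.

Definition gradsq (Phi : vfield R) (x : pt) : R := \sum_(i < 3) \sum_(j < 3) partial j (Phi i) x ^+ 2.

Variables (V : pt -> R) (V1 : 'I_3 -> pt -> R) (V2 : 'I_3 -> 'I_3 -> pt -> R).
Hypothesis cV : continuous V.
Hypothesis cV1 : forall i, continuous (V1 i).
Hypothesis cV2 : forall i j, continuous (V2 i j).
Hypothesis pV : forall i, pd i V (V1 i).
Hypothesis pV1 : forall i j, pd j (V1 i) (V2 i j).
Hypothesis V2ge0 : forall x (xi : 'I_3 -> R), 0 <= \sum_(i < 3) \sum_(j < 3) V2 i j x * xi i * xi j.

Definition rho (x : pt) : R := expR (- V x).
(** [rho * divV Phi] is the divergence of [rho * Phi]. *)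
Definition divV (Phi : vfield R) (x : pt) : R := div Phi x - dot V1 Phi x.

Lemma rho_gt0 x : 0 < rho x. Proof. exact: expR_gt0. Qed.

Lemma rho_cont : continuous rho. Proof. by apply: cont_expR; exact: cont_opp. Qed.

Lemma pd_rho i : pd i rho (fun x => rho x * - V1 i x).
Proof. by apply: (pd_comp (p := @expR R)) (pdN (pV i)) => t; exact: is_derive_expR. Qed.

(** The algebra of the Bochner identity. [P], [D1], [D2] stand for the values of [Phi] and its
    derivatives ([D1 i j] for [partial j (Phi i)]), and [v1], [v2] for those of [V]. The left side
    is the divergence of [rho ((Phi . grad) Phi - Phi divV Phi)], whose second derivatives of [Phi]
    cancel by symmetry. *)
Lemma Bochner_pointwise (P : 'I_3 -> R) (D1 : 'I_3 -> 'I_3 -> R) (D2 : 'I_3 -> 'I_3 -> 'I_3 -> R)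
   (v1 : 'I_3 -> R) (v2 : 'I_3 -> 'I_3 -> R) (r : R) :
  (forall i j k, D2 i j k = D2 i k j) ->
  let dv := \sum_(j < 3) D1 j j - \sum_(j < 3) v1 j * P j in
  \sum_(i < 3) ((r * - v1 i) * (\sum_(j < 3) P j * D1 i j - P i * dv) +
    r * (\sum_(j < 3) (D1 j i * D1 i j + P j * D2 i j i) - (D1 i i * dv +
      P i * (\sum_(j < 3) D2 j j i - \sum_(j < 3) (v2 j i * P j + v1 j * D1 j i))))) =
  r * (\sum_(i < 3) \sum_(j < 3) D1 i j ^+ 2 + \sum_(i < 3) \sum_(j < 3) v2 i j * P i * P j)
  - (r * ((D1 i2 i1 - D1 i1 i2) ^+ 2 + (D1 i0 i2 - D1 i2 i0) ^+ 2 + (D1 i1 i0 - D1 i0 i1) ^+ 2) + r * dv ^+ 2).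
Proof.
move=> sD dv; rewrite /dv !sum3.
rewrite (sD i0 i1 i0) (sD i0 i2 i0) (sD i1 i0 i1) (sD i1 i2 i1) (sD i2 i0 i2) (sD i2 i1 i2).
ring.
Qed.

Lemma rot_sq (Phi : vfield R) x : dot (rot Phi) (rot Phi) x =
  (partial i1 (Phi i2) x - partial i2 (Phi i1) x) ^+ 2 + (partial i2 (Phi i0) x - partial i0 (Phi i2) x) ^+ 2
  + (partial i0 (Phi i1) x - partial i1 (Phi i0) x) ^+ 2.
Proof. by rewrite /dot sum3 !rotE !expr2. Qed.

Section Admissible.
Variables (Phi : vfield R) (q : pt -> R).
Hypothesis a : adm Phi q.

Let sP i : Sm (Phi i). Proof. exact: (adm_Sm a).1. Qed.
Let sq : Sm q. Proof. exact: (adm_Sm a).2. Qed.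

Lemma adm_normal0 i x : `|crd i x| = L -> Phi i x = 0.
Proof. by move=> h; apply: (TS_face L0 (a.1 i) _ h); rewrite /bvec. Qed.

(** Differentiation in direction [j] flips only the [j]-th parity, so the sine factor in direction
    [i] survives. *)
Lemma adm_tangential0 i j x : j != i -> `|crd i x| = L -> partial j (Phi i) x = 0.
Proof.
move=> ij h; have := TS_partial j (a.1 i) => /(TS_face L0) /(_ _ h); apply.
by rewrite /flipb /bvec eq_sym (negbTE ij).
Qed.

Lemma adm_scalar0 i x : `|crd i x| = L -> q x = 0.
Proof. by move=> h; exact: (TS_face L0 a.2 _ h). Qed.

Lemma partial_cont i j : continuous (partial i (Phi j)).
Proof. by apply: Sm_continuous; exact: Sm_partial. Qed.

Lemma rot_cont i : continuous (rot Phi i).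
Proof. by apply: Sm_continuous; exact: rot_Sm. Qed.

Lemma grad_cont i : continuous (grad q i).
Proof. by apply: Sm_continuous; exact: Sm_partial. Qed.

Lemma divV_cont : continuous (divV Phi).
Proof.
apply: cont_add; first by apply: Sm_continuous; exact: div_Sm.
by apply: cont_opp; apply: cont_dot => // i; exact: Sm_continuous.
Qed.

Lemma gradsq_cont : continuous (gradsq Phi).
Proof. by apply: cont_sum3 => i; apply: cont_sum3 => j; apply: cont_sqr; exact: partial_cont. Qed.

(** The flux [q rot Phi] vanishes on the faces, and a rotation has divergence zero. This
    orthogonality decouples the two unknowns. *)
Lemma integ_rot_grad : I (dot (rot Phi) (grad q)) = 0.
Proof.
pose G i x := partial i q x * rot Phi i x + q x * partial i (rot Phi i) x.
have sr i : Sm (rot Phi i) := rot_Sm i sP.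
have -> : dot (rot Phi) (grad q) = fun x => \sum_(i < 3) G i x.
  apply/funext => x; rewrite /dot !sum3 /G /grad.
  suff : partial i0 (rot Phi i0) x + partial i1 (rot Phi i1) x + partial i2 (rot Phi i2) x = 0.
    set A := partial i0 (rot Phi i0) x; set B := partial i1 (rot Phi i1) x; set C := partial i2 (rot Phi i2) x.
    move=> h; have -> : C = - A - B by lra.
    by move: (partial i0 q x) (partial i1 q x) (partial i2 q x) => a0 a1 a2; ring.
  have dB i f g : Sm f -> Sm g -> partial i (f \- g) x = partial i f x - partial i g x.
    by move=> sf sg; rewrite (pd_partial (pdB (Sm_pdp i sf) (Sm_pdp i sg))).
  rewrite /Defs.rot /= !dB; try exact: Sm_partial.
  rewrite (TS_partialC i1 i0 (a.1 i2)) (TS_partialC i2 i0 (a.1 i1)) (TS_partialC i2 i1 (a.1 i0)).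
  by pring.
apply: (@integ_div_zero (fun i x => q x * rot Phi i x)).
- by move=> i; apply: pdM; [exact: Sm_pdp|exact: Sm_pdp].
- move=> i; apply: cont_add; apply: cont_mul; apply: Sm_continuous => //; exact: Sm_partial.
- by move=> i x h; rewrite (adm_scalar0 h) mul0r.
Qed.

Lemma integ_rho_divV : I (fun x => rho x * divV Phi x) = 0.
Proof.
have -> : (fun x => rho x * divV Phi x) = fun x => \sum_(i < 3) ((rho x * - V1 i x) * Phi i x + rho x * partial i (Phi i) x).
  apply/funext => x; rewrite /divV /Defs.div /dot !sum3.
  by pring.
apply: (@integ_div_zero (fun i x => rho x * Phi i x)).
- by move=> i; apply: pdM; [exact: pd_rho|exact: Sm_pdp].
- move=> i; have := Sm_continuous (sP i); have := @partial_cont i i; have := rho_cont => h1 h2 h3.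
  by apply: cont_add; apply: cont_mul => //; apply: cont_mul => //; exact: cont_opp.
- by move=> i x h; rewrite adm_normal0// mulr0.
Qed.

Lemma Bochner_le : I (fun x => rho x * gradsq Phi x) <=
  I (fun x => rho x * dot (rot Phi) (rot Phi) x) + I (fun x => rho x * divV Phi x ^+ 2).
Proof.
have bQ := box_bdm L; have mQ := bQ.1.
have cr := rho_cont; have cd := divV_cont.
have cP i : continuous (Phi i) := Sm_continuous (sP i).
have cD i j : continuous (partial j (Phi i)) := @partial_cont j i.
have cDD i j k : continuous (partial k (partial j (Phi i))) by apply: Sm_continuous; do 2 apply: Sm_partial.
(* The flux of the weighted Bochner identity: it vanishes on the faces because they are
   flat, and the convexity of [V] gives the zeroth-order term its sign. *)
pose F i x := rho x * (\sum_(j < 3) Phi j x * partial j (Phi i) x - Phi i x * divV Phi x).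
pose G i x := (rho x * - V1 i x) * (\sum_(j < 3) Phi j x * partial j (Phi i) x - Phi i x * divV Phi x) +
    rho x * (\sum_(j < 3) (partial i (Phi j) x * partial j (Phi i) x + Phi j x * partial i (partial j (Phi i)) x)
     - (partial i (Phi i) x * divV Phi x +
      Phi i x * (\sum_(j < 3) partial i (partial j (Phi j)) x -
         \sum_(j < 3) (V2 j i x * Phi j x + V1 j x * partial i (Phi j) x)))).
have pdv i : pd i (divV Phi) (fun x => \sum_(j < 3) partial i (partial j (Phi j)) x -
         \sum_(j < 3) (V2 j i x * Phi j x + V1 j x * partial i (Phi j) x)).
  apply: pdB; apply: pd_sum3 => j; first by apply: Sm_pdp; exact: Sm_partial.
  by apply: pdM => //; exact: Sm_pdp.
have pF i : pd i (F i) (G i).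
  apply: pdM; first exact: pd_rho.
  apply: pdB; last by apply: pdM => //; exact: Sm_pdp.
  by apply: pd_sum3 => j; apply: pdM; [exact: Sm_pdp|apply: Sm_pdp; exact: Sm_partial].
have cG i : continuous (G i).
  apply: cont_add; apply: cont_mul; [by apply: cont_mul => //; exact: cont_opp| |by []|].
    by apply: cont_add; [apply: cont_sum3 => j; exact: cont_mul|apply: cont_opp; exact: cont_mul].
  apply: cont_add.
    by apply: cont_sum3 => j; apply: cont_add; exact: cont_mul.
  apply: cont_opp; apply: cont_add; first exact: cont_mul.
  apply: cont_mul => //; apply: cont_add; first by apply: cont_sum3.
  by apply: cont_opp; apply: cont_sum3 => j; apply: cont_add; exact: cont_mul.
have F0 i x : `|crd i x| = L -> F i x = 0.
  move=> h; rewrite /F (adm_normal0 h) mul0r subr0 big1 ?mulr0// => j _.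
  have [->|ji] := eqVneq j i; first by rewrite adm_normal0// mul0r.
  by rewrite adm_tangential0// mulr0.
have G0 := integ_div_zero pF cG F0.
have iG : itg (box L) (fun x => \sum_(i < 3) G i x) by apply: bdm_itg => //; exact: cont_sum3.
have c1 : continuous (fun x => rho x * dot (rot Phi) (rot Phi) x).
  by apply: cont_mul => //; apply: cont_dot; exact: rot_cont.
have c2 : continuous (fun x => rho x * divV Phi x ^+ 2) by apply: cont_mul => //; exact: cont_sqr.
have j1 := bdm_itg bQ c1; have j2 := bdm_itg bQ c2.
rewrite -[leRHS]addr0 -{1}G0 -(integD mQ j1 j2) -(integD mQ (itgD mQ j1 j2) iG).
apply: le_integ => //.
- by apply: bdm_itg => //; apply: cont_mul => //; exact: gradsq_cont.
- by do 2 apply: itgD => //.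
move=> x _.
have := @Bochner_pointwise (fun i => Phi i x) (fun i j => partial j (Phi i) x)
  (fun i j k => partial k (partial j (Phi i)) x) (fun i => V1 i x) (fun i j => V2 i j x) (rho x).
have sD i j k : partial k (partial j (Phi i)) x = partial j (partial k (Phi i)) x.
  by rewrite (TS_partialC k j (a.1 i)).
move=> /(_ sD) /= E.
have -> : \sum_(i < 3) G i x = rho x * (gradsq Phi x + \sum_(i < 3) \sum_(j < 3) V2 i j x * Phi i x * Phi j x)
  - (rho x * dot (rot Phi) (rot Phi) x + rho x * divV Phi x ^+ 2).
  by rewrite rot_sq /gradsq /divV /dot /Defs.div -E; apply: eq_bigr.
exact: Bochner_arith (mulr_ge0 (ltW (rho_gt0 x)) (V2ge0 x (fun i => Phi i x))).
Qed.

End Admissible.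
End Bochner.

(** * Coercivity of the weighted system *)

Section WeightedSystem.
Variable R : realType.
Local Notation pt := (pt R).
Variable L : R.
Hypothesis L0 : 0 < L.
Local Notation I := (integ (box L)).
Local Notation adm := (adm L).
Implicit Types (Phi : vfield R) (q : pt -> R).

(* The first-order system of the Hodge--Witten Laplacian for the weight [r], the
   gradient of [- ln r] being [v1]. *)
Definition opU (r : pt -> R) Phi q : vfield R := fun i x => r x * rot Phi i x + grad q i x.
(** The free constant [c] compensates for the vanishing weighted mean of [div Phi - dot v1 Phi]. *)
Definition opG (v1 : vfield R) Phi (c : R) : pt -> R := fun x => div Phi x - dot v1 Phi x + c.

Lemma opU_cont r Phi q i : continuous r -> adm Phi q -> continuous (opU r Phi q i).
Proof.
move=> cr a; apply: cont_add; last exact: (grad_cont a).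
by apply: cont_mul => //; exact: (rot_cont a).
Qed.

Lemma opG_cont v1 Phi q c : (forall i, continuous (v1 i)) -> adm Phi q -> continuous (opG v1 Phi c).
Proof.
by move=> cv a; apply: cont_add; [exact: (divV_cont cv a)|exact: cont_cst].
Qed.

Lemma opU_comb r Phi q Psi p (a : R) i x : adm Phi q -> adm Psi p ->
  opU r (fun i x => Phi i x + a * Psi i x) (fun x => q x + a * p x) i x =
  opU r Phi q i x + a * opU r Psi p i x.
Proof.
move=> /adm_Sm[s1 s2] /adm_Sm[s1' s2'].
rewrite /opU rot_comb// grad_comb//.
move: (rot Phi i x) (rot Psi i x) (grad q i x) (grad p i x) => *; ring.
Qed.

Lemma opG_comb v1 Phi q Psi p c d (a : R) x : adm Phi q -> adm Psi p ->
  opG v1 (fun i x => Phi i x + a * Psi i x) (c + a * d) x =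
  opG v1 Phi c x + a * opG v1 Psi d x.
Proof.
move=> /adm_Sm[s1 s2] /adm_Sm[s1' s2'].
rewrite /opG div_comb// /dot !sum3.
move: (div Phi x) (div Psi x) => *; ring.
Qed.

Lemma vnrm2D_le D (u v : vfield R) : mbl3 D -> vL2 D u -> vL2 D v ->
  vnrm2 D (fun i x => u i x + v i x) <= 2 * vnrm2 D u + 2 * vnrm2 D v.
Proof.
move=> mD hu hv; have h1 := vL2_itg mD hu hu; have h2 := vL2_itg mD hv hv.
rewrite /vnrm2 -(integZ _ mD h1) -(integZ _ mD h2) -(integD mD (itgZ _ mD h1) (itgZ _ mD h2)).
have hs : vL2 D (fun i x => u i x + v i x) by move=> i; exact: L2D.
apply: le_integ => //; first exact: vL2_itg.
  by apply: itgD => //; exact: itgZ.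
move=> x _; rewrite /dot !sum3.
have := sqr_ge0 (u i0 x - v i0 x); have := sqr_ge0 (u i1 x - v i1 x); have := sqr_ge0 (u i2 x - v i2 x).
by nra.
Qed.

Lemma continuous_vL2 D (u : vfield R) : bdm D -> (forall i, continuous (u i)) -> vL2 D u.
Proof. by move=> bD cu i; exact: continuous_L2. Qed.

Lemma le_I (f g : pt -> R) : continuous f -> continuous g -> (forall x, box L x -> f x <= g x) -> I f <= I g.
Proof. by move=> cf cg h; have bQ := box_bdm L; apply: le_integ; [exact: bQ.1|exact: bdm_itg|exact: bdm_itg|]. Qed.

Lemma I_D (f g : pt -> R) : continuous f -> continuous g -> I (fun x => f x + g x) = I f + I g.
Proof. by move=> cf cg; have bQ := box_bdm L; apply: integD; [exact: bQ.1|exact: bdm_itg|exact: bdm_itg]. Qed.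

Lemma I_Z (a : R) (f : pt -> R) : continuous f -> I (fun x => a * f x) = a * I f.
Proof. by move=> cf; have bQ := box_bdm L; apply: integZ; [exact: bQ.1|exact: bdm_itg]. Qed.

(** The flux [x_i Phi_i^2] vanishes on the faces, so [int Phi_i^2 = - 2 int x_i Phi_i partial_i
    Phi_i]. By Young's inequality the right side is at most [1/2 int Phi_i^2 + 2 L^2 int (partial_i
    Phi_i)^2]. *)
Lemma vnrm2_le_gradsq Phi q : adm Phi q -> vnrm2 (box L) Phi <= 4 * L ^+ 2 * I (gradsq Phi).
Proof.
move=> a; have [sP _] := adm_Sm a.
have cP i : continuous (Phi i) := Sm_continuous (sP i).
have cD i j : continuous (partial j (Phi i))  by exact: (partial_cont a).
have key i : I (fun x => Phi i x ^+ 2) <= 4 * L ^+ 2 * I (fun x => partial i (Phi i) x ^+ 2).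
  have pG := pdM (@pd_coord R i i) (pdM (Sm_pdp i (sP i)) (Sm_pdp i (sP i))).
  have cx : continuous (@crd R i) := @crd_continuous R i.
  have c1 : continuous (fun x => Phi i x ^+ 2) by exact: cont_sqr.
  have c2 : continuous (fun x => partial i (Phi i) x ^+ 2) by exact: cont_sqr.
  have := integ_pd0 L0 pG.
  rewrite eqxx => h.
  have {}h : I (fun x => 1 * (Phi i x * Phi i x) + crd i x * (partial i (Phi i) x * Phi i x + Phi i x * partial i (Phi i) x)) = 0.
    apply: h.
      by cont.
    by move=> x xL; rewrite (adm_normal0 L0 a xL) !mulr0.
  have le1 : I (fun x => 2^-1 * Phi i x ^+ 2) <= I (fun x => (1 * (Phi i x * Phi i x) + crd i x * (partial i (Phi i) x * Phi i x + Phi i x * partial i (Phi i) x)) + 2 * L ^+ 2 * partial i (Phi i) x ^+ 2).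
    apply: le_I.
    - by apply: cont_mul => //; exact: cont_cst.
    - by cont.
    move=> x bx; have /andP[b1 b2] := bx i.
    have x2 : crd i x ^+ 2 <= L ^+ 2 by nra.
    move: (Phi i x) (partial i (Phi i) x) (crd i x) x2 => p d t x2.
    have h1 : 0 <= (p + 2 * t * d) ^+ 2 by exact: sqr_ge0.
    have h2 : 0 <= (L ^+ 2 - t ^+ 2) * d ^+ 2 by rewrite mulr_ge0 ?sqr_ge0// subr_ge0.
    by nra.
  rewrite I_D ?h ?add0r in le1; first last.
  - by apply: cont_mul => //; exact: cont_cst.
  - by cont.
  rewrite !I_Z// in le1; lra.
have c2 i : continuous (fun x => partial i (Phi i) x ^+ 2) by exact: cont_sqr.
have bQ := box_bdm L.
rewrite /vnrm2 /dot integ_sum3; [|exact: bQ.1|by move=> i; apply: bdm_itg => //; exact: cont_mul].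
apply: (@le_trans _ _ (\sum_(i < 3) 4 * L ^+ 2 * I (fun x => partial i (Phi i) x ^+ 2))).
  by apply: ler_sum => i _; apply: le_trans (key i); rewrite le_eqVlt; apply/orP; left; apply/eqP; apply: eq_integ => x _; rewrite expr2.
rewrite -mulr_sumr; apply: ler_wpM2l; first by rewrite mulr_ge0 ?sqr_ge0.
rewrite -integ_sum3; [|exact: bQ.1|by move=> i; exact: bdm_itg].
apply: le_I; [exact: cont_sum3|exact: (gradsq_cont a)|].
move=> x _; apply: ler_sum => i _; rewrite [leRHS](bigD1 i)//= lerDl.
by apply: sumr_ge0 => j _; exact: sqr_ge0.
Qed.

Section Estimates.
Variables (V : pt -> R) (V1 : vfield R) (V2 : 'I_3 -> 'I_3 -> pt -> R) (B : R).
Hypothesis cV : continuous V.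
Hypothesis cV1 : forall i, continuous (V1 i).
Hypothesis cV2 : forall i j, continuous (V2 i j).
Hypothesis pV : forall i, pd i V (V1 i).
Hypothesis pV1 : forall i j, pd j (V1 i) (V2 i j).
Hypothesis V2ge0 : forall x (xi : 'I_3 -> R), 0 <= \sum_(i < 3) \sum_(j < 3) V2 i j x * xi i * xi j.
Hypothesis V01 : forall x, box L x -> 0 <= V x <= B.

Variables (Phi : vfield R) (q : pt -> R) (c : R).
Hypothesis a : adm Phi q.

Let cr := rho_cont cV.
Let cdv := divV_cont cV1 a.

(** Expand [rho^-1 |rho rot Phi + grad q|^2]: the mixed term integrates to 0 by [integ_rot_grad],
    and [rho^-1 <= expR B]. *)
Lemma integ_rho_rot_le : I (fun x => rho V x * dot (rot Phi) (rot Phi) x) <= expR B * vnrm2 (box L) (opU (rho V) Phi q).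
Proof.
have crot := rot_cont a; have cg := grad_cont a.
have cE i := @opU_cont _ Phi q i cr a.
have cdr := cont_dot crot crot; have cdg := cont_dot crot cg.
rewrite /vnrm2 -I_Z; last exact: cont_dot.
rewrite -[leLHS]addr0 -(mulr0 2) -{1}(integ_rot_grad L0 a) -I_Z// -I_D//; first last.
- by apply: cont_mul => //; exact: cont_cst.
- exact: cont_mul.
apply: le_I.
- by apply: cont_add; [exact: cont_mul|apply: cont_mul => //; exact: cont_cst].
- by apply: cont_mul; [exact: cont_cst|exact: cont_dot].
move=> x bx; have r0 := rho_gt0 V x.
apply: (@le_trans _ _ ((rho V x)^-1 * dot (opU (rho V) Phi q) (opU (rho V) Phi q) x)).
  rewrite -(ler_pM2l r0) mulrA divff ?mul1r; last exact: lt0r_neq0.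
  rewrite /dot /opU !sum3.
  have := sqr_ge0 (grad q i0 x); have := sqr_ge0 (grad q i1 x); have := sqr_ge0 (grad q i2 x).
  move: (grad q i0 x) (grad q i1 x) (grad q i2 x) (rot Phi i0 x) (rot Phi i1 x) (rot Phi i2 x) (rho V x).
  by move=> *; nra.
apply: ler_wpM2r; first exact: dot_ge0.
by rewrite /rho expRN invrK ler_expR; have /andP[] := V01 bx.
Qed.

(** The mixed term [2 c rho divV Phi] integrates to 0, which makes the estimate independent of
    [c]. *)
Lemma integ_rho_divV_le : I (fun x => rho V x * divV V1 Phi x ^+ 2) <= nrm2 (box L) (opG V1 Phi c).
Proof.
have cG := @opG_cont V1 Phi q c cV1 a.
have cd2 : continuous (fun x => divV V1 Phi x ^+ 2) by exact: cont_sqr.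
have crd2 : continuous (fun x => rho V x * divV V1 Phi x) by exact: cont_mul.
rewrite -[leLHS]addr0 -(mulr0 (2 * c)) -{1}(integ_rho_divV L0 cV cV1 pV a) -I_Z// -I_D//; first last.
- by apply: cont_mul => //; exact: cont_cst.
- exact: cont_mul.
apply: le_I.
- by apply: cont_add; [exact: cont_mul|apply: cont_mul => //; exact: cont_cst].
- exact: cont_sqr.
move=> x bx; have r0 := rho_gt0 V x.
have r1 : rho V x <= 1 by rewrite /rho -expR0 ler_expR oppr_le0; have /andP[] := V01 bx.
apply: (@le_trans _ _ (rho V x * opG V1 Phi c x ^+ 2)).
  rewrite (_ : opG V1 Phi c x = divV V1 Phi x + c)//.
  have := mulr_ge0 (ltW r0) (sqr_ge0 c).
  by move: (divV V1 Phi x) (rho V x) => d r; nra.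
by rewrite -[leRHS]mul1r; apply: ler_wpM2r => //; exact: sqr_ge0.
Qed.

Lemma rho_ge x : box L x -> expR (- B) <= rho V x.
Proof. by move=> bx; rewrite /rho ler_expR lerN2; have /andP[] := V01 bx. Qed.

Lemma integ_le_rho (f : pt -> R) : continuous f -> (forall x, 0 <= f x) -> I f <= expR B * I (fun x => rho V x * f x).
Proof.
move=> cf f0; rewrite -I_Z; last exact: cont_mul.
apply: le_I => //; first by apply: cont_mul; [exact: cont_cst|exact: cont_mul].
move=> x bx; rewrite mulrA -[leLHS]mul1r; apply: ler_wpM2r => //.
by have := rho_ge bx; rewrite expRN -ler_pdivrMl ?expR_gt0// mulr1.
Qed.

(** One factor [expR B] comes from [integ_rho_rot_le], the other from removing the weight on the
    left. As the constant depends on [V] through [B] only, it serves for all weights [t V] with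
    [0 <= t <= 1]. *)
Lemma coercive : vnrm2 (box L) (rot Phi) + vnrm2 (box L) Phi <=
  expR B * (1 + 4 * L ^+ 2) * expR B * (vnrm2 (box L) (opU (rho V) Phi q) + nrm2 (box L) (opG V1 Phi c)).
Proof.
have h1 := integ_rho_rot_le; have h2 := integ_rho_divV_le.
have hB := Bochner_le L0 cV cV1 cV2 pV pV1 V2ge0 a.
have h3 := vnrm2_le_gradsq a.
have h4 := integ_le_rho (gradsq_cont a) (fun x => sumr_ge0 _ (fun i _ => sumr_ge0 _ (fun j _ => sqr_ge0 _))).
have crot := rot_cont a.
have h5 := integ_le_rho (cont_dot crot crot) (dot_ge0 _).
set S := vnrm2 (box L) (opU (rho V) Phi q) + nrm2 (box L) (opG V1 Phi c).
have B0 : 0 <= B.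
  have : box L 0 by move=> i; elim/ord3P: i; rewrite /crd /= oppr_lt0 L0.
  by move/V01 => /andP[]; exact: le_trans.
have eB : 1 <= expR B by rewrite -expR0 ler_expR.
have g0 : 0 <= nrm2 (box L) (opG V1 Phi c) := nrm2_ge0 _ _.
have u0 : 0 <= vnrm2 (box L) (opU (rho V) Phi q) := vnrm2_ge0 _ _.
have T1 : I (fun x => rho V x * dot (rot Phi) (rot Phi) x) <= expR B * S.
  by apply: le_trans h1 _; rewrite ler_pM2l ?expR_gt0// /S lerDl.
have T2 : I (fun x => rho V x * gradsq Phi x) <= expR B * S.
  apply: le_trans hB _; rewrite /S mulrDr; apply: lerD => //.
  by apply: le_trans h2 _; rewrite ler_peMl.
have eB0 : 0 <= expR B := ltW (expR_gt0 _).
have T3 : vnrm2 (box L) (rot Phi) <= expR B * (expR B * S).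
  by apply: le_trans h5 _; exact: ler_wpM2l.
have T4 : vnrm2 (box L) Phi <= 4 * L ^+ 2 * (expR B * (expR B * S)).
  apply: le_trans h3 _; apply: ler_wpM2l; first by rewrite mulr_ge0 ?sqr_ge0.
  by apply: le_trans h4 _; exact: ler_wpM2l.
by move: T3 T4; rewrite (_ : expR B * (1 + 4 * L ^+ 2) * expR B * S = expR B * (expR B * S) + 4 * L ^+ 2 * (expR B * (expR B * S))); [lra|ring].
Qed.
End Estimates.
End WeightedSystem.

(** * The continuity method in the weight *)

Section ContinuityMethod.
Variable R : realType.
Local Notation pt := (pt R).
Variable L : R.
Hypothesis L0 : 0 < L.
Local Notation adm := (adm L).
Implicit Types (Phi M : vfield R) (q g : pt -> R).

Definition tot M g : R := vnrm2 (box L) M + nrm2 (box L) g.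

Lemma tot_ge0 M g : 0 <= tot M g.
Proof. by rewrite addr_ge0 ?vnrm2_ge0 ?nrm2_ge0. Qed.

Lemma totD_le M g M' g' : (forall i, continuous (M i)) -> continuous g ->
  (forall i, continuous (M' i)) -> continuous g' ->
  tot (fun i x => M i x + M' i x) (fun x => g x + g' x) <= 2 * tot M g + 2 * tot M' g'.
Proof.
move=> cM cg cM' cg'; have bQ := box_bdm L.
have h1 := vnrm2D_le bQ.1 (continuous_vL2 bQ cM) (continuous_vL2 bQ cM').
have h2 := nrm2D_le bQ.1 (continuous_L2 bQ cg) (continuous_L2 bQ cg').
by rewrite /tot; apply: le_trans (lerD h1 h2) _; rewrite !mulrDr; lra.
Qed.

Lemma eq_tot M g M' g' : (forall i x, M i x = M' i x) -> g =1 g' -> tot M g = tot M' g'.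
Proof.
move=> h1 h2; congr (_ + _); apply: eq_integ => x _; last by rewrite h2.
by apply: eq_bigr => i _; rewrite h1.
Qed.

(** Density instead of surjectivity keeps all approximate solutions among the trigonometric sums,
    where derivatives and boundary values are explicit. *)
Definition dense_range (r : pt -> R) (v1 : vfield R) := forall M g (e : R),
  (forall i, continuous (M i)) -> continuous g -> 0 < e ->
  exists Phi q c, adm Phi q /\
    tot (fun i x => opU r Phi q i x - M i x) (fun x => opG v1 Phi c x - g x) < e.

Lemma dense_range_flat : dense_range (fun=> 1) (fun _ _ => 0).
Proof.
move=> M g e cM cg e0; have bQ := box_bdm L; have e4 : 0 < e / 4 by rewrite divr_gt0.
have /choice[t ht] : forall i, exists t, TS L (bcov i) t /\ nrm2 (box L) (fun x => M i x - t x) < e / 4.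
  by move=> i; have [t h1 h2] := TS_dense L0 (bcov i) (cM i) e4; exists t.
have [s ts hs] := TS_dense L0 bnone cg e4.
have ct i : continuous (t i) := Sm_continuous (TS_Sm (ht i).1).
have cs : continuous s := Sm_continuous (TS_Sm ts).
have [Phi [q [c [a h1 h2]]]] := flat_solvable_TS L0 (fun i => (ht i).1) ts.
exists Phi, q, c; split=> //.
rewrite (@eq_tot _ _ (fun i x => t i x - M i x) (fun x => s x - g x)); first last.
- by move=> x; rewrite /opG /dot sum3 !mul0r !addr0 subr0 h2.
- by move=> i x; rewrite /opU mul1r h1.
rewrite /tot; have sw (f f' : pt -> R) : nrm2 (box L) (fun x => f x - f' x) = nrm2 (box L) (fun x => f' x - f x).
  by apply: eq_integ => x _; rewrite -sqrrN opprB.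
have -> : vnrm2 (box L) (fun i x => t i x - M i x) = \sum_(i < 3) nrm2 (box L) (fun x => t i x - M i x).
  rewrite /vnrm2 /dot integ_sum3; [by []|exact: bQ.1|move=> i].
  apply: bdm_itg => //; have := ct i; have := cM i => k1 k2; apply: cont_mul; apply: cont_add => //; exact: cont_opp.
rewrite sum3 (sw s) (sw (t i0)) (sw (t i1)) (sw (t i2)).
by have := (ht i0).2; have := (ht i1).2; have := (ht i2).2; move: hs; lra.
Qed.

(** The terms [grad q], [div Phi] and [c] cancel in the difference of the two operators; what
    remains is the quantity that [coercive] controls. *)
Lemma perturbation_le (r r' : pt -> R) (v v' : vfield R) Phi q c (h : R) :
  continuous r -> continuous r' -> (forall i, continuous (v i)) -> (forall i, continuous (v' i)) ->
  (forall x, box L x -> (r' x - r x) ^+ 2 <= h) ->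
  (forall x, box L x -> \sum_(i < 3) (v' i x - v i x) ^+ 2 <= h) -> adm Phi q ->
  tot (fun i x => opU r' Phi q i x - opU r Phi q i x) (fun x => opG v' Phi c x - opG v Phi c x) <=
  h * (vnrm2 (box L) (rot Phi) + vnrm2 (box L) Phi).
Proof.
move=> cr cr' cv cv' hr hv a; have [sP _] := adm_Sm a.
have cP i : continuous (Phi i) := Sm_continuous (sP i).
have crot := rot_cont a.
rewrite mulrDr /tot; apply: lerD.
  rewrite /vnrm2 -(I_Z L); last exact: cont_dot.
  have -> : dot (fun i x => opU r' Phi q i x - opU r Phi q i x) (fun i x => opU r' Phi q i x - opU r Phi q i x) =
    fun x => (r' x - r x) ^+ 2 * dot (rot Phi) (rot Phi) x.
    apply/funext => x; rewrite /dot /opU !sum3.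
    move: (rot Phi i0 x) (rot Phi i1 x) (rot Phi i2 x) (grad q i0 x) (grad q i1 x) (grad q i2 x) => *; ring.
  apply: le_I; [|by apply: cont_mul; [exact: cont_cst|exact: cont_dot]|].
    apply: cont_mul; [apply: cont_sqr; apply: cont_add => //; exact: cont_opp|exact: cont_dot].
  by move=> x bx; apply: ler_wpM2r; [exact: dot_ge0|exact: hr].
rewrite /vnrm2 -(I_Z L); last exact: cont_dot.
have cd i : continuous (fun x => v' i x - v i x).
  by have := cv i; have := cv' i => k1 k2; apply: cont_add => //; exact: cont_opp.
have -> : nrm2 (box L) (fun x => opG v' Phi c x - opG v Phi c x) =
  integ (box L) (fun x => dot (fun i x => v' i x - v i x) Phi x ^+ 2).
  apply: eq_integ => x _; rewrite /opG /dot !sum3.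
  by move: (div Phi x) => *; ring.
apply: le_I; [by apply: cont_sqr; exact: cont_dot|by apply: cont_mul; [exact: cont_cst|exact: cont_dot]|].
move=> x bx; apply: (@le_trans _ _ (\sum_(i < 3) (v' i x - v i x) ^+ 2 * dot Phi Phi x)).
  rewrite -mulr_suml /dot !sum3.
  move: (v' i0 x - v i0 x) (v' i1 x - v i1 x) (v' i2 x - v i2 x) (Phi i0 x) (Phi i1 x) (Phi i2 x) => a0 a1 a2 b0 b1 b2.
  have := sqr_ge0 (a0 * b1 - a1 * b0); have := sqr_ge0 (a0 * b2 - a2 * b0); have := sqr_ge0 (a1 * b2 - a2 * b1).
  by nra.
by rewrite -mulr_suml; apply: ler_wpM2r; [exact: dot_ge0|exact: hv].
Qed.

(** In squared norms: [T] is the size of the data, [t] the residual for the old operator, [u] the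
    size of its image, [d] the perturbation and [w] the residual for the new operator. *)
Lemma half_arith (T t d u w : R) : 0 <= T -> t <= T / 16 -> u <= 2 * t + 2 * T -> d <= u / 16 ->
  w <= 2 * d + 2 * t -> w <= T / 2.
Proof. lra. Qed.

(** An approximate solution for the old operator reduces the squared residual for the new one to at
    most half. Solving again with the residual as data, and adding up, makes it as small as
    desired. *)
Lemma dense_range_step (r r' : pt -> R) (v v' : vfield R) (K h : R) :
  continuous r -> continuous r' -> (forall i, continuous (v i)) -> (forall i, continuous (v' i)) ->
  (forall x, box L x -> (r' x - r x) ^+ 2 <= h) ->
  (forall x, box L x -> \sum_(i < 3) (v' i x - v i x) ^+ 2 <= h) ->
  0 <= h -> h * K <= 16^-1 ->
  (forall Phi q c, adm Phi q -> vnrm2 (box L) (rot Phi) + vnrm2 (box L) Phi <= K * tot (opU r Phi q) (opG v Phi c)) ->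
  dense_range r v -> dense_range r' v'.
Proof.
move=> cr cr' cv cv' hr hv h0 hK coer dr.
have half M g : (forall i, continuous (M i)) -> continuous g -> 0 < tot M g ->
    exists Phi q c, adm Phi q /\
    tot (fun i x => opU r' Phi q i x - M i x) (fun x => opG v' Phi c x - g x) <= tot M g / 2.
  move=> cM cg T0; have [Phi [q [c [a hX]]]] := dr M g (tot M g / 16) cM cg (divr_gt0 T0 (ltr0Sn _ _)).
  exists Phi, q, c; split=> //.
  have cU i := @opU_cont _ L r Phi q i cr a; have cG := @opG_cont _ L v Phi q c cv a.
  have cU' i := @opU_cont _ L r' Phi q i cr' a; have cG' := @opG_cont _ L v' Phi q c cv' a.
  have cUM i : continuous (fun x => opU r Phi q i x - M i x) by apply: cont_add => //; exact: cont_opp.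
  have cGg : continuous (fun x => opG v Phi c x - g x) by apply: cont_add => //; exact: cont_opp.
  have cUU i : continuous (fun x => opU r' Phi q i x - opU r Phi q i x) by apply: cont_add => //; exact: cont_opp.
  have cGG : continuous (fun x => opG v' Phi c x - opG v Phi c x) by apply: cont_add => //; exact: cont_opp.
  have t1 := totD_le cUM cGg cM cg.
  rewrite (@eq_tot _ _ (opU r Phi q) (opG v Phi c)) in t1; first last.
  - by move=> x; rewrite subrK.
  - by move=> i x; rewrite subrK.
  have t2 := totD_le cUU cGG cUM cGg.
  rewrite (@eq_tot _ _ (fun i x => opU r' Phi q i x - M i x) (fun x => opG v' Phi c x - g x)) in t2; first last.
  - by move=> x; rewrite addrA subrK.
  - by move=> i x; rewrite addrA subrK.
  apply: (half_arith (ltW T0) (ltW hX) t1 _ t2).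
  apply: le_trans (perturbation_le c cr cr' cv cv' hr hv a) _.
  apply: le_trans (ler_wpM2l h0 (coer Phi q c a)) _.
  by rewrite mulrA mulrC; apply: ler_wpM2l; [exact: tot_ge0|].
move=> M g e cM cg e0.
have iter n : exists Phi q c, adm Phi q /\
    tot (fun i x => opU r' Phi q i x - M i x) (fun x => opG v' Phi c x - g x) <= tot M g / 2 ^+ n.
  elim: n => [|n [Phi [q [c [a hX]]]]].
    exists (fun _ _ => 0), (fun=> 0), 0; split; first exact: adm0.
    rewrite expr0 divr1 le_eqVlt; apply/orP; left; apply/eqP.
    have z i x : opU r' (fun _ _ => 0) (fun=> 0) i x = 0.
      rewrite /opU /grad partial_cst0 addr0; elim/ord3P: i; by rewrite !rotE !partial_cst0 subrr mulr0.
    have w x : opG v' (fun _ _ => 0) 0 x = 0.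
      by rewrite /opG /Defs.div /dot !sum3 !partial_cst0 !mulr0 !addr0 subr0.
    congr (_ + _); apply: eq_integ => x _; last by rewrite w sub0r sqrrN.
    by apply: eq_bigr => i _; rewrite z sub0r mulrNN.
  have cU' i := @opU_cont _ L r' Phi q i cr' a; have cG' := @opG_cont _ L v' Phi q c cv' a.
  pose M' : vfield R := fun i x => M i x - opU r' Phi q i x; pose g' x := g x - opG v' Phi c x.
  have cM' i : continuous (M' i) by have := cM i => k; apply: cont_add => //; exact: cont_opp.
  have cg' : continuous g' by apply: cont_add => //; exact: cont_opp.
  have E : tot M' g' = tot (fun i x => opU r' Phi q i x - M i x) (fun x => opG v' Phi c x - g x).
    congr (_ + _); apply: eq_integ => x _; last by rewrite /g' -sqrrN opprB.
    by apply: eq_bigr => i _; rewrite /M' -mulrNN opprB.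
  have [T0|T0] := leP (tot M' g') 0.
    exists Phi, q, c; split=> //; rewrite -E; apply: le_trans T0 _.
    by rewrite divr_ge0 ?tot_ge0 ?exprn_ge0.
  have [Psi [p [d [b hY]]]] := half _ _ cM' cg' T0.
  exists (fun i x => Phi i x + 1 * Psi i x), (fun x => q x + 1 * p x), (c + 1 * d); split.
    exact: adm_comb.
  rewrite (@eq_tot _ _ (fun i x => opU r' Psi p i x - M' i x) (fun x => opG v' Psi d x - g' x)); first last.
  - move=> x; rewrite (opG_comb v' c d 1 x a b) /g'.
    by move: (opG v' Phi c x) (opG v' Psi d x) => *; ring.
  - move=> i x; rewrite (opU_comb r' 1 i x a b) /M'.
    by move: (opU r' Phi q i x) (opU r' Psi p i x) => *; ring.
  apply: le_trans hY _; rewrite E exprSr invfM mulrA ler_wpM2r//.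
have [n hn] : exists n, tot M g / 2 ^+ n < e.
  exists (Num.bound (tot M g / e)).
  rewrite ltr_pdivrMr ?exprn_gt0//.
  have := archi_boundP (divr_ge0 (tot_ge0 M g) (ltW e0)); rewrite ltr_pdivrMr// => h1.
  apply: lt_le_trans h1 _; rewrite mulrC ler_pM2l// -natrX ler_nat.
  exact: ltnW (ltn_expl _ _).
have [Phi [q [c [a hX]]]] := iter n.
by exists Phi, q, c; split=> //; exact: le_lt_trans hX hn.
Qed.

Variables (V : pt -> R) (V1 : vfield R) (V2 : 'I_3 -> 'I_3 -> pt -> R) (B : R).
Hypothesis cV : continuous V.
Hypothesis cV1 : forall i, continuous (V1 i).
Hypothesis cV2 : forall i j, continuous (V2 i j).
Hypothesis pV : forall i, pd i V (V1 i).
Hypothesis pV1 : forall i j, pd j (V1 i) (V2 i j).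
Hypothesis V2ge0 : forall x (xi : 'I_3 -> R), 0 <= \sum_(i < 3) \sum_(j < 3) V2 i j x * xi i * xi j.
Hypothesis V01 : forall x, box L x -> 0 <= V x <= B.

Lemma expRN_lip (s t : R) : 0 <= s -> 0 <= t -> `|expR (- s) - expR (- t)| <= `|s - t|.
Proof.
wlog st : s t / s <= t.
  move=> H s0 t0; have [h|h] := leP s t; first exact: H.
  by rewrite distrC [leRHS]distrC; apply: H => //; exact: ltW.
move=> s0 t0; rewrite ger0_norm ?subr_ge0 ?ler_expR ?lerN2// distrC ger0_norm ?subr_ge0//.
have -> : expR (- t) = expR (- s) * expR (s - t) by rewrite -expRD; congr expR; ring.
have h1 := expR_ge1Dx (s - t); have h2 : expR (- s) <= 1 by rewrite -expR0 ler_expR oppr_le0.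
have h3 := expR_gt0 (- s).
have h4 : 0 <= expR (- s) * (expR (s - t) - (1 + (s - t))) by rewrite mulr_ge0 ?(ltW h3)// subr_ge0.
have h5 : 0 <= (1 - expR (- s)) * (t - s) by rewrite mulr_ge0 ?subr_ge0.
by move: h4 h5; move: (expR (- s)) (expR (s - t)) => p q; nra.
Qed.

Theorem weighted_dense_range : dense_range (rho V) V1.
Proof.
have bx0 : box L 0 by move=> i; elim/ord3P: i; rewrite /crd /= oppr_lt0 L0.
have B0 : 0 <= B by have /andP[] := V01 bx0; exact: le_trans.
have cdd := cont_dot cV1 cV1; have [B1 B10 hB1] := continuous_bounded_cbox L cdd.
set K := expR B * (1 + 4 * L ^+ 2) * expR B.
have K0 : 0 < K.
  have L4 : 0 < 1 + 4 * L ^+ 2 by rewrite ltr_pwDl// mulr_ge0 ?sqr_ge0.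
  by rewrite /K !mulr_gt0 ?expR_gt0.
(* Consecutive parameters differ by [1/n]. The weights then differ by at most [B / n], and the
   squared length of the difference of the drifts is at most [B1 / n^2], so [H / n^2] bounds both
   squares. *)
pose H := B ^+ 2 + B1; have H0 : 0 <= H by rewrite addr_ge0 ?sqr_ge0.
have [n n0 hn] : exists2 n, (0 < n)%N & H / n%:R ^+ 2 * K <= 16^-1.
  exists (Num.bound (16 * (H * K))).+1 => //.
  have h : 16 * (H * K) < (Num.bound (16 * (H * K)))%:R.
    by apply: archi_boundP; rewrite mulr_ge0// mulr_ge0// ltW.
  set m := Num.bound _ in h *; have m1 : 1 <= m.+1%:R :> R by rewrite ler1n.
  have m2 : 16 * (H * K) <= m.+1%:R ^+ 2.
    have h' : m%:R < m.+1%:R :> R by rewrite ltr_nat.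
    by have hh := lt_trans h h'; apply: (le_trans (ltW hh)); rewrite expr2 ler_peMl// (le_trans _ m1).
  rewrite mulrAC ler_pdivrMr ?exprn_gt0 ?ltr0Sn//; move: m2; lra.
pose Vt (t : R) x := t * V x; pose V1t (t : R) : vfield R := fun i x => t * V1 i x.
have cVt t : continuous (Vt t) by apply: cont_mul => //; exact: cont_cst.
have cV1t t i : continuous (V1t t i) by apply: cont_mul => //; exact: cont_cst.
have main k : (k <= n)%N -> dense_range (rho (Vt (k%:R / n%:R))) (V1t (k%:R / n%:R)).
  elim: k => [|k IH] kn.
    have -> : rho (Vt (0%:R / n%:R)) = fun=> 1 by apply/funext => x; rewrite /rho /Vt !mul0r oppr0 expR0.
    have -> : V1t (0%:R / n%:R) = fun _ _ => 0 by apply/funext => i; apply/funext => x; rewrite /V1t !mul0r.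
    exact: dense_range_flat.
  have nn0 : n%:R != 0 :> R by rewrite pnatr_eq0 -lt0n.
  set t := k%:R / n%:R in IH *; set t' := k.+1%:R / n%:R.
  have tt : t' - t = n%:R^-1 by rewrite /t /t' -natr1; field.
  have t0 : 0 <= t by rewrite divr_ge0.
  have t'0 : 0 <= t' by rewrite divr_ge0.
  have t1 : t <= 1 by rewrite ler_pdivrMr ?ltr0n// mul1r ler_nat ltnW.
  have inv0 : 0 <= n%:R^-1 :> R by rewrite invr_ge0.
  apply: (dense_range_step _ _ _ _ _ _ _ hn _ (IH (ltnW kn))).
  - exact: (rho_cont (cVt t)).
  - exact: (rho_cont (cVt t')).
  - exact: cV1t.
  - exact: cV1t.
  - move=> x bx; have /andP[v0 vB] := V01 bx.
    have h1 : `|rho (Vt t') x - rho (Vt t) x| <= n%:R^-1 * V x.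
      by apply: le_trans (expRN_lip _ _) _; rewrite /Vt ?mulr_ge0// -mulrBl tt ger0_norm// mulr_ge0.
    apply: (@le_trans _ _ ((n%:R^-1 * B) ^+ 2)).
      rewrite -real_normK ?num_real// !expr2; apply: ler_pM => //; apply: le_trans h1 _; exact: ler_wpM2l.
    by rewrite exprMn mulrC exprVn; apply: ler_wpM2r; rewrite ?invr_ge0 ?exprn_ge0// lerDl.
  - move=> x bx; rewrite /V1t.
    have -> : \sum_(i < 3) (t' * V1 i x - t * V1 i x) ^+ 2 = dot V1 V1 x * n%:R ^- 2.
      rewrite mulr_suml; apply: eq_bigr => i _; rewrite -mulrBl tt exprMn exprVn expr2; ring.
    apply: ler_wpM2r; first by rewrite invr_ge0 exprn_ge0.
    apply: le_trans (ler_norm _) _; apply: le_trans (hB1 _ (box_cbox bx)) _.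
    by rewrite lerDr sqr_ge0.
  - by rewrite divr_ge0// exprn_ge0.
  - move=> Phi q c a; apply: (coercive L0 (cVt t) (cV1t t) (V2 := fun i j x => t * V2 i j x)) => //.
    + by move=> i j; apply: cont_mul => //; exact: cont_cst.
    + by move=> i; exact: pdZ.
    + by move=> i j; exact: pdZ.
    + move=> x xi; rewrite (_ : \sum_(i < 3) _ = t * \sum_(i < 3) \sum_(j < 3) V2 i j x * xi i * xi j); first exact: mulr_ge0.
      by rewrite mulr_sumr; apply: eq_bigr => i _; rewrite mulr_sumr; apply: eq_bigr => j _; rewrite !mulrA.
    + move=> x /V01 /andP[v0 vB]; rewrite /Vt mulr_ge0//=.
      by apply: le_trans vB; rewrite ler_piMl.
have := main n (leqnn n); rewrite divff; last by rewrite pnatr_eq0 -lt0n.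
have -> : rho (Vt 1) = rho V by apply/funext => x; rewrite /rho /Vt mul1r.
by have -> : V1t 1 = V1 by apply/funext => i; apply/funext => x; rewrite /V1t mul1r.
Qed.
End ContinuityMethod.

(** * Dilations and test functions *)

Section ChangeOfVariables.
Variable R : realType.
Local Notation mR := (measurableTypeR R).
Local Notation mpt := ((mR * mR) * mR)%type.
Local Notation pt := (pt R).
Variables (l : R) (b : pt).
Hypothesis l0 : 0 < l.

Definition dil1 (c : R) (t : mR) : mR := l * t + c.
Definition dil2 (x : mR * mR) : mR * mR := (dil1 b.1.1 x.1, dil1 b.1.2 x.2).
Definition dil3 (x : mpt) : mpt := (dil2 x.1, dil1 b.2 x.2).

Lemma dil1_measurable c : measurable_fun setT (dil1 c).
Proof. by apply: measurable_funD => //; exact: mulrl_measurable. Qed.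

Lemma dil2_measurable : measurable_fun setT dil2.
Proof.
by apply: measurable_fun_pair; (apply: measurableT_comp; first exact: dil1_measurable);
  [exact: measurable_fst|exact: measurable_snd].
Qed.

Lemma dil3_measurable : measurable_fun setT dil3.
Proof.
apply: measurable_fun_pair.
  by apply: measurableT_comp; [exact: dil2_measurable|exact: measurable_fst].
by apply: measurableT_comp; [exact: dil1_measurable|exact: measurable_snd].
Qed.

HB.instance Definition _ c := isMeasurableFun.Build _ _ _ _ (dil1 c) (dil1_measurable c).
HB.instance Definition _ := isMeasurableFun.Build _ _ _ _ dil2 dil2_measurable.
HB.instance Definition _ := isMeasurableFun.Build _ _ _ _ dil3 dil3_measurable.

Let l1 : {nonneg R} := NngNum (ltW l0).
Let l2 : {nonneg R} := NngNum (exprn_ge0 2 (ltW l0)).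
Let l3 : {nonneg R} := NngNum (exprn_ge0 3 (ltW l0)).

(** The pushforward scaled by [l] agrees with Lebesgue measure on half-open intervals, and these
    determine the measure. *)
Lemma mu1_dil c (A : set mR) : measurable A -> mu1 R A = (l%:E * mu1 R (dil1 c @^-1` A))%E.
Proof.
move=> mA.
have := @lebesgue_measure_unique R (mscale l1 (pushforward (mu1 R) (dil1 c))) _ A mA.
apply => _ [[p q] _ <-].
transitivity (l%:E * mu1 R (dil1 c @^-1` [set` `]p, q]%R]))%E; last by [].
rewrite (_ : _ @^-1` _ = [set` `](p - c) / l, (q - c) / l]%R]); last first.
  apply/seteqP; split => t; rewrite /dil1 /= !in_itv /= ltr_pdivrMr// ler_pdivlMr// [t * l]mulrC.
    by move=> /andP[h1 h2]; apply/andP; split; lra.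
  by move=> /andP[h1 h2]; apply/andP; split; lra.
rewrite /mu1 /= !lebesgue_measure_itv /= !lte_fin ltr_pM2r ?invr_gt0// ltrD2r.
case: ifP => _; last by rewrite mule0.
by rewrite -!EFinB -EFinM; congr EFin; field; exact: lt0r_neq0.
Qed.

Lemma mu2_dil (A : set (mR * mR)) : measurable A -> @mu2 R A = ((l ^+ 2)%:E * @mu2 R (dil2 @^-1` A))%E.
Proof.
move=> mA.
apply: (@product_measure_unique _ _ mR mR R (mu1 R) (mu1 R) (mscale l2 (pushforward (@mu2 R) dil2))) => // X Y mX mY.
transitivity ((l ^+ 2)%:E * @mu2 R (dil2 @^-1` (X `*` Y)))%E; first by [].
have -> : dil2 @^-1` (X `*` Y) = (dil1 b.1.1 @^-1` X) `*` (dil1 b.1.2 @^-1` Y) by [].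
have m1 : measurable (dil1 b.1.1 @^-1` X) by rewrite -[X in measurable X]setTI; exact: dil1_measurable.
have m2 : measurable (dil1 b.1.2 @^-1` Y) by rewrite -[X in measurable X]setTI; exact: dil1_measurable.
rewrite /mu2 product_measure1E// (mu1_dil b.1.1 mX) (mu1_dil b.1.2 mY).
by rewrite expr2 EFinM -!muleA; congr (_ * _)%E; rewrite muleCA.
Qed.

Lemma mu3_dil (A : set mpt) : measurable A -> mu3 A = ((l ^+ 3)%:E * mu3 (dil3 @^-1` A))%E.
Proof.
move=> mA.
apply: (@product_measure_unique _ _ _ mR R (@mu2 R) (mu1 R) (mscale l3 (pushforward (@mu3 R) dil3))) => // X Y mX mY.
transitivity ((l ^+ 3)%:E * mu3 (dil3 @^-1` (X `*` Y)))%E; first by [].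
have -> : dil3 @^-1` (X `*` Y) = (dil2 @^-1` X) `*` (dil1 b.2 @^-1` Y) by [].
have m1 : measurable (dil2 @^-1` X) by rewrite -[X in measurable X]setTI; exact: dil2_measurable.
have m2 : measurable (dil1 b.2 @^-1` Y) by rewrite -[X in measurable X]setTI; exact: dil1_measurable.
transitivity (@mu2 R X * mu1 R Y)%E; last by [].
rewrite (mu2_dil mX) (mu1_dil b.2 mY) /mu3 product_measure1E//.
by rewrite exprSr EFinM -!muleA; congr (_ * _)%E; rewrite muleCA.
Qed.

Lemma dil3E (x : pt) : dil3 x = l *: x + b. Proof. by []. Qed.

Lemma integ_dil (D : set pt) (f : pt -> R) : mbl3 D -> measurable_fun (D : set mpt) (f : mpt -> mR) ->
  (forall x, 0 <= f x) ->
  integ D f = l ^+ 3 * integ (dil3 @^-1` D) (fun x => f (l *: x + b)).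
Proof.
move=> mD mf f0; rewrite !integE /Rintegral.
have mEf : measurable_fun (D : set mpt) (fun x : mpt => (f x)%:E) by exact/measurable_EFinP.
have E := @eq_measure_integral _ mpt R D (mscale l3 (pushforward (@mu3 R) dil3))
  (@mu3 R : {measure set mpt -> \bar R}) (fun x : mpt => (f x)%:E) (fun A mA _ => mu3_dil mA).
rewrite E.
rewrite ge0_integral_mscale//; last by move=> x _; rewrite lee_fin.
rewrite (ge0_integral_pushforward dil3_measurable)//; last by move=> x _; rewrite lee_fin.
(* An infinite integral is turned into 0 by [fine], on both sides. *)
rewrite /=; case: (integral _ _ _) => [r| |] //=; first by rewrite gt0_muley ?lte_fin ?exprn_gt0//= mulr0.
by rewrite gt0_muleNy ?lte_fin ?exprn_gt0//= mulr0.
Qed.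
End ChangeOfVariables.

(** * Test functions and the dilated Poincare inequality *)

Section TestFunctions.
Variable R : realType.
Local Notation mR := (measurableTypeR R).
Local Notation mpt := ((mR * mR) * mR)%type.
Local Notation pt := (pt R).
Implicit Types (f g : pt -> R) (W D : set pt).

Lemma partial_near0 i f x : (\forall y \near x, f y = 0) -> partial i f x = 0.
Proof.
move=> h; have d0 : is_derive x (ev R i) (fun=> 0 : R) 0 := pd_cst i 0 x.
have [_ <-] : is_derive x (ev R i) f 0.
  by apply: near_eq_is_derive d0; apply: filterS h => y ->.
by [].
Qed.

Lemma notin_closure_support_near f x : ~ closure (Defs.support f) x -> \forall y \near x, f y = 0.
Proof.
move=> nx; have oC : open (~` closure (Defs.support f)) by apply: closed_openC; exact: closed_closure.
have : nbhs x (~` closure (Defs.support f)) by exact: open_nbhs_nbhs.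
apply: filterS => y ny; apply/eqP; apply/negP => /negP fy; apply: ny.
exact: subset_closure.
Qed.

Lemma notin_closure_support f x : ~ closure (Defs.support f) x -> f x = 0 /\ forall i, partial i f x = 0.
Proof.
move=> /notin_closure_support_near h; split; first exact: nbhs_singleton h.
by move=> i; exact: partial_near0.
Qed.

Lemma smooth_pd f : smooth f -> [/\ continuous f, forall i, pd i f (partial i f) &
  forall i, continuous (partial i f)].
Proof.
move=> [S [Sf hS]]; have [cf df] := hS f Sf; split=> // i.
  by apply: derivable_pd; exact: (df i).1.
by have [] := hS _ (df i).2.
Qed.

Lemma smooth_partial f i : smooth f -> smooth (partial i f).
Proof. by move=> [S [Sf hS]]; exists S; split=> //; exact: ((hS f Sf).2 i).2. Qed.

Lemma closure_support_partial i f : closure (Defs.support (partial i f)) `<=` closure (Defs.support f).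
Proof.
have <- : closure (closure (Defs.support f)) = closure (Defs.support f).
  by apply/esym/closure_id; exact: closed_closure.
apply: closureS => x; apply: contraPP => /notin_closure_support[_ /(_ i) h].
by rewrite /Defs.support /= h eqxx.
Qed.

Lemma test_fun_partial W i f : test_fun W f -> test_fun W (partial i f).
Proof.
move=> [sf [cf fW]]; split; first exact: smooth_partial.
have h := @closure_support_partial i f; split; last exact: subset_trans h fW.
exact: (subclosed_compact (@closed_closure _ _) cf h).
Qed.

Lemma smooth_sub f g : smooth f -> smooth g -> smooth (f \- g).
Proof.
move=> [S [Sf hS]] [T [Tg hT]].
exists [set h | exists a b, [/\ S a, T b & h = a \- b]]; split; first by exists f, g.
move=> _ [a [b [Sa Tb ->]]]; have [ca da] := hS a Sa; have [cb db] := hT b Tb.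
have pdab i : pd i (a \- b) (partial i a \- partial i b).
  by apply: pdB; apply: derivable_pd; [exact: (da i).1|exact: (db i).1].
split; first by apply: cont_add => //; exact: cont_opp.
move=> i; split; first by move=> x; exact: pd_derivable (pdab i).
exists (partial i a), (partial i b); split; [exact: (da i).2|exact: (db i).2|].
exact: pd_partial.
Qed.

Lemma test_fun_sub W f g : test_fun W f -> test_fun W g -> test_fun W (f \- g).
Proof.
move=> [sf [cf fW]] [sg [cg gW]]; split; first exact: smooth_sub.
have h : closure (Defs.support (f \- g)) `<=` closure (Defs.support f) `|` closure (Defs.support g).
  rewrite -closureU; apply: closureS => x; rewrite /Defs.support /= => fg.
  have [f0|f0] := eqVneq (f x) 0; [right|by left].
  by move: fg; rewrite f0 sub0r oppr_eq0.
split; last by apply: subset_trans h _; rewrite subUset.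
exact: (subclosed_compact (@closed_closure _ _) (compactU cf cg) h).
Qed.

Lemma test_vfield_rot W (u : vfield R) : test_vfield W u -> test_vfield W (rot u).
Proof.
by move=> tu; elim/ord3P; apply: test_fun_sub; exact: test_fun_partial.
Qed.

Lemma integ_supp D W f : mbl3 D -> mbl3 W -> W `<=` D -> (forall x, ~ W x -> f x = 0) ->
  integ W f = integ D f.
Proof.
move=> mD mW WD f0; have e1 := Rintegral_mkcond (@mu3 R : {measure set mpt -> \bar R}) W f.
have e2 := Rintegral_mkcond (@mu3 R : {measure set mpt -> \bar R}) D f.
rewrite !integE; apply: etrans e1 _; apply: etrans (esym e2).
apply: eq_Rintegral => x _; rewrite !patchE.
case: ifPn => xW; case: ifPn => xD //.
  by move: xD; rewrite notin_setE => /(_ (WD _ (set_mem xW))).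
by rewrite f0//; move: xW; rewrite notin_setE.
Qed.

Lemma box_face L i (x : pt) : `|crd i x| = L -> ~ box L x.
Proof. by move=> xL /(_ i); rewrite -ltr_norml xL ltxx. Qed.

(** No regularity of [W] enters: the flux [f psi] vanishes off [W], and the integration by parts
    takes place on the enclosing box. *)
Lemma weak_grad_pd L W f (G : vfield R) : 0 < L -> open W -> W `<=` box L -> continuous f ->
  (forall i, continuous (G i)) -> (forall i, pd i f (G i)) -> weak_grad W f G.
Proof.
move=> L0 oW WL cf cG pf psi tpsi.
have mW : mbl3 W := open_measurable3 oW.
have sp i := smooth_pd (tpsi i).1.
have cp i : continuous (psi i) by have [] := sp i.
have cdp i j : continuous (partial j (psi i)) by have [_ _] := sp i; apply.
have z i x : ~ W x -> psi i x = 0 /\ forall j, partial j (psi i) x = 0.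
  by move=> nW; apply: notin_closure_support => /(tpsi i).2.2.
have bQ := box_bdm L; have mQ := bQ.1.
have cdiv : continuous (div psi).
  by rewrite /Defs.div; apply: cont_sum3 => i.
rewrite (integ_supp mQ mW WL); last first.
  by move=> x nW; rewrite /Defs.div big1 ?mulr0// => i _; rewrite (z i x nW).2.
rewrite (integ_supp mQ mW WL); last first.
  by move=> x nW; rewrite /dot big1// => i _; rewrite (z i x nW).1 mulr0.
apply/eqP; rewrite -addr_eq0 -I_D//; [|exact: cont_mul|exact: cont_dot].
apply/eqP; rewrite -[RHS](@integ_div_zero _ L L0 (fun i x => f x * psi i x) (fun i x => G i x * psi i x + f x * partial i (psi i) x)).
- by apply: eq_integ => x _; rewrite /Defs.div /dot !sum3; pring.
- by move=> i; apply: pdM => //; have [_ h _] := sp i; exact: h.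
- by move=> i; apply: cont_add; exact: cont_mul.
- by move=> i x xL; rewrite (z i x _).1 ?mulr0// => /WL; exact: box_face xL.
Qed.

Lemma Sm_sum3 (F : 'I_3 -> pt -> R) : (forall i, Sm (F i)) -> Sm (fun x => \sum_(i < 3) F i x).
Proof.
move=> h; rewrite (_ : (fun x => _) = fun x => F i0 x + F i1 x + F i2 x).
  by apply: Sm_add => //; exact: Sm_add.
by apply/funext => x; rewrite sum3.
Qed.

Lemma Sm_dil f (l : R) (b : pt) : Sm f -> Sm (fun x => f (l *: x + b)).
Proof.
elim=> [a|i|g h _ sg _ sh|g h _ sg _ sh|g _ sg|g _ sg|P g _ sg].
- exact: Sm_cst.
- rewrite (_ : (fun x => _) = fun x => l * crd i x + crd i b); last by apply/funext => x; rewrite crdD crdZ.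
  by apply: Sm_add; [apply: Sm_mul; [exact: Sm_cst|exact: Sm_crd]|exact: Sm_cst].
- exact: Sm_add.
- exact: Sm_mul.
- exact: Sm_sin.
- exact: Sm_cos.
- exact: Sm_flat.
Qed.

Lemma pd_dil i f g (l : R) (b : pt) : pd i f g -> pd i (fun x => f (l *: x + b)) (fun x => l * g (l *: x + b)).
Proof.
move=> pf x; apply/is_derive_line.
pose F := (fun h : R => f (h *: ev R i + (l *: x + b))).
have h : is_derive (0 : R) 1 F (g (l *: x + b)) by exact/is_derive_line.
have hl : is_derive (0 : R) 1 (fun h : R => l * h) l.
  by apply: is_derive_eq; rewrite /GRing.scale /=; ring.
have h' : is_derive (l * 0) 1 F (g (l *: x + b)) by rewrite mulr0.
have := is_derive1_comp h' hl; rewrite mulrC; congr is_derive.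
apply/funext => t; rewrite /F /=; congr f; rewrite scalerDr scalerA -addrA; congr (_ + _).
Qed.

Definition poincare D (c : R) := forall f (G : vfield R), H1 D f G -> integ D f = 0 ->
  Num.sqrt (nrm2 D f) <= c * Num.sqrt (vnrm2 D G).

(** Pull [f] back to [D]: the Jacobians on the two sides cancel, and the gradient gains the factor
    [l <= 1]. The value [m] is the mean of the pulled back function. *)
Lemma poincare_dil L D (c l : R) (b : pt) f : 0 < L -> open D -> D !=set0 -> D `<=` box L -> 0 <= c -> poincare D c ->
  0 < l -> l <= 1 -> Sm f -> (dil3 l b @` D) `<=` box L -> open (dil3 l b @` D) ->
  exists m, integ (dil3 l b @` D) (fun x => (f x - m) ^+ 2) <=
     c ^+ 2 * integ (dil3 l b @` D) (fun x => \sum_(i < 3) partial i f x ^+ 2).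
Proof.
move=> L0 oD [x0 Dx0] DL c0 hp l0 l1 sf WL oW.
set W := dil3 l b @` D in WL oW *.
have bD : bdm D by split; [exact: open_measurable3|exists L; exact: subset_trans (@box_cbox _ _)].
have mW : mbl3 W := open_measurable3 oW.
have preW : dil3 l b @^-1` W = D.
  apply/seteqP; split=> x; last by exists x.
  move=> [y Dy]; rewrite !dil3E => /addIr /(scalerI (lt0r_neq0 l0)) <- //.
pose v := integ D (fun=> 1 : R).
(* Taking a mean over [D] requires positive volume: [D] contains a small cube around [x0]. *)
have v0 : 0 < v.
  rewrite /v integE (Rintegral_cst _ bD.1) mul1r fine_gt0//; apply/andP; split; last first.
    by apply: le_lt_trans (box_finite L); apply: le_measure; rewrite ?inE//; [exact: bD.1|exact: box_measurable].
  have : nbhs x0 D by exact: open_nbhs_nbhs.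
  move=> /nbhs_ballP[e /= e0 eD].
  pose C : set mpt := ([set` `]x0.1.1 - e / 2, x0.1.1 + e / 2[%R] `*` [set` `]x0.1.2 - e / 2, x0.1.2 + e / 2[%R]) `*` [set` `]x0.2 - e / 2, x0.2 + e / 2[%R].
  have mC2 : measurable ([set` `]x0.1.1 - e / 2, x0.1.1 + e / 2[%R] `*` [set` `]x0.1.2 - e / 2, x0.1.2 + e / 2[%R] : set (mR * mR)) by exact: measurableX.
  have mC : measurable C by exact: measurableX.
  have CD : C `<=` D.
    move=> [[y0 y1] y2] [[/=]]; rewrite !in_itv /= => h0 h1 h2; apply: eD.
    by split; [split|]; rewrite /ball /= distrC ltr_norml; lra.
  have pos (t : R) : (0 < mu1 R [set` `]t - e / 2, t + e / 2[%R])%E.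
    rewrite /mu1 /= lebesgue_measure_itv /= lte_fin ifT; last by lra.
    by rewrite -EFinB lte_fin; lra.
  have CE : mu3 C = (mu2 ([set` `]x0.1.1 - e / 2, x0.1.1 + e / 2[%R] `*` [set` `]x0.1.2 - e / 2, x0.1.2 + e / 2[%R]) * mu1 R [set` `]x0.2 - e / 2, x0.2 + e / 2[%R])%E.
    by apply: product_measure1E.
  have CE2 : mu2 ([set` `]x0.1.1 - e / 2, x0.1.1 + e / 2[%R] `*` [set` `]x0.1.2 - e / 2, x0.1.2 + e / 2[%R]) = (mu1 R [set` `]x0.1.1 - e / 2, x0.1.1 + e / 2[%R] * mu1 R [set` `]x0.1.2 - e / 2, x0.1.2 + e / 2[%R])%E.
    by apply: product_measure1E.
  have : (0 < mu3 C)%E by rewrite CE CE2 !mule_gt0.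
  by move/lt_le_trans; apply; apply: le_measure; rewrite ?inE//; exact: bD.1.
pose F x := f (l *: x + b); have sF : Sm F := Sm_dil l b sf.
pose m := integ D F / v.
exists m.
have cF : continuous (fun x => F x - m) by apply: cont_add; [exact: Sm_continuous|exact: cont_cst].
pose G : vfield R := fun i x => l * partial i f (l *: x + b).
have cG i : continuous (G i).
  apply: Sm_continuous; apply: Sm_mul; [exact: Sm_cst|apply: Sm_dil; exact: Sm_partial].
have pF i : pd i (fun x => F x - m) (G i).
  have := pdB (pd_dil l b (Sm_pdp i sf)) (pd_cst i m); apply: pd_ext => // x; exact: subr0.
have hH : H1 D (fun x => F x - m) G.
  split; first exact: continuous_L2.
  split; first by move=> i; exact: continuous_L2.
  exact: (weak_grad_pd L0).
have mean0 : integ D (fun x => F x - m) = 0.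
  rewrite integB; [|exact: bD.1|by apply: bdm_itg => //; exact: Sm_continuous|by apply: bdm_itg => //; exact: cont_cst].
  have -> : integ D (fun=> m) = m * v.
    rewrite -integZ; [|exact: bD.1|by apply: bdm_itg => //; exact: cont_cst].
    by apply: eq_integ => x _; rewrite mulr1.
  by rewrite /m divfK ?subrr// lt0r_neq0.
have := hp _ _ hH mean0 => h.
have {}h : nrm2 D (fun x => F x - m) <= c ^+ 2 * vnrm2 D G.
  rewrite -[leLHS]sqr_sqrtr ?nrm2_ge0// -[vnrm2 D G]sqr_sqrtr ?vnrm2_ge0// -exprMn.
  by rewrite !expr2; apply: ler_pM.
have cf : continuous f := Sm_continuous sf.
have c1 : continuous (fun x => (f x - m) ^+ 2).
  by apply: cont_sqr; apply: cont_add => //; exact: cont_cst.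
have c2 : continuous (fun x => \sum_(i < 3) partial i f x ^+ 2).
  by apply: cont_sum3 => i; apply: cont_sqr; apply: Sm_continuous; exact: Sm_partial.
rewrite (integ_dil b l0 mW (continuous_measurable3 mW c1)); last by move=> x; exact: sqr_ge0.
rewrite (integ_dil b l0 mW (continuous_measurable3 mW c2)); last by move=> x; apply: sumr_ge0 => i _; exact: sqr_ge0.
rewrite preW mulrCA; apply: ler_wpM2l; first by rewrite exprn_ge0// ltW.
apply: le_trans h _; apply: ler_wpM2l; first exact: sqr_ge0.
apply: le_integ; [exact: bD.1| | |].
- by apply: vL2_itg; [exact: bD.1|exact: continuous_vL2|exact: continuous_vL2].
- apply: bdm_itg => //; apply: Sm_continuous.
  have s3 : Sm (fun x => \sum_(i < 3) partial i f x ^+ 2).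
    apply: (Sm_sum3 (F := fun i x => partial i f x ^+ 2)) => i.
    by apply: Sm_mul; exact: Sm_partial.
  exact: (Sm_dil l b s3).
- move=> x _; apply: ler_sum => i _; rewrite /G mulrACA -!expr2 -[leRHS]mul1r.
  by apply: ler_wpM2r; [exact: sqr_ge0|rewrite expr_le1// ltW].
Qed.
End TestFunctions.

(** * Approximation of test fields by gradients *)

Section GradientApproximation.
Variable R : realType.
Local Notation pt := (pt R).
Variable L : R.
Hypothesis L0 : 0 < L.
Local Notation I := (integ (box L)).
Local Notation adm := (adm L).

(** The flux is the cross product of [Phi] and [u], which vanishes off [W]; its divergence is
    [dot u (rot Phi) - dot (rot u) Phi]. *)
Lemma integ_rot_parts (u Phi : vfield R) (W : set pt) : W `<=` box L -> test_vfield W u -> (forall i, Sm (Phi i)) ->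
  I (dot u (rot Phi)) = I (dot (rot u) Phi).
Proof.
move=> WL tu sP.
have su i := smooth_pd (tu i).1.
have cu i : continuous (u i) by have [] := su i.
have cdu i j : continuous (partial j (u i)) by have [_ _] := su i; apply.
have pu i j : pd j (u i) (partial j (u i)) by have [_ h _] := su i; exact: h.
have cP i : continuous (Phi i) := Sm_continuous (sP i).
have cdP i j : continuous (partial j (Phi i)) by apply: Sm_continuous; exact: Sm_partial.
have pP i j : pd j (Phi i) (partial j (Phi i)) := Sm_pdp j (sP i).
have z i x : ~ W x -> u i x = 0.
  by move=> nW; exact: (notin_closure_support (fun h => nW ((tu i).2.2 _ h))).1.
have crot (w : vfield R) i : (forall i j, continuous (partial j (w i))) -> continuous (rot w i).
  move=> h; elim/ord3P: i; apply: cont_add; try exact: h; apply: cont_opp; exact: h.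
pose F (i : 'I_3) : pt -> R := if i == i0 then fun x => Phi i1 x * u i2 x - Phi i2 x * u i1 x
  else if i == i1 then fun x => Phi i2 x * u i0 x - Phi i0 x * u i2 x
  else fun x => Phi i0 x * u i1 x - Phi i1 x * u i0 x.
pose G (i : 'I_3) : pt -> R := 
  if i == i0 then fun x => (partial i0 (Phi i1) x * u i2 x + Phi i1 x * partial i0 (u i2) x) - (partial i0 (Phi i2) x * u i1 x + Phi i2 x * partial i0 (u i1) x)
  else if i == i1 then fun x => (partial i1 (Phi i2) x * u i0 x + Phi i2 x * partial i1 (u i0) x) - (partial i1 (Phi i0) x * u i2 x + Phi i0 x * partial i1 (u i2) x)
  else fun x => (partial i2 (Phi i0) x * u i1 x + Phi i0 x * partial i2 (u i1) x) - (partial i2 (Phi i1) x * u i0 x + Phi i1 x * partial i2 (u i0) x).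
have pF i : pd i (F i) (G i) by elim/ord3P: i; rewrite /F /G ?eqxx ?eqI3; apply: pdB; apply: pdM.
have cM (f g f' g' : pt -> R) : continuous f -> continuous g -> continuous f' -> continuous g' -> continuous (fun x => f x * g x + f' x * g' x).
  by move=> *; apply: cont_add; exact: cont_mul.
have cG i : continuous (G i).
  by elim/ord3P: i; rewrite /G ?eqxx ?eqI3; apply: cont_add; [|apply: cont_opp| |apply: cont_opp| |apply: cont_opp]; exact: cM.
have F0 i x : `|crd i x| = L -> F i x = 0.
  move=> h; have nW : ~ W x by move/WL; exact: box_face h.
  by elim/ord3P: i {h}; rewrite /F ?eqxx ?eqI3 !(z _ _ nW) !mulr0 subrr.
have E := integ_div_zero L0 pF cG F0.
have c1 : continuous (dot u (rot Phi)) by apply: cont_dot => // i; exact: crot.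
have c2 : continuous (dot (rot u) Phi) by apply: cont_dot => // i; exact: crot.
rewrite -[RHS]addr0 -E -I_D//; last exact: cont_sum3.
by apply: eq_integ => x _; rewrite /dot !sum3 !rotE /G ?eqxx ?eqI3; pring.
Qed.

Lemma integ_rot_test (u : vfield R) (W : set pt) i : W `<=` box L -> test_vfield W u -> I (rot u i) = 0.
Proof.
move=> WL tu.
have z j k : I (partial j (u k)) = 0.
  have [h1 h2 h3] := smooth_pd (tu k).1.
  apply: (integ_pd0 L0 (h2 j) (h3 j)) => x h.
  exact: (notin_closure_support (fun hx => box_face h (WL _ ((tu k).2.2 _ hx)))).1.
have c j k : continuous (partial j (u k)) by have [h1 h2 h3] := smooth_pd (tu k).1; exact: h3.
have bQ := box_bdm L.
have d j k j' k' : I (fun x => partial j (u k) x - partial j' (u k') x) = 0.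
  by rewrite integB ?z ?subrr//; [exact: bQ.1|exact: bdm_itg|exact: bdm_itg].
by elim/ord3P: i; exact: d.
Qed.

Lemma estimate_arith0 (A c C q r T s : R) : r <= A * (c * T) + s * (C * q) ->
  s * (C * q) <= s * (C * T) -> s ^+ 2 <= s * T -> r + s ^+ 2 <= (c * A + (C + 1) * s) * T.
Proof. by move=> h1 h2 h3; lra. Qed.

(** Solves the self-referential bound for [Num.sqrt R2], by division by [T = sqrt (R2 + e)]. This is
    positive and dominates both [sqrt R2] and [sqrt e], so the coefficient of [A] remains [c]. *)
Lemma estimate_arith (A c C R2 e : R) : 0 <= A -> 0 <= c -> 0 <= C -> 0 < e -> 0 <= R2 ->
  R2 <= A * (c * Num.sqrt (R2 + e)) + Num.sqrt e * (C * Num.sqrt R2) ->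
  Num.sqrt R2 <= c * A + (C + 1) * Num.sqrt e.
Proof.
move=> A0 c0 C0 e0 R0 h.
set T := Num.sqrt (R2 + e) in h *; set s := Num.sqrt e in h *.
have T2 : T ^+ 2 = R2 + e by rewrite sqr_sqrtr// addr_ge0// ltW.
have s2 : s ^+ 2 = e by rewrite sqr_sqrtr// ltW.
have sT : s <= T by rewrite ler_wsqrtr// lerDr.
have RT : Num.sqrt R2 <= T by rewrite ler_wsqrtr// lerDl ltW.
have s0 : 0 < s by rewrite sqrtr_gt0.
have T0 : 0 < T by exact: lt_le_trans sT.
apply: (le_trans RT); rewrite -(ler_pM2r T0) -expr2 T2 -s2.
have h1 : s * (C * Num.sqrt R2) <= s * (C * T) by apply: ler_wpM2l; [exact: ltW|exact: ler_wpM2l].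
have h2 : s ^+ 2 <= s * T by rewrite expr2; apply: ler_wpM2l => //; exact: ltW.
exact: estimate_arith0 h h1 h2.
Qed.

Variables (V : pt -> R) (V1 : vfield R) (V2 : 'I_3 -> 'I_3 -> pt -> R).
Hypothesis cV : continuous V.
Hypothesis cV1 : forall i, continuous (V1 i).
Hypothesis cV2 : forall i j, continuous (V2 i j).
Hypothesis pV : forall i, pd i V (V1 i).
Hypothesis pV1 : forall i j, pd j (V1 i) (V2 i j).
Hypothesis V2ge0 : forall x (xi : 'I_3 -> R), 0 <= \sum_(i < 3) \sum_(j < 3) V2 i j x * xi i * xi j.
Hypothesis V0 : forall x, 0 <= V x.

Variables (D : set pt) (c l : R) (b : pt) (u : vfield R).
Hypotheses (oD : open D) (D0 : D !=set0) (DL : D `<=` box L) (c0 : 0 <= c) (hp : poincare D c).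
Hypotheses (l0 : 0 < l) (l1 : l <= 1).
Local Notation W := (dil3 l b @` D).
Hypotheses (WL : W `<=` box L) (oW : open W) (VW : forall x, W x -> V x = 0).
Hypothesis tu : test_vfield W u.

(* Since [rot u] has mean zero, each component of [Phi] may be replaced by its deviation from
   its mean over [W], to which the Poincare inequality applies. *)
Lemma rot_dot_le Phi q : adm Phi q ->
  I (dot (rot u) Phi) <= Num.sqrt (vnrm2 (box L) (rot u)) * (c * Num.sqrt (I (fun x => rho V x * gradsq Phi x))).
Proof.
move=> a; have [sP _] := adm_Sm a.
have bQ := box_bdm L; have mW : mbl3 W := open_measurable3 oW.
have bW : bdm W by split => //; exists L; exact: subset_trans (@box_cbox _ _).
have cP i : continuous (Phi i) := Sm_continuous (sP i).
have tr := test_vfield_rot tu.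
have cr i : continuous (rot u i) by have [] := smooth_pd (tr i).1.
have zr i x : ~ W x -> rot u i x = 0.
  by move=> nW; exact: (notin_closure_support (fun h => nW ((tr i).2.2 _ h))).1.
have /choice[m hm] : forall i, exists m, integ W (fun x => (Phi i x - m) ^+ 2) <=
     c ^+ 2 * integ W (fun x => \sum_(j < 3) partial j (Phi i) x ^+ 2).
  by move=> i; exact: (poincare_dil L0).
pose Psi : vfield R := fun i x => Phi i x - m i.
have cPsi i : continuous (Psi i) by apply: cont_add => //; exact: cont_cst.
have -> : I (dot (rot u) Phi) = integ W (dot (rot u) Psi).
  rewrite (integ_supp bQ.1 mW WL); last first.
    by move=> x nW; rewrite /dot big1// => i _; rewrite zr ?mul0r.
  have -> : dot (rot u) Psi = fun x => dot (rot u) Phi x - \sum_(i < 3) m i * rot u i x.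
    by apply/funext => x; rewrite /dot /Psi !sum3; move: (rot u i0 x) (rot u i1 x) (rot u i2 x) => *; ring.
  have cmr i : continuous (fun x => m i * rot u i x) by apply: cont_mul => //; exact: cont_cst.
  rewrite integB; [|exact: bQ.1|by apply: bdm_itg => //; exact: cont_dot|by apply: bdm_itg => //; exact: cont_sum3].
  rewrite (integ_sum3 (F := fun i x => m i * rot u i x)); [|exact: bQ.1|by move=> i; exact: (bdm_itg bQ (cmr i))].
  rewrite big1 ?subr0// => i _; rewrite I_Z//.
  by rewrite (@integ_rot_test u W)// mulr0.
apply: le_trans (ler_norm _) _.
apply: le_trans (vCauchySchwarz mW (continuous_vL2 bW cr) (continuous_vL2 bW cPsi)) _.
have -> : vnrm2 W (rot u) = vnrm2 (box L) (rot u).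
  apply: (integ_supp bQ.1 mW WL) => x nW; rewrite /dot big1// => i _; rewrite zr ?mul0r//.
apply: ler_wpM2l; first exact: sqrtr_ge0.
rewrite -[X in X * _](ger0_norm c0) -sqrtr_sqr -sqrtrM ?sqr_ge0// ler_wsqrtr//.
have cg i : continuous (fun x => \sum_(j < 3) partial j (Phi i) x ^+ 2).
  by apply: cont_sum3 => j; apply: cont_sqr; exact: (partial_cont a).
have cgs := gradsq_cont a.
have crg : continuous (fun x => rho V x * gradsq Phi x) by apply: cont_mul => //; exact: rho_cont.
have gs0 x : 0 <= gradsq Phi x by apply: sumr_ge0 => i _; apply: sumr_ge0 => j _; exact: sqr_ge0.
apply: (@le_trans _ _ (c ^+ 2 * integ W (gradsq Phi))).
  rewrite /vnrm2 /dot integ_sum3; [|exact: mW|by move=> i; apply: bdm_itg => //; exact: cont_mul].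
  rewrite [gradsq Phi](_ : _ = fun x => \sum_(i < 3) \sum_(j < 3) partial j (Phi i) x ^+ 2)//.
  rewrite integ_sum3; [|exact: mW|by move=> i; exact: (bdm_itg bW (cg i))].
  rewrite mulr_sumr; apply: ler_sum => i _; apply: le_trans (hm i).
  by rewrite le_eqVlt; apply/orP; left; apply/eqP; apply: eq_integ => x _; rewrite expr2.
apply: ler_wpM2l; first exact: sqr_ge0.
have -> : integ W (gradsq Phi) = integ W (fun x => rho V x * gradsq Phi x).
  by apply: eq_integ => x Wx; rewrite /rho VW// oppr0 expR0 mul1r.
rewrite !integE -!integE.
have -> : integ W (fun x => rho V x * gradsq Phi x) = I (fun x => if x \in W then rho V x * gradsq Phi x else 0).
  rewrite -(integ_supp bQ.1 mW WL); last by move=> x nW; rewrite ifF//; apply/negbTE; rewrite notin_setE.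
  by apply: eq_integ => x Wx; rewrite ifT// inE.
apply: le_integ; [exact: bQ.1| |exact: bdm_itg|].
  have h := bdm_itg bQ crg.
  apply: (le_integrable bQ.1 _ _ h).
    have mh := measurable_int _ h.
    apply/measurable_EFinP; apply: measurable_fun_if => //.
    - exact: box_measurable.
    - apply: (measurable_fun_bool true) => //.
      rewrite (_ : _ @^-1` _ = W); last first.
        by apply/seteqP; split=> x /=; [move=> /set_mem|move=> /mem_set].
      by apply: measurableI => //; exact: box_measurable.
    - by apply: continuous_measurable3 => //; apply: measurableI; [exact: box_measurable|];
        rewrite (_ : _ @^-1` _ = W)//; apply/seteqP; split=> x /=; [move=> /set_mem|move=> /mem_set].
  by move=> x _ /=; rewrite lee_fin; case: ifP => _; rewrite ?normr0.
move=> x _; case: ifP => _ //; apply: mulr_ge0 => //; exact: ltW (rho_gt0 V x).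
Qed.

(** The factor [expR (V x)] turns the duality estimate into decay: off [W], where [u] vanishes, it
    weights [|grad q|^2] itself. *)
Theorem weighted_gradient_approx (d : R) : 0 < d -> exists2 q, TS L bfull q &
  I (fun x => expR (V x) * dot (fun i x => u i x - grad q i x) (fun i x => u i x - grad q i x) x)
   <= (c * Num.sqrt (vnrm2 (box L) (rot u)) + d) ^+ 2.
Proof.
move=> d0; have bQ := box_bdm L; have mQ := bQ.1.
have [B' B'0 hB'] := continuous_bounded_cbox L cV.
have V01 x : box L x -> 0 <= V x <= B'.
  by move=> bx; rewrite V0 /=; apply: le_trans (ler_norm _) _; apply: hB'; exact: box_cbox.
set A := Num.sqrt (vnrm2 (box L) (rot u)).
pose C := Num.sqrt (expR B').
have C0 : 0 <= C := sqrtr_ge0 _.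
have C21 : 0 < 2 * C + 1 by rewrite ltr_wpDl// mulr_ge0.
(* The final error is [(2 * C + 1) * sqrt e]: [C + 1] from [estimate_arith], and [C] from the
   residual under the weight. *)
pose e := (d / (2 * C + 1)) ^+ 2.
have e0 : 0 < e by rewrite exprn_gt0// divr_gt0.
have se : Num.sqrt e = d / (2 * C + 1) by rewrite sqrtr_sqr ger0_norm// divr_ge0 ?ltW.
have su i := smooth_pd (tu i).1.
have cu i : continuous (u i) by have [] := su i.
have dr : dense_range L (rho V) V1 by exact: (weighted_dense_range L0 cV cV1 cV2 pV pV1 V2ge0 V01).
have [Phi [q [k [a hX]]]] := dr u (fun=> 0) e cu (@cont_cst R 0) e0.
have [sP sq] := adm_Sm a.
have cr := rho_cont cV; have crot := rot_cont a; have cg := grad_cont a.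
have cU i := @opU_cont _ L (rho V) Phi q i cr a; have cG := @opG_cont _ L V1 Phi q k cV1 a.
pose e1 : vfield R := fun i x => u i x - opU (rho V) Phi q i x.
have ce1 i : continuous (e1 i) by have := cu i => h; apply: cont_add => //; exact: cont_opp.
have he1 : vnrm2 (box L) e1 <= e.
  have -> : vnrm2 (box L) e1 = vnrm2 (box L) (fun i x => opU (rho V) Phi q i x - u i x).
    by apply: eq_integ => x _; apply: eq_bigr => i _; rewrite /e1 -mulrNN !opprB.
  by apply: le_trans (ltW hX); rewrite /tot lerDl nrm2_ge0.
have hg : nrm2 (box L) (opG V1 Phi k) <= e.
  have <- : nrm2 (box L) (fun x => opG V1 Phi k x - 0) = nrm2 (box L) (opG V1 Phi k).
    by apply: eq_integ => x _; rewrite subr0.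
  by apply: le_trans (ltW hX); rewrite /tot lerDr vnrm2_ge0.
set R2 := I (fun x => rho V x * dot (rot Phi) (rot Phi) x).
have crr : continuous (fun x => rho V x * dot (rot Phi) (rot Phi) x) by apply: cont_mul => //; exact: cont_dot.
have R20 : 0 <= R2 by apply: integ_ge0 => x _; apply: mulr_ge0; [exact: ltW (rho_gt0 V x)|exact: dot_ge0].
have hD := le_trans (integ_rho_divV_le L0 cV cV1 pV V01 k a) hg.
have hBo : I (fun x => rho V x * gradsq Phi x) <= R2 + e.
  by apply: le_trans (Bochner_le L0 cV cV1 cV2 pV pV1 V2ge0 a) _; rewrite lerD2l.
have hrot : vnrm2 (box L) (rot Phi) <= expR B' * R2.
  exact: (integ_le_rho cV V01 (cont_dot crot crot) (dot_ge0 _)).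
(* Test [u = rho rot Phi + grad q + e1] with [rot Phi], which is orthogonal to [grad q]. *)
have split1 : R2 = I (dot u (rot Phi)) - I (dot e1 (rot Phi)).
  rewrite -integB; [|exact: mQ|by apply: bdm_itg => //; exact: cont_dot|by apply: bdm_itg => //; exact: cont_dot].
  rewrite -[LHS]addr0 -(integ_rot_grad L0 a) -I_D//; last exact: cont_dot.
  apply: eq_integ => x _; rewrite /dot /e1 /opU !sum3.
  by move: (rot Phi i0 x) (rot Phi i1 x) (rot Phi i2 x) (grad q i0 x) (grad q i1 x) (grad q i2 x) => *; ring.
have R2le : R2 <= A * (c * Num.sqrt (R2 + e)) + Num.sqrt e * (C * Num.sqrt R2).
  rewrite [X in X <= _]split1; apply: lerD.
    rewrite (integ_rot_parts WL tu sP); apply: le_trans (rot_dot_le a) _.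
    apply: ler_wpM2l; first exact: sqrtr_ge0.
    apply: ler_wpM2l => //; exact: ler_wsqrtr.
  apply: le_trans (ler_norm _) _; rewrite normrN.
  apply: le_trans (vCauchySchwarz mQ (continuous_vL2 bQ ce1) (continuous_vL2 bQ crot)) _.
  apply: ler_pM; rewrite ?sqrtr_ge0//; first exact: ler_wsqrtr.
  by rewrite /C -(sqrtrM _ (ltW (expR_gt0 B'))); exact: ler_wsqrtr.
have sR := estimate_arith (sqrtr_ge0 _) c0 C0 e0 R20 R2le.
exists q; first exact: a.2.
(* The square root of the weight. As [w^2 rho^2 = rho], the summand [rho rot Phi] of [u - grad q]
   has weighted squared norm exactly [R2]. *)
pose w x := expR (V x / 2).
have cw : continuous w by apply: cont_expR; apply: cont_mul => //; exact: cont_cst.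
have w2 x : w x ^+ 2 = expR (V x) by rewrite expr2 -expRD; congr expR; field.
pose f1 : vfield R := fun i x => w x * (rho V x * rot Phi i x).
pose f2 : vfield R := fun i x => w x * e1 i x.
have cf1 i : continuous (f1 i) by have := crot i => h; apply: cont_mul => //; exact: cont_mul.
have cf2 i : continuous (f2 i) by have := ce1 i => h; exact: cont_mul.
have -> : I (fun x => expR (V x) * dot (fun i x => u i x - grad q i x) (fun i x => u i x - grad q i x) x) =
   vnrm2 (box L) (fun i x => f1 i x + f2 i x).
  apply: eq_integ => x _; rewrite /f1 /f2 /e1 /opU -w2 /dot !sum3.
  by move: (rot Phi i0 x) (rot Phi i1 x) (rot Phi i2 x) (grad q i0 x) (grad q i1 x) (grad q i2 x) => *; ring.
rewrite -[leLHS]sqr_sqrtr ?vnrm2_ge0//.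
have fin : Num.sqrt (vnrm2 (box L) (fun i x => f1 i x + f2 i x)) <= c * A + d.
  apply: le_trans (vnormD mQ (continuous_vL2 bQ cf1) (continuous_vL2 bQ cf2)) _.
  have n1 : vnrm2 (box L) f1 = R2.
    apply: eq_integ => x _; rewrite /f1 /dot !sum3.
    have wr : w x ^+ 2 * rho V x = 1 by rewrite w2 /rho expRN divff// gt_eqF// expR_gt0.
    transitivity (w x ^+ 2 * rho V x * (rho V x * (rot Phi i0 x * rot Phi i0 x + rot Phi i1 x * rot Phi i1 x + rot Phi i2 x * rot Phi i2 x))).
      by move: (rot Phi i0 x) (rot Phi i1 x) (rot Phi i2 x) => *; ring.
    by rewrite wr mul1r.
  have n2 : vnrm2 (box L) f2 <= expR B' * e.
    apply: (@le_trans _ _ (expR B' * vnrm2 (box L) e1)); last by rewrite ler_pM2l ?expR_gt0.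
    rewrite /vnrm2 -I_Z; last exact: cont_dot.
    apply: le_I; [exact: cont_dot|by apply: cont_mul; [exact: cont_cst|exact: cont_dot]|].
    move=> x bx; have -> : dot f2 f2 x = w x ^+ 2 * dot e1 e1 x.
      by rewrite /dot /f2 !sum3; move: (e1 i0 x) (e1 i1 x) (e1 i2 x) => *; ring.
    rewrite w2; apply: ler_wpM2r; first exact: dot_ge0.
    by rewrite ler_expR; have /andP[] := V01 x bx.
  have n3 : Num.sqrt (vnrm2 (box L) f2) <= C * Num.sqrt e.
    by rewrite /C -(sqrtrM _ (ltW (expR_gt0 B'))); exact: ler_wsqrtr.
  rewrite n1; apply: le_trans (lerD sR n3) _.
  rewrite -addrA lerD2l -mulrDl se mulrA ler_pdivrMr// mulrC.
  by rewrite le_eqVlt; apply/orP; left; apply/eqP; ring.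
rewrite !expr2; apply: ler_pM => //; exact: sqrtr_ge0.
Qed.
End GradientApproximation.

(** * Convex polyhedral penalties *)

Section Penalty.
Variable R : realType.
Local Notation pt := (pt R).

Definition pos (t : R) : R := Num.max 0 t.

Lemma pos_ge0 t : 0 <= pos t. Proof. by rewrite /pos le_max lexx. Qed.
Lemma pos_mul t : t * pos t = pos t ^+ 2.
Proof. by rewrite /pos; case: (leP 0 t) => _; rewrite ?expr2 ?mulr0. Qed.

(** A quadratic remainder determines the derivative, and for positive parts it is available at the
    kink as well. *)
Lemma is_derive_quadratic (f : R -> R) (t d C : R) : 0 <= C ->
  (forall s, `|f s - f t - d * (s - t)| <= C * (s - t) ^+ 2) -> is_derive t 1 f d.
Proof.
move=> C0 hf.
have lim : (fun h : R => h^-1 *: (f (h *: 1 + t) - f t)) @ (0 : R)^' --> d.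
  apply/cvgrPdist_lt => e e0; near=> h; rewrite /GRing.scale /= mulr1.
  have hn : h != 0 by near: h; exact: nbhs_dnbhs_neq.
  have := hf (h + t); rewrite addrK => k.
  rewrite (_ : d - _ = - (h^-1 * (f (h + t) - f t - d * h))); last by field.
  rewrite normrN normrM normfV mulrC ltr_pdivrMr ?normr_gt0//.
  apply: (le_lt_trans k); rewrite -real_normK ?num_real// expr2 mulrA ltr_pM2r ?normr_gt0//.
  apply: (@le_lt_trans _ _ ((C + 1) * `|h|)); first by rewrite ler_wpM2r// lerDl.
  rewrite mulrC -ltr_pdivlMr; last by rewrite ltr_wpDl.
  by near: h; apply: dnbhs0_lt; rewrite divr_gt0// ltr_wpDl.
split; first by apply/cvg_ex; exists d.
exact/cvg_lim.
Unshelve. all: by end_near.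
Qed.

Lemma is_derive_pos2 (t : R) : is_derive t 1 (fun t => pos t ^+ 2) (2 * pos t).
Proof.
apply: (@is_derive_quadratic _ _ _ 1) => // s; rewrite mul1r.
have hp (r : R) : (0 <= r /\ pos r = r) \/ (r < 0 /\ pos r = 0).
  by rewrite /pos; case: (leP 0 r) => h; [left|right].
have q1 := sqr_ge0 (s - t); have q2 := sqr_ge0 s; have q3 := sqr_ge0 t.
rewrite ler_norml; have [[h1 ->]|[h1 ->]] := hp t; have [[h2 ->]|[h2 ->]] := hp s; rewrite ?expr0n /=.
- by apply/andP; split; lra.
- have q4 : t * s <= 0 by rewrite mulr_ge0_le0// ltW.
  by apply/andP; split; lra.
- have q4 : t * s <= 0 by rewrite mulr_le0_ge0// ltW.
  by apply/andP; split; lra.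
- by apply/andP; split; lra.
Qed.

Lemma is_derive_pos3 (t : R) : is_derive t 1 (fun t => pos t ^+ 3) (3 * pos t ^+ 2).
Proof.
have h := is_deriveM (is_derive_id t (1 : R)) (is_derive_pos2 t).
have -> : (fun t => pos t ^+ 3) = (fun t => t * pos t ^+ 2).
  by apply/funext => s; rewrite expr2 mulrA pos_mul -exprSr.
have -> : 3 * pos t ^+ 2 = t *: (2 * pos t) + (pos t ^+ 2) *: 1.
  by rewrite /GRing.scale /= mulr1; have := pos_mul t; lra.
exact: h.
Qed.

Lemma pos_continuous : continuous pos.
Proof.
move=> t; apply/cvgrPdist_lt => e e0; near=> s.
have : `|t - s| < e by near: s; exact: cvgr_dist_lt.
apply: le_lt_trans; rewrite /pos.
have [h1|h1] := leP 0 t; have [h2|h2] := leP 0 s => //; rewrite ler_norml.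
- have := ler_norm (t - s); rewrite subr0 => k; apply/andP; split; last lra.
  by have := normr_ge0 (t - s); lra.
- have := ler_norm (s - t); rewrite distrC sub0r => k; apply/andP; split; first lra.
  by have := normr_ge0 (t - s); lra.
- by rewrite subrr; have := normr_ge0 (t - s); lra.
Unshelve. all: by end_near.
Qed.

(** A pair [p] stands for a half-space, the set where [lin p] is at most 0, with normal [p.1]. *)
Definition lin (p : pt * R) (x : pt) : R := \sum_(i < 3) crd i p.1 * crd i x - p.2.

Lemma Sm_lin p : Sm (lin p).
Proof.
rewrite (_ : lin p = fun x => crd i0 p.1 * crd i0 x + crd i1 p.1 * crd i1 x + crd i2 p.1 * crd i2 x + (- p.2)).
  have h i : Sm (fun x : pt => crd i p.1 * crd i x) by apply: Sm_mul; [exact: Sm_cst|exact: Sm_crd].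
  by apply: Sm_add; [apply: Sm_add; [exact: Sm_add|]|exact: Sm_cst].
by apply/funext => x; rewrite /lin sum3.
Qed.

Lemma pd_lin i p : pd i (lin p) (fun=> crd i p.1).
Proof.
have h := pdB (pd_sum3 (fun j => pdZ (crd j p.1) (pd_coord i j))) (pd_cst i p.2).
apply: (pd_eq h) => x; rewrite sum3 subr0.
by elim/ord3P: i {h}; rewrite !eqxx ?eqI3 !(mulr0, mulr1, addr0, add0r).
Qed.

Lemma cont_lin p : continuous (lin p). Proof. exact: Sm_continuous (Sm_lin p). Qed.

Lemma cont_sumseq (T : Type) (s : seq T) (F : T -> pt -> R) : (forall p, continuous (F p)) ->
  continuous (fun x => \sum_(p <- s) F p x).
Proof.
move=> cF; elim: s => [|p s IH].
  by rewrite (_ : (fun x => _) = fun=> 0); [exact: cont_cst|apply/funext => x; rewrite big_nil].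
by rewrite (_ : (fun x => _) = fun x => F p x + \sum_(q <- s) F q x); [exact: cont_add|apply/funext => x; rewrite big_cons].
Qed.

Lemma pd_sumseq (T : Type) i (s : seq T) (F G : T -> pt -> R) : (forall p, pd i (F p) (G p)) ->
  pd i (fun x => \sum_(p <- s) F p x) (fun x => \sum_(p <- s) G p x).
Proof.
move=> pF; elim: s => [|p s IH].
  by apply: (pd_ext _ _ (pd_cst i 0)) => x; rewrite big_nil.
by apply: (pd_ext _ _ (pdD (pF p) IH)) => x; rewrite big_cons.
Qed.

Variables (ls : seq (pt * R)) (N : R).
Hypothesis N0 : 0 <= N.

(** The cube is the lowest integer power of a positive part that is twice continuously
    differentiable, as [V] must be, and it is the weight on the right side of the Hardy
    inequality. *)
Definition pen (x : pt) : R := N * \sum_(p <- ls) pos (lin p x) ^+ 3.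
Definition pen1 : vfield R := fun i x => N * \sum_(p <- ls) 3 * pos (lin p x) ^+ 2 * crd i p.1.
Definition pen2 (i j : 'I_3) (x : pt) : R := N * \sum_(p <- ls) 3 * (2 * pos (lin p x) * crd j p.1) * crd i p.1.

Lemma cont_pos_lin p : continuous (fun x => pos (lin p x)).
Proof. by apply: (cont_comp (p := pos)); [exact: pos_continuous|exact: cont_lin]. Qed.

Lemma cont_pen : continuous pen.
Proof.
apply: cont_mul; first exact: cont_cst.
apply: cont_sumseq => p; have h := @cont_pos_lin p.
rewrite (_ : (fun x => _) = fun x => pos (lin p x) * pos (lin p x) ^+ 2); last by apply/funext => x; rewrite exprS.
by apply: cont_mul => //; exact: cont_sqr.
Qed.

Lemma cont_pen1 i : continuous (pen1 i).
Proof.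
apply: cont_mul; first exact: cont_cst.
apply: cont_sumseq => p; have h := @cont_pos_lin p.
by apply: cont_mul; [apply: cont_mul; [exact: cont_cst|exact: cont_sqr]|exact: cont_cst].
Qed.

Lemma cont_pen2 i j : continuous (pen2 i j).
Proof.
apply: cont_mul; first exact: cont_cst.
apply: cont_sumseq => p; have h := @cont_pos_lin p.
apply: cont_mul; last exact: cont_cst.
apply: cont_mul; first exact: cont_cst.
by apply: cont_mul; [apply: cont_mul => //; exact: cont_cst|exact: cont_cst].
Qed.

Lemma pd_pos2_lin i p : pd i (fun x => pos (lin p x) ^+ 2) (fun x => 2 * pos (lin p x) * crd i p.1).
Proof.
apply: (pd_comp (p := fun t => pos t ^+ 2) (p' := fun t => 2 * pos t)) (pd_lin i p) => t.
exact: is_derive_pos2.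
Qed.

Lemma pd_pen i : pd i pen (pen1 i).
Proof.
apply: pdZ; apply: pd_sumseq => p.
apply: (pd_comp (p := fun t => pos t ^+ 3) (p' := fun t => 3 * pos t ^+ 2)) (pd_lin i p) => t.
exact: is_derive_pos3.
Qed.

Lemma pd_pen1 i j : pd j (pen1 i) (pen2 i j).
Proof.
apply: pdZ; apply: pd_sumseq => p.
have h := pdM (pdZ 3 (pd_pos2_lin j p)) (pd_cst j (crd i p.1)).
by apply: (pd_eq h) => x; rewrite mulr0 addr0.
Qed.

(** The Hessian is a nonnegative combination of the squares of the normals. *)
Lemma pen2_ge0 x (xi : 'I_3 -> R) : 0 <= \sum_(i < 3) \sum_(j < 3) pen2 i j x * xi i * xi j.
Proof.
rewrite (_ : \sum_(i < 3) _ = N * \sum_(p <- ls) (3 * (2 * pos (lin p x)) * (\sum_(i < 3) crd i p.1 * xi i) ^+ 2)).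
  apply: mulr_ge0 => //; apply: sumr_ge0 => p _.
  by apply: mulr_ge0; [apply: mulr_ge0 => //; apply: mulr_ge0 => //; exact: pos_ge0|exact: sqr_ge0].
rewrite !sum3 /pen2; elim: ls => [|p s IH]; first by rewrite !big_nil; ring.
rewrite !big_cons !mulrDr !mulrDl.
set A := fun i j => N * \sum_(p <- s) 3 * (2 * pos (lin p x) * crd j p.1) * crd i p.1 in IH *.
rewrite -IH !sum3.
ring.
Qed.

Lemma pen_ge0 x : 0 <= pen x.
Proof. by apply: mulr_ge0 => //; apply: sumr_ge0 => p _; rewrite exprn_ge0 ?pos_ge0. Qed.

Lemma pen_ge p x : p \in ls -> N * pos (lin p x) ^+ 3 <= pen x.
Proof.
move=> pl; apply: ler_wpM2l => //; rewrite (perm_big _ (perm_to_rem pl)) big_cons lerDl.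
by apply: sumr_ge0 => q _; rewrite exprn_ge0 ?pos_ge0.
Qed.

Lemma pen_eq0 x : (forall p, p \in ls -> lin p x <= 0) -> pen x = 0.
Proof.
move=> h; rewrite /pen big_seq big1 ?mulr0// => p /h px.
by rewrite /pos max_l// expr0n.
Qed.
End Penalty.

(** * Smooth cutoffs along half-spaces *)

Section Step.
Variable R : realType.
Local Notation pt := (pt R).
Variable eta : R.
Hypothesis eta0 : 0 < eta.

Definition bump (t : R) : R := flat 1 t.

Lemma bumpE t : bump t = if 0 < t then expR (- t^-1) else 0.
Proof. by rewrite /bump /flat; case: ifP => // _; rewrite hornerC mul1r. Qed.

Lemma le_bump s t : s <= t -> bump s <= bump t.
Proof.
move=> st; rewrite !bumpE; have [s0|s0] := ltP 0 s; last by case: ifP => // _; exact: expR_ge0.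
have t0 := lt_le_trans s0 st.
by rewrite t0 ler_expR lerN2 lef_pV2.
Qed.

(** A composition of bumps rather than the usual quotient, since [Sm] has no quotients. The inner
    bump starts at [eta / 2] and is normalised so that the argument of the outer one reaches 0 at
    [t = eta]. *)
Definition step (t : R) : R := (bump 1)^-1 * bump (1 - (bump (eta / 2))^-1 * bump (t - eta / 2)).

Lemma bump_gt0 t : 0 < t -> 0 < bump t.
Proof. by move=> t0; rewrite bumpE t0 expR_gt0. Qed.

Lemma bump_le0 t : t <= 0 -> bump t = 0.
Proof. by move=> t0; rewrite bumpE ltNge t0. Qed.

Lemma bump_ge0 t : 0 <= bump t.
Proof. by rewrite bumpE; case: ifP => // _; exact: expR_ge0. Qed.

Let e2 : 0 < eta / 2. Proof. by rewrite divr_gt0. Qed.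

Lemma step1 t : t <= eta / 2 -> step t = 1.
Proof.
move=> h; rewrite /step (@bump_le0 (t - _)) ?subr_le0// mulr0 subr0 mulVf//.
exact: lt0r_neq0 (bump_gt0 ltr01).
Qed.

Lemma step0 t : eta <= t -> step t = 0.
Proof.
move=> h; rewrite /step (@bump_le0 (1 - _)) ?mulr0// subr_le0.
rewrite mulrC ler_pdivlMr ?bump_gt0// mul1r; apply: le_bump; lra.
Qed.

Lemma step01 t : 0 <= step t <= 1.
Proof.
rewrite /step mulr_ge0 ?invr_ge0 ?bump_ge0//= mulrC ler_pdivrMr ?bump_gt0// mul1r.
by apply: le_bump; rewrite gerBl mulr_ge0 ?invr_ge0 ?bump_ge0.
Qed.

Definition cutoff (ls : seq (pt * R)) (x : pt) : R := \prod_(p <- ls) step (lin p x).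

Lemma Sm_step (f : pt -> R) : Sm f -> Sm (fun x => step (f x)).
Proof.
move=> sf; apply: Sm_mul; first exact: Sm_cst.
apply: Sm_flat; apply: Sm_add; first exact: Sm_cst.
apply: Sm_opp; apply: Sm_mul; first exact: Sm_cst.
by apply: Sm_flat; apply: Sm_add => //; exact: Sm_cst.
Qed.

Lemma Sm_cutoff ls : Sm (cutoff ls).
Proof.
elim: ls => [|p s IH].
  by rewrite (_ : cutoff _ = fun=> 1); [exact: Sm_cst|apply/funext => x; rewrite /cutoff big_nil].
rewrite (_ : cutoff _ = fun x => step (lin p x) * cutoff s x); last by apply/funext => x; rewrite /cutoff big_cons.
by apply: Sm_mul => //; apply: Sm_step; exact: Sm_lin.
Qed.

Lemma cutoff01 ls x : 0 <= cutoff ls x <= 1.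
Proof.
rewrite /cutoff; elim: ls => [|p s /andP[h1 h2]]; first by rewrite big_nil ler01 lexx.
rewrite big_cons; have /andP[k1 k2] := step01 (lin p x).
by rewrite mulr_ge0//= -[leRHS]mulr1; apply: ler_pM.
Qed.

Lemma cutoff1 ls x : (forall p, p \in ls -> lin p x <= eta / 2) -> cutoff ls x = 1.
Proof. by move=> h; rewrite /cutoff big_seq big1// => p /h /step1. Qed.

Lemma cutoff0 ls x p : p \in ls -> eta <= lin p x -> cutoff ls x = 0.
Proof.
move=> pl h; rewrite /cutoff (perm_big _ (perm_to_rem pl)) big_cons (step0 h); exact: mul0r.
Qed.

Lemma partial_cutoff0 ls x i : (forall p, p \in ls -> lin p x < eta / 2) -> partial i (cutoff ls) x = 0.
Proof.
move=> h; have nr : \forall y \near x, forall p, p \in ls -> lin p y < eta / 2.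
  elim: ls h => [|p s IH] h; first by near=> y.
  have h1 : \forall y \near x, lin p y < eta / 2.
    by have := @cont_lin _ p x; move/cvgr_lt; apply; apply: h; rewrite mem_head.
  have h2 : \forall y \near x, forall p, p \in s -> lin p y < eta / 2.
    by apply: IH => q qs; apply: h; rewrite in_cons qs orbT.
  near=> y => q; rewrite in_cons => /orP[/eqP ->|]; first by near: y.
  by move: q; near: y.
have d0 : is_derive x (ev R i) (fun=> 1 : R) 0 := pd_cst i 1 x.
have d1 : is_derive x (ev R i) (cutoff ls) 0.
  apply: near_eq_is_derive d0; apply: filterS nr => y hy.
  by rewrite cutoff1// => p /hy /ltW.
have d2 := Sm_pdp i (Sm_cutoff ls) x.
by rewrite -(@derive_val _ _ _ _ _ _ _ d2) (@derive_val _ _ _ _ _ _ _ d1).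
Unshelve. all: by end_near.
Qed.
End Step.

Lemma sum3_sqr_le (R : realFieldType) (C s t p0 p1 p2 : R) :
  p0 ^+ 2 * t ^+ 2 <= C * s * t ^+ 2 -> p1 ^+ 2 * t ^+ 2 <= C * s * t ^+ 2 ->
  p2 ^+ 2 * t ^+ 2 <= C * s * t ^+ 2 ->
  - (p0 * t) * - (p0 * t) + - (p1 * t) * - (p1 * t) + - (p2 * t) * - (p2 * t) <= 3 * C * (s * t ^+ 2).
Proof. by move=> h0 h1 h2; lra. Qed.

(** * Truncation by a Hardy inequality *)

Section Truncation.
Variable R : realType.
Local Notation pt := (pt R).
Variable L : R.
Hypothesis L0 : 0 < L.
Local Notation I := (integ (box L)).
Local Notation adm := (adm L).

(* Integration by parts of [pos (lin p x) ^+ 2 * q ^+ 2] along the unit normal of [p]. *)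
Lemma hardy (p : pt * R) (q : pt -> R) : \sum_(i < 3) crd i p.1 ^+ 2 = 1 -> TS L bfull q ->
  I (fun x => pos (lin p x) * q x ^+ 2) <= I (fun x => pos (lin p x) ^+ 3 * dot (grad q) (grad q) x).
Proof.
move=> p1 tq; have sq := TS_Sm tq; have cq := Sm_continuous sq.
have cl := @cont_pos_lin _ p.
have cg i : continuous (partial i q) by apply: Sm_continuous; exact: Sm_partial.
pose G i x := crd i p.1 * ((2 * pos (lin p x) * crd i p.1) * (q x * q x) + pos (lin p x) ^+ 2 * (partial i q x * q x + q x * partial i q x)).
have pG i : pd i (fun x => crd i p.1 * (pos (lin p x) ^+ 2 * (q x * q x))) (G i).
  by apply: pdZ; apply: pdM; [exact: pd_pos2_lin|apply: pdM; exact: Sm_pdp].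
have cG i : continuous (G i).
  have := cg i => h; apply: cont_mul; first exact: cont_cst.
  apply: cont_add; apply: cont_mul.
  - by apply: cont_mul; [apply: cont_mul => //; exact: cont_cst|exact: cont_cst].
  - exact: cont_mul.
  - exact: cont_sqr.
  - by apply: cont_add; exact: cont_mul.
have F0 i x : `|crd i x| = L -> crd i p.1 * (pos (lin p x) ^+ 2 * (q x * q x)) = 0.
  by move=> h; rewrite (TS_face L0 tq _ h)// !mulr0.
have E := integ_div_zero L0 pG cG F0.
have c1 : continuous (fun x => pos (lin p x) * q x ^+ 2) by apply: cont_mul => //; exact: cont_sqr.
have c3 : continuous (fun x => pos (lin p x) ^+ 3 * dot (grad q) (grad q) x).
  apply: cont_mul; last exact: cont_dot.
  rewrite (_ : (fun x => _) = fun x => pos (lin p x) * pos (lin p x) ^+ 2); last by apply/funext => x; rewrite exprS.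
  by apply: cont_mul => //; exact: cont_sqr.
rewrite -[leRHS]addr0 -E -I_D//; last exact: cont_sum3.
apply: le_I => //; first by apply: cont_add => //; exact: cont_sum3.
move=> x _; rewrite /G /dot /grad !sum3; rewrite sum3 in p1.
have l0 := pos_ge0 (lin p x).
move: (partial i0 q x) (partial i1 q x) (partial i2 q x) (q x) (pos (lin p x)) l0 => g0 g1 g2 t l l0.
move: (crd i0 p.1) (crd i1 p.1) (crd i2 p.1) p1 => a0 a1 a2 p1.
clear -p1 l0.
set s := a0 * g0 + a1 * g1 + a2 * g2.
have cs : s ^+ 2 <= g0 * g0 + g1 * g1 + g2 * g2.
  have -> : g0 * g0 + g1 * g1 + g2 * g2 = (a0 ^+ 2 + a1 ^+ 2 + a2 ^+ 2) * (g0 * g0 + g1 * g1 + g2 * g2) by rewrite p1 mul1r.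
  have := sqr_ge0 (a0 * g1 - a1 * g0); have := sqr_ge0 (a0 * g2 - a2 * g0); have := sqr_ge0 (a1 * g2 - a2 * g1).
  by rewrite /s; nra.
have -> : l ^+ 3 * (g0 * g0 + g1 * g1 + g2 * g2) +
  (a0 * (2 * l * a0 * (t * t) + l ^+ 2 * (g0 * t + t * g0)) +
   a1 * (2 * l * a1 * (t * t) + l ^+ 2 * (g1 * t + t * g1)) +
   a2 * (2 * l * a2 * (t * t) + l ^+ 2 * (g2 * t + t * g2))) =
  l ^+ 3 * (g0 * g0 + g1 * g1 + g2 * g2) + 2 * l * t ^+ 2 * (a0 ^+ 2 + a1 ^+ 2 + a2 ^+ 2) + 2 * l ^+ 2 * t * s.
  by rewrite /s; ring.
rewrite p1 mulr1.
have h1 : 0 <= l ^+ 3 * (g0 * g0 + g1 * g1 + g2 * g2 - s ^+ 2) by rewrite mulr_ge0 ?exprn_ge0// subr_ge0.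
have h2 : 0 <= l * (t + l * s) ^+ 2 by rewrite mulr_ge0 ?sqr_ge0.
move: (g0 * g0 + g1 * g1 + g2 * g2) s h1 h2 {cs} => g s h1 h2.
(* With [s] the derivative of [q] along the normal, a completed square and [s^2 <= g] leave a
   nonnegative remainder. *)
have -> : l ^+ 3 * g + 2 * l * t ^+ 2 + 2 * l ^+ 2 * t * s = l * t ^+ 2 + (l ^+ 3 * (g - s ^+ 2) + l * (t + l * s) ^+ 2) by ring.
by rewrite lerDl addr_ge0.
Qed.

Variables (D : set pt) (c l eta : R) (b : pt) (u : vfield R) (ls : seq (pt * R)).
Hypotheses (oD : open D) (D0 : D !=set0) (DL : D `<=` box L) (c0 : 0 <= c) (hp : poincare D c).
Hypotheses (l0 : 0 < l) (l1 : l <= 1) (eta0 : 0 < eta).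
Local Notation W := (dil3 l b @` D).
Hypotheses (WL : W `<=` box L) (WD : W `<=` D) (oW : open W).
Hypothesis ls1 : forall p, p \in ls -> \sum_(i < 3) crd i p.1 ^+ 2 = 1.
Hypothesis lsW : forall p x, p \in ls -> W x -> lin p x <= 0.
Hypothesis lsD : [set x | forall p, p \in ls -> lin p x <= eta] `<=` D.
Hypothesis lsK : compact [set x | forall p, p \in ls -> lin p x <= eta].
Hypothesis tu : test_vfield W u.

Lemma test_fun_cutoff q : Sm q -> test_fun D (fun x => cutoff eta ls x * q x).
Proof.
move=> sq; set f := fun x => _.
have sf : Sm f by apply: Sm_mul => //; exact: Sm_cutoff.
pose K : set pt := [set x | forall p, p \in ls -> lin p x <= eta].
have clK : closed K by apply: compact_closed lsK; exact: norm_hausdorff.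
have fK : closure (Defs.support f) `<=` K.
  rewrite (closure_id K).1//; apply: closureS => x fx p pl.
  rewrite leNgt; apply/negP => h; move: fx; rewrite /Defs.support /= /f.
  by rewrite (cutoff0 eta0 pl (ltW h)) mul0r eqxx.
split; first exact: Sm_smooth.
split; last exact: subset_trans fK lsD.
exact: (subclosed_compact (@closed_closure _ _) lsK fK).
Qed.

(** Where the derivative of the cutoff does not vanish, some [lin p x] is at least [eta / 2]. A
    plain bound on the derivative therefore becomes one by the left weight of [hardy]. *)
Lemma cutoff_partial_bound : exists2 C, 0 <= C & forall x i, box L x ->
  partial i (cutoff eta ls) x ^+ 2 <= C * \sum_(p <- ls) pos (lin p x).
Proof.
have c1 i : continuous (fun x => partial i (cutoff eta ls) x ^+ 2).
  by apply: cont_sqr; apply: Sm_continuous; apply: Sm_partial; exact: Sm_cutoff.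
have /choice[C hC] : forall i, exists C, 0 <= C /\ forall x, cbox L x -> `|partial i (cutoff eta ls) x ^+ 2| <= C.
  by move=> i; have [C C0 h] := continuous_bounded_cbox L (c1 i); exists C.
pose M := C i0 + C i1 + C i2.
have CM i : C i <= M.
  by have := (hC i0).1; have := (hC i1).1; have := (hC i2).1; elim/ord3P: i; rewrite /M; lra.
have M0 : 0 <= M by rewrite !addr_ge0 ?(hC _).1.
exists (M * (2 / eta)); first by rewrite mulr_ge0// divr_ge0// ltW.
move=> x i bx; have S0 : 0 <= \sum_(p <- ls) pos (lin p x) by apply: sumr_ge0 => p _; exact: pos_ge0.
have [hall|] := pselect (forall p, p \in ls -> lin p x < eta / 2).
  by rewrite partial_cutoff0// expr0n /= mulr_ge0// mulr_ge0// divr_ge0// ltW.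
move=> /existsNP[p] /not_implyP[pl /negP]; rewrite -leNgt => hpx.
have h1 : 1 <= 2 / eta * \sum_(p <- ls) pos (lin p x).
  have : eta / 2 <= \sum_(p <- ls) pos (lin p x).
    rewrite (perm_big _ (perm_to_rem pl)) big_cons; apply: le_trans hpx _.
    apply: (@le_trans _ _ (pos (lin p x))); first by rewrite /pos le_max lexx orbT.
    by rewrite lerDl; apply: sumr_ge0 => r _; exact: pos_ge0.
  by rewrite mulrAC ler_pdivlMr// mul1r ler_pdivrMr// mulrC.
apply: le_trans (ler_norm _) _; apply: le_trans ((hC i).2 x (box_cbox bx)) _.
apply: le_trans (CM i) _; rewrite -[leLHS]mulr1 -mulrA; exact: ler_wpM2l.
Qed.

Theorem compact_gradient_approx (d : R) : 0 < d -> exists2 f, test_fun D f &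
  Num.sqrt (vnrm2 D (fun i x => u i x - grad f i x)) <= c * Num.sqrt (vnrm2 D (rot u)) + d.
Proof.
move=> d0; have bQ := box_bdm L; have mQ := bQ.1.
have mD : mbl3 D := open_measurable3 oD.
have tr := test_vfield_rot tu.
have su i := smooth_pd (tu i).1.
have cu i : continuous (u i) by have [] := su i.
have zu i x : ~ W x -> u i x = 0.
  by move=> nW; exact: (notin_closure_support (fun h => nW ((tu i).2.2 _ h))).1.
have rotE : vnrm2 D (rot u) = vnrm2 (box L) (rot u).
  apply: (integ_supp mQ mD DL) => x nD; rewrite /dot big1// => i _.
  by rewrite (notin_closure_support (fun h => nD (WD ((tr i).2.2 _ h)))).1 mul0r.
set A := Num.sqrt (vnrm2 D (rot u)).
have d2 : 0 < d / 2 by rewrite divr_gt0.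
pose M := c * A + d / 2.
have M0 : 0 <= M by rewrite addr_ge0 ?mulr_ge0 ?sqrtr_ge0// ltW.
have [C C0 hC] := cutoff_partial_bound.
(* The cutoff error has three components, and each half-space contributes at most [C * M^2 / N] to
   each; [N] is then chosen so that [S / N] is at most [(d / 2)^2]. *)
pose S := 3 * C * (size ls)%:R * M ^+ 2.
have S0 : 0 <= S by rewrite !mulr_ge0 ?sqr_ge0.
pose N := S / (d / 2) ^+ 2 + 1.
have dd : 0 < (d / 2) ^+ 2 by rewrite exprn_gt0.
have N0 : 0 < N by rewrite ltr_wpDl// divr_ge0// ltW.
have SN : S / N <= (d / 2) ^+ 2.
  by rewrite ler_pdivrMr// /N mulrDr mulr1 mulrC divfK ?lerDl ?ltW// lt0r_neq0.
have VW x : W x -> pen ls N x = 0.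
  by move=> Wx; apply: pen_eq0 => p pl; exact: lsW.
have [q tq hq] := weighted_gradient_approx L0 (@cont_pen _ ls N) (@cont_pen1 _ ls N) (@cont_pen2 _ ls N)
   (@pd_pen _ ls N) (@pd_pen1 _ ls N) (pen2_ge0 ls (ltW N0)) (pen_ge0 ls (ltW N0)) oD D0 DL c0 hp l0 l1 WL oW VW tu d2.
rewrite -rotE -/A -/M in hq.
have sq := TS_Sm tq; have cq := Sm_continuous sq.
have cg i : continuous (grad q i) by apply: Sm_continuous; exact: Sm_partial.
pose e : vfield R := fun i x => u i x - grad q i x.
have ce i : continuous (e i) by have := cu i; have := cg i => h1 h2; apply: cont_add => //; exact: cont_opp.
have cV := @cont_pen _ ls N.
have cVe : continuous (fun x => expR (pen ls N x) * dot e e x).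
  by apply: cont_mul; [exact: cont_expR|exact: cont_dot].
have cl3 p : continuous (fun x => pos (lin p x) ^+ 3 * dot (grad q) (grad q) x).
  apply: cont_mul; last exact: cont_dot.
  rewrite (_ : (fun x => _) = fun x => pos (lin p x) * pos (lin p x) ^+ 2); last by apply/funext => x; rewrite exprS.
  have cp := @cont_pos_lin _ p; by apply: cont_mul => //; exact: cont_sqr.
(* Where [lin p] is positive the point lies off [W], so [u = 0] there and [|grad q|] is what [hq]
   controls; moreover [N * pos^3 <= pen <= expR pen]. *)
have hardy_ls p : p \in ls -> I (fun x => pos (lin p x) * q x ^+ 2) <= M ^+ 2 / N.
  move=> pl; apply: le_trans (hardy (ls1 pl) tq) _.
  rewrite ler_pdivlMr// mulrC -I_Z//; apply: le_trans hq.
  apply: le_I => //; first by apply: cont_mul => //; exact: cont_cst.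
  move=> x _; rewrite mulrA.
  have [lx|lx] := leP (lin p x) 0.
    by rewrite /pos max_l// expr0n /= mulr0 mul0r mulr_ge0 ?expR_ge0 ?dot_ge0.
  have nW : ~ W x by move/(lsW pl); rewrite leNgt lx.
  have -> : dot (grad q) (grad q) x = dot (fun i x => u i x - grad q i x) (fun i x => u i x - grad q i x) x.
    by rewrite /dot; apply: eq_bigr => i _; rewrite zu// sub0r mulrNN.
  apply: ler_wpM2r; first exact: dot_ge0.
  apply: le_trans (pen_ge (ltW N0) x pl) _; apply: le_trans (expR_ge1Dx _); lra.
pose chi := cutoff eta ls; have sc : Sm chi := Sm_cutoff eta ls.
(* As [chi = 1] on [W], which carries [u], the error is [chi (u - grad q) - q grad chi]; these are
   [f1] and [f2]. *)
exists (fun x => chi x * q x); first exact: test_fun_cutoff.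
have pf i : partial i (fun x => chi x * q x) = fun x => partial i chi x * q x + chi x * partial i q x.
  exact: pd_partial (pdM (Sm_pdp i sc) (Sm_pdp i sq)).
pose f1 : vfield R := fun i x => chi x * e i x.
pose f2 : vfield R := fun i x => - (partial i chi x * q x).
have cchi : continuous chi := Sm_continuous sc.
have cdchi i : continuous (partial i chi) by apply: Sm_continuous; exact: Sm_partial.
have cf1 i : continuous (f1 i) by have := ce i => h; exact: cont_mul.
have cf2 i : continuous (f2 i) by apply: cont_opp; exact: cont_mul.
have tf := test_fun_cutoff sq.
have -> : vnrm2 D (fun i x => u i x - grad (fun x => chi x * q x) i x) = vnrm2 (box L) (fun i x => f1 i x + f2 i x).
  rewrite /vnrm2 (integ_supp mQ mD DL); last first.
    move=> x nD; rewrite /dot big1// => i _; rewrite zu; last by move/WD.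
    by rewrite /grad (notin_closure_support (fun h => nD (tf.2.2 _ h))).2 subrr mul0r.
  apply: eq_integ => x _; rewrite /dot; apply: eq_bigr => i _.
  have -> : u i x - grad (fun x => chi x * q x) i x = f1 i x + f2 i x; last by [].
  rewrite /grad pf /f1 /f2 /e /grad.
  have E : u i x = chi x * u i x.
    have [Wx|nW] := pselect (W x); last by rewrite zu// mulr0.
    by rewrite /chi cutoff1 ?mul1r// => p pl; apply: (le_trans (lsW pl Wx)); rewrite divr_ge0// ltW.
  rewrite {1}E; move: (partial i q x) (partial i chi x) => *; ring.
apply: le_trans (vnormD mQ (continuous_vL2 bQ cf1) (continuous_vL2 bQ cf2)) _.
rewrite (_ : c * A + d = M + d / 2); last by rewrite /M; field.
apply: lerD.
  rewrite -[leRHS]ger0_norm// -sqrtr_sqr ler_wsqrtr//.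
  apply: le_trans hq; apply: le_I => //; first exact: cont_dot.
  move=> x _; have -> : dot f1 f1 x = chi x ^+ 2 * dot e e x.
    by rewrite /dot /f1 !sum3; move: (e i0 x) (e i1 x) (e i2 x) => *; ring.
  apply: ler_wpM2r; first exact: dot_ge0.
  apply: (@le_trans _ _ 1); first by have := cutoff01 eta ls x; rewrite -/chi; nra.
  by rewrite -expR0 ler_expR; exact: pen_ge0 (ltW N0) x.
rewrite -[leRHS](ger0_norm (ltW d2)) -sqrtr_sqr ler_wsqrtr//.
apply: le_trans SN.
have cpq p : continuous (fun x => pos (lin p x) * q x ^+ 2).
  by have cp := @cont_pos_lin _ p; apply: cont_mul => //; exact: cont_sqr.
apply: (@le_trans _ _ (3 * C * I (fun x => \sum_(p <- ls) pos (lin p x) * q x ^+ 2))).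
  rewrite /vnrm2 -I_Z; last exact: cont_sumseq.
  apply: le_I; [exact: cont_dot|by apply: cont_mul; [exact: cont_cst|exact: cont_sumseq]|].
  move=> x bx; rewrite -mulr_suml /dot /f2 !sum3.
  have q2 := sqr_ge0 (q x).
  have h i : partial i chi x ^+ 2 * q x ^+ 2 <= C * (\sum_(p <- ls) pos (lin p x)) * q x ^+ 2.
    by apply: ler_wpM2r => //; exact: hC.
  exact: sum3_sqr_le (h i0) (h i1) (h i2).
have -> : S / N = 3 * C * ((size ls)%:R * (M ^+ 2 / N)) by rewrite /S !mulrA.
apply: ler_wpM2l; first by rewrite mulr_ge0.
suff : forall s, {subset s <= ls} -> I (fun x => \sum_(p <- s) pos (lin p x) * q x ^+ 2) <= (size s)%:R * (M ^+ 2 / N).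
  by apply.
elim=> [|p s IH] sub.
  by rewrite (_ : (fun x => _) = fun=> 0) ?integ0 ?mul0r//; apply/funext => x; rewrite big_nil.
rewrite (_ : (fun x => _) = fun x => pos (lin p x) * q x ^+ 2 + \sum_(r <- s) pos (lin r x) * q x ^+ 2); last first.
  by apply/funext => x; rewrite big_cons.
rewrite I_D//; last exact: cont_sumseq.
rewrite /= -natr1 mulrDl mul1r addrC; apply: lerD.
  by apply: IH => r rs; apply: sub; rewrite in_cons rs orbT.
by apply: hardy_ls; apply: sub; rewrite mem_head.
Qed.
End Truncation.

(** * Convex domains *)

Section ConvexGeometry.
Variable R : realType.
Local Notation pt := (pt R).

Definition ip (x y : pt) : R := \sum_(i < 3) crd i x * crd i y.

Lemma ip_ge0 x : 0 <= ip x x.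
Proof. by apply: sumr_ge0 => i _; rewrite -expr2 sqr_ge0. Qed.

Lemma ip_eq0 x : ip x x = 0 -> x = 0.
Proof.
move=> h; apply: pt_ext => i; move/eqP: h; rewrite /ip psumr_eq0; last by move=> j _; rewrite -expr2 sqr_ge0.
move=> /allP /(_ i); rewrite mem_index_enum => /(_ isT); rewrite -expr2 sqrf_eq0 => /eqP ->.
by elim/ord3P: i.
Qed.

Lemma closure_ball (A : set pt) x (e : R) : closure A x -> 0 < e -> exists2 y, A y & ball x e y.
Proof. by move=> cA e0; have [y [Ay By]] := cA _ (nbhsx_ballx x e e0); exists y. Qed.

Lemma ball_ptP (x y : pt) e : ball x e y <-> forall i, `|crd i x - crd i y| < e.
Proof.
split; first by move=> [[h0 h1] h2]; elim/ord3P; [exact: h0|exact: h1|exact: h2].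
by move=> h; split; [split; [exact: (h i0)|exact: (h i1)]|exact: (h i2)].
Qed.

Lemma compact_finite_cover (T : eqType) (K : set pt) (P : set T) (U : T -> set pt) : compact K ->
  (forall p, P p -> open (U p)) -> (forall x, K x -> exists2 p, P p & U p x) ->
  exists s : seq T, (forall p, p \in s -> P p) /\ forall x, K x -> exists2 p, p \in s & U p x.
Proof.
move=> /compact_near_coveringP ncK oU KU.
(* The filter of properties that hold for all finite families from [P] containing some fixed one;
   along it, near-covering compactness yields a finite subcover. *)
pose F (A : set (seq T)) : Prop := exists s0 : seq T, (forall p, p \in s0 -> P p) /\
  forall s : seq T, (forall p, p \in s -> P p) -> {subset s0 <= s} -> A s.
have FF : Filter F.
  split; first by exists [::].
  - move=> A B [a [aP hA]] [b [bP hB]]; exists (a ++ b); split.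
      by move=> p; rewrite mem_cat => /orP[/aP|/bP].
    move=> s sP sub; split; [apply: hA => //|apply: hB => //] => p ps; apply: sub; rewrite mem_cat ps ?orbT//.
  - by move=> A B AB [a [aP hA]]; exists a; split=> // s sP /(hA s sP)/AB.
have : F [set s : seq T | K `<=` [set x : pt | exists2 p : T, p \in s & U p x]].
  apply: (ncK (seq T) F (fun (s : seq T) x => exists2 p : T, p \in s & U p x)) => x Kx; have [p Pp Ux] := KU x Kx.
  exists (U p, [set s : seq T | p \in s]); last by move=> [y s] [/= Uy ps]; exists p.
  split => /=; first exact: open_nbhs_nbhs (conj (oU p Pp) Ux).
  exists [:: p]; split; first by move=> r; rewrite inE => /eqP ->.
  by move=> s _; apply; rewrite inE.
move=> [s [sP hs]]; exists s; split=> // x Kx; exact: (hs s sP _ x Kx).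
Qed.

Variables (D : set pt) (oD : open D) (cD : convex_set3 D).
Variables (x0 : pt) (Dx0 : D x0) (l : R) (l0 : 0 < l) (l1 : l < 1).
Local Notation b := ((1 - l) *: x0).
Local Notation W := (dil3 l b @` D).

Lemma dil_subset : W `<=` D.
Proof.
by move=> _ [x Dx <-]; rewrite dil3E; apply: cD => //; rewrite (ltW l0) (ltW l1).
Qed.

Lemma dil_imageE x : W x <-> D (l^-1 *: (x - b)).
Proof.
split; first by move=> [y Dy <-]; rewrite dil3E addrK scalerA mulVf ?scale1r// lt0r_neq0.
move=> h; exists (l^-1 *: (x - b)) => //.
by rewrite dil3E scalerA divff ?scale1r ?subrK// lt0r_neq0.
Qed.

Lemma dil_open : open W.
Proof.
rewrite (_ : W = (fun x => l^-1 *: (x - b)) @^-1` D); last by apply/seteqP; split=> x /dil_imageE.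
apply: open_comp => // x _.
by apply: cvgZ; [exact: cvg_cst|apply: cvgB; [exact: cvg_id|exact: cvg_cst]].
Qed.

Lemma dil_convex x y (t : R) : W x -> W y -> 0 <= t <= 1 -> W (t *: x + (1 - t) *: y).
Proof.
move=> [x' Dx <-] [y' Dy <-] t01; exists (t *: x' + (1 - t) *: y'); first exact: cD.
by rewrite !dil3E; apply: pt_ext => i; rewrite !(crdD, crdZ, crdB); ring.
Qed.

(** A point [z] of the closure is closer than [(1 - l) * r] to some [l *: x + b] with [x] in [D].
    The difference, divided by [1 - l], moves [x0] only within its ball in [D], so [z] is again a
    convex combination of points of [D]. *)
Lemma closure_dil_subset : closure W `<=` D.
Proof.
move=> z cz; have /nbhs_ballP[r /= r0 rD] := open_nbhs_nbhs (conj oD Dx0).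
have l10 : 0 < 1 - l by rewrite subr_gt0.
have [w [x Dx <-] zw] := closure_ball cz (mulr_gt0 l10 r0).
have -> : z = l *: x + (1 - l) *: (x0 + (1 - l)^-1 *: (z - (l *: x + b))).
  apply: pt_ext => i; rewrite !(crdD, crdZ, crdB, crdN); field; exact: lt0r_neq0.
apply: cD => //; last by rewrite (ltW l0) (ltW l1).
apply: rD; apply/ball_ptP => i; have /ball_ptP/(_ i) := zw; rewrite dil3E !(crdD, crdZ, crdB, crdN) => h.
by rewrite opprD addNKr normrN normrM normfV (gtr0_norm l10) mulrC ltr_pdivrMr// [r * _]mulrC.
Qed.

Lemma closure_dil_segment z w (t : R) : closure W z -> W w -> 0 <= t <= 1 -> closure W ((1 - t) *: z + t *: w).
Proof.
move=> cz Ww /andP[t0 t1] B /nbhs_ballP[e /= e0 eB].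
have [y Wy zy] := closure_ball cz e0.
exists ((1 - t) *: y + t *: w); split.
  by have := dil_convex (t := 1 - t) Wy Ww; rewrite subKr; apply; rewrite subr_ge0 t1/= gerBl.
apply: eB; apply/ball_ptP => i; have /ball_ptP/(_ i) h := zy.
rewrite !(crdD, crdZ) (_ : _ - _ = (1 - t) * (crd i z - crd i y)); last by ring.
have t10 : 0 <= 1 - t by rewrite subr_ge0.
rewrite normrM (ger0_norm t10); apply: le_lt_trans h; rewrite ler_piMl//; lra.
Qed.

Variables (L : R) (DL : D `<=` cbox L).

Lemma closure_dil_compact : compact (closure W).
Proof.
apply: (subclosed_compact (@closed_closure _ _) (@cbox_compact _ L)).
by apply: subset_trans DL; exact: closure_dil_subset.
Qed.

(** Project [y] onto the compact convex closure of [W], which lies in [D]; the unit vector from the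
    projection [z] to [y] is the normal. *)
Lemma separation y : ~ D y -> exists p : pt * R, [/\ ip p.1 p.1 = 1,
  forall x, W x -> lin p x <= 0 & 0 < lin p y].
Proof.
move=> nDy; pose f z := ip (y - z) (y - z).
have cf : continuous f.
  rewrite (_ : f = fun z => \sum_(i < 3) (crd i y - crd i z) ^+ 2).
    apply: cont_sum3 => i; apply: cont_sqr; apply: cont_add; first exact: cont_cst.
    by apply: cont_opp; exact: crd_continuous.
  by apply/funext => z; rewrite /f /ip; apply: eq_bigr => i _; rewrite crdB expr2.
have Wn : closure W !=set0 by exists (dil3 l b x0); apply: subset_closure; exists x0.
have [z zW hz] := compact_EVT_min Wn closure_dil_compact (continuous_subspaceT cf).
move: zW; rewrite inE => zW.
pose a := y - z.
have a0 : 0 < ip a a.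
  rewrite lt_neqAle ip_ge0 andbT; apply/eqP => /esym /ip_eq0 /subr0_eq E.
  by apply: nDy; rewrite E; exact: closure_dil_subset.
have key w : W w -> ip a (w - z) <= 0.
  move=> Ww; rewrite leNgt; apply/negP => k0.
  pose K := ip (w - z) (w - z); have K0 : 0 <= K := ip_ge0 _.
  have main (t : R) : 0 < t -> t <= 1 -> 2 * ip a (w - z) <= t * K.
    move=> t0 t1; have t01 : 0 <= t <= 1 by rewrite ltW.
    have : (1 - t) *: z + t *: w \in closure W by rewrite inE; exact: closure_dil_segment.
    move=> /hz; rewrite /f.
    have -> : ip (y - ((1 - t) *: z + t *: w)) (y - ((1 - t) *: z + t *: w)) =
      ip (y - z) (y - z) - t * (2 * ip a (w - z) - t * K).
      by rewrite /K /ip /a !sum3 !(crdB, crdD, crdZ, crdN); ring.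
    by rewrite lerBrDr gerDl pmulr_rle0// subr_le0.
  (* Minimality along the segment from [z] to [w] is contradicted at [t = 1] if [K] is small, and
     otherwise at the quotient of [ip a (w - z)] by [K]. *)
  have [h|h] := leP K (ip a (w - z)).
    by have := main 1 ltr01 (lexx _); lra.
  have Kp : 0 < K by exact: lt_trans k0 h.
  have := main (ip a (w - z) / K) (divr_gt0 k0 Kp).
  rewrite ler_pdivrMr// mul1r => /(_ (ltW h)); rewrite divfK ?gt_eqF//; lra.
pose n := Num.sqrt (ip a a); have n0 : 0 < n by rewrite sqrtr_gt0.
have n2 : n ^+ 2 = ip a a by rewrite sqr_sqrtr// ltW.
exists (n^-1 *: a, n^-1 * ip a z); split.
- rewrite (_ : ip _ _ = n^-1 ^+ 2 * ip a a); last by rewrite /ip !sum3 !crdZ; ring.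
  by rewrite -n2 exprVn mulVf// lt0r_neq0// exprn_gt0.
- move=> x Wx; rewrite (_ : lin _ _ = n^-1 * ip a (x - z)); first by rewrite pmulr_rle0 ?invr_gt0//; exact: key.
  by rewrite /lin /ip !sum3 /= !(crdB, crdZ, crdD, crdN); ring.
- rewrite (_ : lin _ _ = n^-1 * ip a a); first by rewrite mulr_gt0 ?invr_gt0.
  by rewrite /lin /ip /= !sum3 !crdZ /a !crdB; ring.
Qed.

(** By compactness, finitely many half-spaces exclude all points of the larger cube outside [D]. The
    sum of their positive parts has a positive minimum there, which provides the margin [eta]. The
    enlargement to [L + 1] leaves room for the faces of a bounding cube. *)
Lemma finite_separation : exists (ls : seq (pt * R)) (eta : R), [/\ 0 < eta,
  forall p, p \in ls -> ip p.1 p.1 = 1,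
  forall p x, p \in ls -> W x -> lin p x <= 0 &
  [set x | cbox (L + 1) x /\ forall p, p \in ls -> lin p x <= eta] `<=` D].
Proof.
pose K := cbox (L + 1) `&` ~` D.
have cK : compact K by apply: compact_closedI; [exact: cbox_compact|exact: open_closedC].
pose P : set (pt * R) := [set p | ip p.1 p.1 = 1 /\ forall x, W x -> lin p x <= 0].
pose U (p : pt * R) : set pt := [set x | 0 < lin p x].
have oU p : P p -> open (U p).
  move=> _; rewrite (_ : U p = lin p @^-1` [set t | 0 < t])//.
  by apply: open_comp; [move=> x _; exact: cont_lin|exact: open_gt].
have KU y : K y -> exists2 p, P p & U p y.
  by move=> [_ /separation[p [h1 h2 h3]]]; exists p.
have [F [FP KF]] := compact_finite_cover cK oU KU.
pose g x := \sum_(p <- F) pos (lin p x).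
have cg : continuous g by apply: cont_sumseq => p; exact: cont_pos_lin.
have [Kn|/set0P Kn] := eqVneq K set0.
  exists [::], 1; split=> // x [bx _]; apply: contrapT => nD.
  by have : K x by []; rewrite Kn.
have [m mK hm] := compact_EVT_min Kn cK (continuous_subspaceT cg).
move: mK; rewrite inE => mK.
have g0 : 0 < g m.
  have [p /= pF pm] := KF _ mK.
  rewrite /g (perm_big _ (perm_to_rem pF)) big_cons ltr_pwDl//; first by rewrite /pos lt_max pm orbT.
  by apply: sumr_ge0 => q _; exact: pos_ge0.
(* The successor makes the last comparison strict. *)
pose s : R := (size F).+1%:R; have s0 : 0 < s by rewrite ltr0Sn.
exists F, (g m / s); split.
- by rewrite divr_gt0.
- by move=> p /FP[].
- by move=> p x /FP[_]; apply.
move=> x [bx hx]; apply: contrapT => nD.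
have := hm x; rewrite inE => /(_ (conj bx nD)); apply/negP; rewrite -ltNge.
apply: (@le_lt_trans _ _ (\sum_(p <- F) g m / s)).
  rewrite /g big_seq [leRHS]big_seq; apply: ler_sum => p pF.
  by rewrite /pos ge_max hx// andbT divr_ge0// ltW.
rewrite big_const_seq count_predT iter_addr addr0 -mulr_natr.
by rewrite mulrAC ltr_pdivrMr// ltr_pM2l// /s ltr_nat.
Qed.
End ConvexGeometry.

Section GradientApproximationConvex.
Variable R : realType.
Local Notation pt := (pt R).

(** The inverse dilation is jointly continuous in the point and the factor and is the identity at
    factor 1; compactness of [K] makes the choice of the factor uniform. *)
Lemma dil_absorbs (D K : set pt) x0 : open D -> compact K -> K `<=` D ->
  exists l : R, [/\ 0 < l, l < 1 & K `<=` dil3 l ((1 - l) *: x0) @` D].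
Proof.
move=> oD /compact_near_coveringP ncK KD.
pose P (l : R) (x : pt) := D (l^-1 *: (x - (1 - l) *: x0)).
have : \forall t \near (1 : R)^'-, K `<=` P t.
  apply: (ncK R ((1 : R)^'-) P) => x Kx.
  pose f (q : pt * R) : pt := q.2^-1 *: (q.1 - (1 - q.2) *: x0).
  have fc : {for ((x, 1) : pt * R), continuous f}.
    rewrite /f /continuous_at; apply: cvgZ; last apply: cvgB.
    - apply: cvgV; first exact: oner_neq0.
      exact: cvg_snd.
    - exact: cvg_fst.
    - by apply: cvgZ; [apply: cvgB; [exact: cvg_cst|exact: cvg_snd]|exact: cvg_cst].
  have : nbhs (f (x, 1)) D.
    rewrite /f /= invr1 scale1r subrr scale0r subr0; exact: open_nbhs_nbhs (conj oD (KD _ Kx)).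
  move=> /fc [[A B] [/= nA nB] AB].
  exists (A, [set t | B t]); first by split => //=; exact: cvg_at_left_filter (@cvg_id _ _) _ nB.
  by move=> [y t] [/= Ay Bt]; exact: (AB (y, t)).
move=> h; have : \forall t \near (1 : R)^'-, [/\ 0 < t, t < 1 & K `<=` P t].
  near=> t; split; near: t => //.
  - exact: nbhs_left_gt.
  - exact: nbhs_left_lt.
move=> /filter_ex[t [t0 t1 tK]]; exists t; split=> // x /tK.
by move=> Dx; apply/(dil_imageE D x0 t0).
Unshelve. all: by end_near.
Qed.

Definition face (i : 'I_3) (s M : R) : pt * R := (mk3 (fun j => if j == i then s else 0), M).

Lemma lin_face i s M x : lin (face i s M) x = s * crd i x - M.
Proof.
rewrite /lin /face /= sum3 !crd_mk3; elim/ord3P: i; rewrite !eqxx ?eqI3; ring.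
Qed.

Lemma ip_face i s M : ip (face i s M).1 (face i s M).1 = s ^+ 2.
Proof. by rewrite /ip /face /= sum3 !crd_mk3; elim/ord3P: i; rewrite !eqxx ?eqI3; ring. Qed.

Lemma bounded_set_cbox (D : set pt) : bounded_set D -> exists2 M : R, 0 < M & D `<=` cbox M.
Proof.
case=> N [_ hN]; exists (`|N| + 1); first by rewrite ltr_wpDl.
move=> x Dx i; rewrite -ler_norml; apply: le_trans (crd_le_norm x i) _.
by apply: (hN (`|N| + 1)) => //; rewrite (le_lt_trans (ler_norm N))// ltrDl.
Qed.

Theorem gradient_approx_convex (D : set pt) (c d : R) (u : vfield R) :
  open D -> D !=set0 -> bounded_set D -> convex_set3 D -> 0 <= c -> poincare D c ->
  test_vfield D u -> 0 < d ->
  exists2 f, test_fun D f &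
    Num.sqrt (vnrm2 D (fun i x => u i x - grad f i x)) <= c * Num.sqrt (vnrm2 D (rot u)) + d.
Proof.
move=> oD [x0 Dx0] bD cD c0 hp tu d0.
have [M M0 DM] := bounded_set_cbox bD.
pose K := closure (Defs.support (u i0)) `|` closure (Defs.support (u i1)) `|` closure (Defs.support (u i2)).
have cK : compact K by apply: compactU; [apply: compactU|]; exact: (tu _).2.1.
have KD : K `<=` D by move=> x [[|]|]; exact: (tu _).2.2.
have [l [l0 l1 KW]] := dil_absorbs x0 oD cK KD.
set b := (1 - l) *: x0 in KW.
have WD : dil3 l b @` D `<=` D := dil_subset cD Dx0 l0 l1.
have oW : open (dil3 l b @` D) := dil_open oD l0.
have tuW : test_vfield (dil3 l b @` D) u.
  move=> i; have [h1 [h2 h3]] := tu i; split=> //; split=> // x hx; apply: KW.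
  by elim/ord3P: i h1 h2 h3 hx => _ _ _ hx; [left; left|left; right|right].
have [ls [eta [eta0 ls1 lsW lsD]]] := finite_separation oD cD Dx0 l0 l1 DM.
pose L := M + 2; have L0 : 0 < L by rewrite ltr_wpDl// ltW.
(* The six half-spaces of a cube around [D] are added so that the polytope becomes bounded, hence
   compact. *)
pose fs := [seq face i s M | i <- enum 'I_3, s <- [:: 1; -1]].
have fsE p : p \in fs -> exists i s, p = face i s M /\ (s = 1 \/ s = -1).
  move=> /allpairsP[[i s] /= [_ hs ->]]; exists i, s; split=> //.
  by move: hs; rewrite !inE => /orP[/eqP ->|/eqP ->]; [left|right].
have fsI i s : (s = 1 \/ s = -1) -> face i s M \in fs.
  move=> hs; apply/allpairsP; exists (i, s); split=> //=; first by rewrite mem_enum.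
  by case: hs => ->; rewrite !inE eqxx ?orbT.
(* At most 1 to remain in [cbox (M + 1)], at most [eta] to remain in [D]. *)
pose e := Num.min eta 1.
have e0 : 0 < e by rewrite lt_min eta0 ltr01.
pose KK : set pt := [set x | forall p, p \in ls ++ fs -> lin p x <= e].
have KKb : KK `<=` cbox (M + 1).
  move=> x hx i.
  have h1 : lin (face i 1 M) x <= e by apply: hx; rewrite mem_cat fsI ?orbT//; left.
  have h2 : lin (face i (-1) M) x <= e by apply: hx; rewrite mem_cat fsI ?orbT//; right.
  have e1 : e <= 1 by rewrite ge_min lexx orbT.
  by move: h1 h2; rewrite !lin_face; lra.
have KKD : KK `<=` D.
  move=> x hx; apply: lsD; split; first exact: KKb.
  move=> p pl; have : lin p x <= e by apply: hx; rewrite mem_cat pl.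
  by move/le_trans; apply; rewrite ge_min lexx.
have KKc : compact KK.
  apply: subclosed_compact (@cbox_compact _ (M + 1)) KKb.
  rewrite (_ : KK = \bigcap_(p in [set p | p \in ls ++ fs]) (lin p @^-1` [set t | t <= e])); last first.
    by apply/seteqP; split=> x h p; exact: h.
  apply: closed_bigI => p _; apply: preimage_closed; last exact: closed_le.
  by move=> x _; exact: cont_lin.
have DL : D `<=` box L.
  by move=> x /DM h i; have := h i; rewrite /L; lra.
apply: (compact_gradient_approx L0 oD _ DL c0 hp l0 (ltW l1) e0 _ WD oW _ _ KKD KKc tuW d0).
- by exists x0.
- exact: subset_trans WD DL.
- move=> p; rewrite mem_cat => /orP[/ls1|/fsE[i [s [-> hs]]]].
    by move=> <-; apply: eq_bigr => i _; rewrite expr2.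
  transitivity (ip (face i s M).1 (face i s M).1); first by apply: eq_bigr => j _; rewrite expr2.
  by rewrite ip_face; case: hs => ->; rewrite ?expr1n ?sqrrN ?expr1n.
- move=> p x; rewrite mem_cat => /orP[/lsW h Wx|/fsE[i [s [-> hs]]] /WD /DM /(_ i)].
    exact: h.
  by rewrite lin_face; case: hs => ->; lra.
Qed.
End GradientApproximationConvex.

(** * The Maxwell estimate *)

Section MaxwellEstimate.
Variable R : realType.
Local Notation mR := (measurableTypeR R).
Local Notation mpt := ((mR * mR) * mR)%type.
Local Notation pt := (pt R).

Lemma le_addMgt0 (x a c : R) : 0 <= c -> (forall d, 0 < d -> x <= a + c * d) -> x <= a.
Proof.
move=> c0 h; apply/ler_addgt0Pr => e e0; have c1 : 0 < c + 1 by rewrite ltr_wpDl.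
have /h/le_trans : 0 < e / (c + 1) by rewrite divr_gt0.
by apply; rewrite lerD2l mulrCA ler_piMr// ?(ltW e0)// ler_pdivrMr// mul1r lerDl.
Qed.

Lemma vnrm2N (D : set pt) (u v : vfield R) :
  vnrm2 D (fun i x => u i x - v i x) = vnrm2 D (fun i x => v i x - u i x).
Proof. by apply: eq_integ => x _; apply: eq_bigr => i _; rewrite -mulrNN !opprB. Qed.

Lemma vnorm_cvg0 (D : set pt) (w : nat -> vfield R) (d : R) :
  (fun n => vnrm2 D (w n)) @ \oo --> 0 -> 0 < d ->
  \forall n \near \oo, Num.sqrt (vnrm2 D (w n)) <= d.
Proof.
move=> /cvgrPdist_le h d0; near=> n.
rewrite -(ger0_norm (ltW d0)) -sqrtr_sqr ler_wsqrtr//.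
have : `|0 - vnrm2 D (w n)| <= d ^+ 2 by near: n; apply: h; rewrite exprn_gt0.
by rewrite sub0r normrN; apply: le_trans; exact: ler_norm.
Unshelve. all: by end_near.
Qed.

Lemma integ_dotBr (D : set pt) (u v w : vfield R) : mbl3 D -> vL2 D u -> vL2 D v -> vL2 D w ->
  integ D (dot u (fun i x => v i x - w i x)) = integ D (dot u v) - integ D (dot u w).
Proof.
move=> mD hu hv hw; rewrite -(integB mD (vL2_itg mD hu hv) (vL2_itg mD hu hw)).
by apply: eq_integ => x _; rewrite /dot !sum3; ring.
Qed.

Variables (D : set pt) (oD : open D) (M : R) (M0 : 0 < M) (DM : D `<=` box M).

Let bD : bdm D.
Proof. by split; [exact: open_measurable3|exists M; exact: subset_trans (@box_cbox _ _)]. Qed.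
Let mD : mbl3 D := bD.1.

Lemma test_fun_L2 f : test_fun D f -> L2 D f.
Proof. by move=> [/smooth_pd[cf _ _] _]; exact: continuous_L2. Qed.

Lemma test_fun_vL2_grad f : test_fun D f -> vL2 D (grad f).
Proof. by move=> tf i; apply: test_fun_L2; exact: test_fun_partial. Qed.

Lemma test_fun_H10 f : test_fun D f -> H10 D f (grad f).
Proof.
move=> tf; have [cf pf cpf] := smooth_pd tf.1; split.
  split; first exact: test_fun_L2.
  by split; [exact: test_fun_vL2_grad|exact: (weak_grad_pd M0)].
exists (fun=> f); split=> //; split.
- rewrite (_ : (fun=> _) = fun=> 0); first exact: cvg_cst.
  apply/funext => n; rewrite /nrm2 -(integ0 D); apply: eq_integ => x _.
  by rewrite /= subrr expr0n.
- rewrite (_ : (fun=> _) = fun=> 0); first exact: cvg_cst.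
  apply/funext => n; rewrite /vnrm2 -(integ0 D); apply: eq_integ => x _.
  by rewrite /dot big1// => i _; rewrite /= subrr mul0r.
Qed.

(* The two weak rotations agree on test fields, in particular on the fields [rot (un n)], which converge to [h']. *)
Lemma weak_rot_norm_le (u h h' : vfield R) (un : nat -> vfield R) :
  vL2 D h -> vL2 D h' -> weak_rot D u h -> weak_rot D u h' -> (forall n, test_vfield D (un n)) ->
  (fun n => vnrm2 D (fun i => rot (un n) i \- h' i)) @ \oo --> 0 ->
  Num.sqrt (vnrm2 D h') <= Num.sqrt (vnrm2 D h).
Proof.
move=> hL hL' wh wh' tu cu.
set X := Num.sqrt (vnrm2 D h'); set Y := Num.sqrt (vnrm2 D h).
have X0 : 0 <= X by exact: sqrtr_ge0.
have Y0 : 0 <= Y by exact: sqrtr_ge0.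
have key : X * X <= X * Y.
  apply: (@le_addMgt0 _ _ (X + Y)); first exact: addr_ge0.
  move=> d d0; have [n hn] := filter_ex (vnorm_cvg0 cu d0).
  have tr : test_vfield D (rot (un n)) := test_vfield_rot (tu n).
  have rL : vL2 D (rot (un n)) by move=> i; exact: test_fun_L2.
  have dL : vL2 D (fun i x => rot (un n) i x - h' i x) by move=> i; exact: L2B.
  have E : integ D (dot h' (rot (un n))) = integ D (dot h (rot (un n))) := etrans (esym (wh' _ tr)) (wh _ tr).
  have XX : X * X = integ D (dot h' h') by rewrite -expr2 sqr_sqrtr// vnrm2_ge0.
  have e1 := integ_dotBr mD hL' rL hL'.
  have e2 := integ_dotBr mD hL rL hL'.
  have s1 := le_trans (ler_norm _) (vCauchySchwarz mD hL hL').
  have s2 := le_trans (ler_norm _) (vCauchySchwarz mD hL dL).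
  have s3 := le_trans (ler_norm _) (vCauchySchwarz mD hL' dL).
  have s3' := vCauchySchwarz mD hL' dL.
  rewrite -/X -/Y in s1 s2 s3 s3'.
  have nX : X * Num.sqrt (vnrm2 D (fun i x => rot (un n) i x - h' i x)) <= X * d by apply: ler_wpM2l.
  have nY : Y * Num.sqrt (vnrm2 D (fun i x => rot (un n) i x - h' i x)) <= Y * d by apply: ler_wpM2l.
  have s4 : - (X * d) <= integ D (dot h' (fun i x => rot (un n) i x - h' i x)).
    by have := le_trans s3' nX; rewrite ler_norml => /andP[].
  have s5 := le_trans s2 nY; rewrite e1 E -XX in s4; rewrite e2 in s5.
  move: s1 s4 s5; rewrite XX mulrDl [X * Y]mulrC.
  move: (integ _ _) (integ _ _) (integ _ _) (Y * X) (X * d) (Y * d) => *; lra.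
have [X00|Xn] := eqVneq X 0; first by rewrite X00.
by move: key; rewrite ler_pM2l// lt_neqAle eq_sym Xn.
Qed.

Variables (eps : pt -> 'M[R]_3) (Me eps_hi : R).
Hypothesis meps : forall i j, measurable_fun D (fun x => eps x i j).
Hypothesis beps : forall i j, {ae @leb3 R, forall x, D x -> `|eps x i j| <= Me}.
Hypothesis seps : {ae @leb3 R, forall x, D x -> (eps x)^T = eps x}.

Lemma mmul_vL2 u : vL2 D u -> vL2 D (mmul eps u).
Proof.
move=> hu i; rewrite (_ : mmul eps u i = fun x => eps x i i0 * u i0 x + eps x i i1 * u i1 x + eps x i i2 * u i2 x).
  have h j : L2 D (fun x => eps x i j * u j x) := L2M mD (meps i j) (beps i j) (hu j).
  by apply: L2D => //; exact: L2D.
by apply/funext => x; rewrite /mmul sum3.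
Qed.

Lemma eps_sym u v : vL2 D u -> vL2 D v ->
  integ D (dot (mmul eps u) v) = integ D (dot (mmul eps v) u).
Proof.
move=> hu hv; have iu := vL2_itg mD (mmul_vL2 hu) hv; have iv := vL2_itg mD (mmul_vL2 hv) hu.
rewrite !integE /Rintegral; congr fine; apply: ae_eq_integral => //.
- by case/integrableP : iu.
- by case/integrableP : iv.
apply: (@filterS _ _ (ae_filter_ringOfSetsType (@mu3 R : {measure set mpt -> \bar R}))) seps.
move=> x hx Dx /=; congr EFin; have S i j : eps x j i = eps x i j by rewrite -{1}(hx Dx) mxE.
by rewrite /dot /mmul !sum3 (S i0 i1) (S i0 i2) (S i1 i2); ring.
Qed.

Lemma enrm2B u v : vL2 D u -> vL2 D v ->
  enrm2 D eps u = enrm2 D eps (fun i x => u i x - v i x) + 2 * integ D (dot (mmul eps u) v) - enrm2 D eps v.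
Proof.
move=> hu hv; have hw : vL2 D (fun i x => u i x - v i x) by move=> i; exact: L2B.
have e1 : enrm2 D eps (fun i x => u i x - v i x) =
  integ D (dot (mmul eps u) (fun i x => u i x - v i x)) - integ D (dot (mmul eps v) (fun i x => u i x - v i x)).
  rewrite -integB//; [|by apply: vL2_itg => //; exact: mmul_vL2|by apply: vL2_itg => //; exact: mmul_vL2].
  by apply: eq_integ => x _; rewrite /dot /mmul !sum3; ring.
rewrite {}e1 !integ_dotBr//; [|exact: mmul_vL2|exact: mmul_vL2].
rewrite (eps_sym hv hu) /enrm2; move: (integ _ _) (integ _ _) (integ _ _) => *; ring.
Qed.

Hypothesis ehi : 0 < eps_hi.
Hypothesis leps : forall u, vL2 D u -> 0 <= enrm2 D eps u <= eps_hi * vnrm2 D u.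

(** Stated for arbitrary admissible constants [c1] and [c2], since the optimal ones are infima in
    the extended reals. *)
Lemma maxwell_estimate (c1 c2 : R) (u h : vfield R) (g : pt -> R) : D !=set0 -> bounded_set D -> convex_set3 D ->
  0 <= c1 -> (forall f G, H10 D f G -> Num.sqrt (nrm2 D f) <= c1 * Num.sqrt (enrm2 D eps G)) ->
  0 <= c2 -> poincare D c2 ->
  Rcirc D u -> L2 D g -> weak_div D (mmul eps u) g -> vL2 D h -> weak_rot D u h ->
  enrm2 D eps u <= (Num.sqrt eps_hi * c2 * Num.sqrt (vnrm2 D h)) ^+ 2 + (c1 * Num.sqrt (nrm2 D g)) ^+ 2.
Proof.
move=> D0 bdD cD c10 hf c20 hp [h' [[hu [hL' wh'] [un [tun [cu cr]]]]]] hg wd hL wh.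
(* The approximating rotations converge to the weak rotation [h'] recorded in [Rcirc]; its norm is
   thereby bounded by that of the given [h]. *)
have hh := weak_rot_norm_le hL hL' wh wh' tun cr.
set k := Num.sqrt eps_hi; set Y := Num.sqrt (vnrm2 D h) in hh *; set a := c1 * Num.sqrt (nrm2 D g).
have k0 : 0 <= k by exact: sqrtr_ge0.
have Y0 : 0 <= Y by exact: sqrtr_ge0.
have main d : 0 < d -> enrm2 D eps u - a ^+ 2 <= (k * c2 * Y + k * (2 + c2) * d) ^+ 2.
  move=> d0.
  have [n [n1 n2]] := filter_ex (filterI (vnorm_cvg0 cu d0) (vnorm_cvg0 cr d0)).
  have [p tp np] := gradient_approx_convex oD D0 bdD cD c20 hp (tun n) d0.
  have pL := test_fun_vL2_grad tp.
  have nL : vL2 D (un n) by move=> i; exact: test_fun_L2 (tun n i).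
  have rL : vL2 D (fun i x => rot (un n) i x - h' i x).
    by move=> i; exact: (L2B mD (test_fun_L2 (test_vfield_rot (tun n) i)) (hL' i)).
  have nr : Num.sqrt (vnrm2 D (rot (un n))) <= Y + d.
    apply: (@le_trans _ _ (Num.sqrt (vnrm2 D (fun i x => h' i x + (rot (un n) i x - h' i x))))).
      by rewrite le_eqVlt; apply/orP; left; apply/eqP; congr Num.sqrt; apply: eq_integ => x _; apply: eq_bigr => i _; rewrite addrCA subrr addr0.
    by apply: le_trans (vnormD mD hL' rL) _; apply: lerD.
  have w1 : vL2 D (fun i x => u i x - un n i x) by move=> i; exact: L2B.
  have w2 : vL2 D (fun i x => un n i x - grad p i x) by move=> i; exact: L2B.
  have w3 : vL2 D (fun i x => u i x - grad p i x) by move=> i; exact: L2B.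
  (* One [d] for replacing [u] by [un n], one for the gradient approximation, and [c2 * d] for the
     rotation of [un n]. *)
  have nN : Num.sqrt (vnrm2 D (fun i x => u i x - grad p i x)) <= c2 * Y + (2 + c2) * d.
    apply: (@le_trans _ _ (Num.sqrt (vnrm2 D (fun i x => (u i x - un n i x) + (un n i x - grad p i x))))).
      by rewrite le_eqVlt; apply/orP; left; apply/eqP; congr Num.sqrt; apply: eq_integ => x _; apply: eq_bigr => i _; rewrite addrA subrK.
    apply: le_trans (vnormD mD w1 w2) _; rewrite vnrm2N.
    apply: le_trans (lerD n1 np) _.
    have : c2 * Num.sqrt (vnrm2 D (rot (un n))) <= c2 * (Y + d) by exact: ler_wpM2l.
    move: (c2 * Num.sqrt _) => z; move: (Y) => Y' hz; lra.
  (* As [p] is a test function, it may be inserted both in the weak divergence and in the inequality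
     for [c1]. *)
  have B : integ D (dot (mmul eps u) (grad p)) <= a * Num.sqrt (enrm2 D eps (grad p)).
    have cs := L2_CauchySchwarz mD hg (test_fun_L2 tp).
    rewrite (wd _ tp); apply: (le_trans (ler_norm _)); rewrite normrN; apply: (le_trans cs).
    rewrite /a [c1 * _]mulrC -mulrA; apply: ler_wpM2l; first exact: sqrtr_ge0.
    exact: hf (test_fun_H10 tp).
  have /andP[F0 _] := leps pL; have /andP[_ E1] := leps w3.
  have E2 : eps_hi * vnrm2 D (fun i x => u i x - grad p i x) <= (k * c2 * Y + k * (2 + c2) * d) ^+ 2.
    rewrite -(sqr_sqrtr (ltW ehi)) -[X in _ * X <= _]sqr_sqrtr ?vnrm2_ge0// -exprMn.
    rewrite -!mulrA -mulrDr -/k !expr2; apply: ler_pM; rewrite ?mulr_ge0 ?sqrtr_ge0//; exact: ler_wpM2l.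
  rewrite (enrm2B hu pL); have F2 := sqr_sqrtr F0.
  move: B F2 (le_trans E1 E2); move: (Num.sqrt (enrm2 D eps (grad p))) => s.
  move: (enrm2 D eps (grad p)) (integ _ _) (enrm2 _ _ _) ((_ * _ * Y + _) ^+ 2) (a) => F b e z a' hb hF he.
  have := sqr_ge0 (a' - s); rewrite sqrrB; lra.
rewrite -lerBlDr; have [t0|t0] := leP (enrm2 D eps u - a ^+ 2) 0.
  by apply: le_trans t0 _; exact: sqr_ge0.
rewrite -(sqr_sqrtr (ltW t0)) !expr2.
have A0 : 0 <= k * c2 * Y by rewrite !mulr_ge0.
suff : Num.sqrt (enrm2 D eps u - a ^+ 2) <= k * c2 * Y by move=> hs; apply: ler_pM.
have C0 : 0 <= k * (2 + c2) by rewrite mulr_ge0// addr_ge0.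
apply: (le_addMgt0 C0) => d d0.
rewrite -[leRHS]ger0_norm; last by rewrite addr_ge0// mulr_ge0// ltW.
by rewrite -sqrtr_sqr ler_wsqrtr// main.
Qed.
End MaxwellEstimate.

Theorem theorem3p5 (R : realType) (Omega : set (pt R)) (eps : pt R -> 'M[R]_3)
  (eps_lo eps_hi : R) :
  open Omega -> Omega !=set0 -> bounded_set Omega -> convex_set3 Omega ->
  (forall i j, measurable_fun Omega (fun x => eps x i j)) ->
  (exists M : R, forall i j, {ae @leb3 R, forall x, Omega x -> `|eps x i j| <= M}) ->
  {ae @leb3 R, forall x, Omega x -> (eps x)^T = eps x} ->
  0 < eps_lo -> 0 < eps_hi ->
  (forall u : vfield R, vL2 Omega u ->
     eps_lo * vnrm2 Omega u <= enrm2 Omega eps u <= eps_hi * vnrm2 Omega u) ->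
  (c_m Omega eps <= maxe (c_f Omega eps) ((Num.sqrt eps_hi)%:E * c_p Omega))%E.
Proof.
move=> oD D0 bD cD meps [Me beps] seps elo0 ehi0 heps.
have [M M0 DM] := bounded_set_cbox bD.
have M1 : 0 < M + 1 by rewrite ltr_wpDl// ltW.
have DL : Omega `<=` box (M + 1).
  by move=> x /DM h i; have := h i; lra.
have leps u : vL2 Omega u -> 0 <= enrm2 Omega eps u <= eps_hi * vnrm2 Omega u.
  move=> /heps/andP[h ->]; rewrite andbT; apply: le_trans h.
  by rewrite mulr_ge0 ?vnrm2_ge0// ltW.
have k0 : 0 < Num.sqrt eps_hi by rewrite sqrtr_gt0.
(* If the bound failed, admissible [c1] and [c2] would exist with [c1] and [sqrt eps_hi * c2] both
   below [c_m], although their maximum is admissible for [c_m]. Infinite values of the constants are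
   covered as well. *)
rewrite leNgt gt_max; apply/negP => /andP[/ereal_inf_lt[_ [c1 [c10 h1] <-] lt1]].
rewrite -lte_pdivlMl// => /ereal_inf_lt[_ [c2 [c20 h2] <-]].
rewrite lte_pdivlMl// -EFinM => lt2.
pose m := Num.max c1 (Num.sqrt eps_hi * c2).
have m0 : 0 <= m by rewrite le_max c10.
have : (m%:E < c_m Omega eps)%E by rewrite /m; case: (leP c1 (Num.sqrt eps_hi * c2)).
apply/negP; rewrite -leNgt; apply: ereal_inf_lbound; exists m => //; split=> // u g h hu _ hg wd hh wr.
have := maxwell_estimate oD M1 DL meps beps seps ehi0 leps D0 bD cD c10 h1 c20 h2 hu hg wd hh wr.
move=> E; rewrite -[X in X * _](ger0_norm m0) -sqrtr_sqr -sqrtrM ?sqr_ge0//; apply: ler_wsqrtr.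
apply: (le_trans E); rewrite [_ ^+ 2 + _]addrC mulrDr; apply: lerD.
  rewrite exprMn sqr_sqrtr ?nrm2_ge0//; apply: ler_wpM2r; first exact: nrm2_ge0.
  by rewrite ler_sqr ?nnegrE// le_max lexx.
rewrite exprMn sqr_sqrtr ?vnrm2_ge0//; apply: ler_wpM2r; first exact: vnrm2_ge0.
by rewrite ler_sqr ?nnegrE ?mulr_ge0 ?(ltW k0)// le_max lexx orbT.
Qed.
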